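(* Let $s>0$, $H=s-\frac d2$, and let $D\subsetneq\mathbb R^d$ be an allowable domain. Let $h_D\sim\mathrm{FGF}_s(D)$ and let $h_D^{\mathrm{Har}}$ be the $s$-harmonic extension field of $D$, sampled independently of each other. Then $h:=h_D^{\mathrm{Har}}+h_D$ (as a random element of $\mathcal S_H'(\mathbb R^d)$) is an $\mathrm{FGF}_s(\mathbb R^d)$. Moreover, $h_D$ and $h_D^{\mathrm{Har}}$ are both almost surely determined by $h$, and the restriction of $h_D^{\mathrm{Har}}$ to $D$ (modulo polynomials of degree at most $\lfloor H\rfloor$, i.e. the collection $(h_D^{\mathrm{Har}},\phi)$, $\phi\in C_c^\infty(D)\cap\mathcal S_H(\mathbb R^d)$) is almost surely determined by the values of $h$ on $\mathbb R^d\setminus D$, i.e. by the random variables $\{(h,\phi):\phi\in T_s(\mathbb R^d),\ \mathrm{supp}(\phi)\subset\mathbb R^d\setminus D\}$.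
   Context: Conventions. $\mathcal S(\mathbb R^d)$ is the real Schwartz space; $\widehat\phi(\xi)=(2\pi)^{-d/2}\int\phi(x)e^{-i\xi\cdot x}dx$. For $r\in\mathbb R$, $\mathcal S_r(\mathbb R^d)$ is the set of $\phi\in\mathcal S(\mathbb R^d)$ with $\int x^\beta\phi(x)dx=0$ for all $|\beta|\le r$ (so $\mathcal S_r=\mathcal S$ if $r<0$), and $\mathcal S'_r(\mathbb R^d)$ is its dual. For $t\in\mathbb R$, $\dot H^t(\mathbb R^d)$ is the Hilbert completion of $\{f\in\mathcal S(\mathbb R^d):|\xi|^t\widehat f\in L^2\}$ under $(f,g)_{\dot H^t}=\int|\xi|^{2t}\widehat f\,\overline{\widehat g}\,d\xi$, identified with the set of $f\in\mathcal S'_{t-d/2}(\mathbb R^d)$ with $\widehat f\in L^2(|\xi|^{2t}d\xi)$. $h\sim\mathrm{FGF}_s(\mathbb R^d)$ means $h$ is a random element of $\mathcal S_H'(\mathbb R^d)$ such that $(h,\phi)\sim\mathcal N(0,\|\phi\|^2_{\dot H^{-s}(\mathbb R^d)})$ for every $\phi\in\mathcal S_H(\mathbb R^d)$. $T_s(\mathbb R^d)$ is the closure of $\mathcal S_H(\mathbb R^d)$ in $\dot H^{-s}(\mathbb R^d)$, and $(h,\phi)$ is defined for $\phi\in T_s(\mathbb R^d)$ by extending the isometry $\phi\mapsto(h,\phi)\in L^2(\Omega)$. A domain (nonempty connected open set) $D$ is allowable (for $s$) if for every $\phi\in\mathcal S(\mathbb R^d)$ there is $C<\infty$ with $|(\phi,g)_{L^2}|\le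 C\|g\|_{\dot H^s(\mathbb R^d)}$ for all $g\in C_c^\infty(D)$. $\dot H^s_0(D)$ is the closure of $C_c^\infty(D)$ in $\dot H^s(\mathbb R^d)$. For $\phi\in\mathcal S(\mathbb R^d)$ let $f_\phi\in\dot H_0^s(D)$ be the unique element with $(f_\phi,g)_{\dot H^s(\mathbb R^d)}=(\phi,g)_{L^2}$ for all $g\in C_c^\infty(D)$, and put $\|\phi\|_{\dot H^{-s}(D)}:=\|f_\phi\|_{\dot H^s(\mathbb R^d)}$. $\mathrm{FGF}_s(D)$ (zero-boundary FGF on $D$) is the law of the random tempered distribution $h_D$ with $(h_D,\phi)\sim\mathcal N(0,\|\phi\|^2_{\dot H^{-s}(D)})$ for all $\phi\in\mathcal S(\mathbb R^d)$. Let $P_D$ be the orthogonal projection of $\dot H^s(\mathbb R^d)$ onto $\dot H^s_0(D)$ and $P_D^{\mathrm{Har}}=I-P_D$, which is the projection onto $\{f\in\dot H^s(\mathbb R^d):((-\Delta)^sf)|_D=0\}$. The $s$-harmonic extension field $h_D^{\mathrm{Har}}$ is the random element of $\mathcal S'_H(\mathbb R^d)$ with $(h_D^{\mathrm{Har}},\phi)\sim\mathcal N(0,\|P_D^{\mathrm{Har}}(-\Delta)^{-s}\phi\|^2_{\dot H^s(\mathbb R^d)})$ for all $\phi\in\mathcal S_H(\mathbb R^d)$, where $(-\Delta)^{-s}\phi\in\dot H^s(\mathbb R^d)$ has Fourier transform $|\xi|^{-2s}\widehat\phi(\xi)$. *)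

(* Defs.v *)
From HB Require Import structures.
From mathcomp Require Import all_boot all_order all_algebra.
From mathcomp Require Import complex.
From mathcomp Require Import all_classical all_reals all_analysis.
Set Implicit Arguments.
Unset Strict Implicit.
Unset Printing Implicit Defensive.
Import Order.TTheory GRing.Theory Num.Theory.
Import numFieldNormedType.Exports.
Local Open Scope classical_set_scope.
Local Open Scope ring_scope.

Section measurable_row.
Context {d : measure_display} {T : measurableType d}.
Variable n : nat.

Let coors : 'I_n -> 'rV[T]_n -> T := fun i x => x ord0 i.

Let row_set0 : g_sigma_preimage coors set0.
Proof. exact: sigma_algebra0. Qed.

Let row_setC A : g_sigma_preimage coors A -> g_sigma_preimage coors (~` A).
Proof. exact: sigma_algebraC. Qed.

Let row_bigcup (F : _^nat) : (forall i, g_sigma_preimage coors (F i)) ->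
  g_sigma_preimage coors (\bigcup_i (F i)).
Proof. exact: sigma_algebra_bigcup. Qed.

(* The product sigma-algebra, which for [T := R] is the Borel one. *)
HB.instance Definition _ := @isMeasurable.Build (measure_tuple_display d)
  'rV[T]_n (g_sigma_preimage coors) row_set0 row_setC row_bigcup.

End measurable_row.

Lemma measurable_coor d (T : measurableType d) n (i : 'I_n) :
  measurable_fun [set: 'rV[T]_n] (fun x : 'rV[T]_n => x ord0 i).
Proof.
move=> _ Y mY; rewrite setTI; apply: sub_sigma_algebra => /=.
rewrite -bigcup_seq/=; exists i => /=; first by rewrite mem_index_enum.
by exists Y => //; rewrite setTI.
Qed.

Lemma measurable_fun_coorP d1 d2 (T1 : measurableType d1)
    (T2 : measurableType d2) n (f : T1 -> 'rV[T2]_n) :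
  measurable_fun [set: T1] f <->
  forall i, measurable_fun [set: T1] (fun t => f t ord0 i).
Proof.
split=> [mf i|mf].
  exact: (measurableT_comp (@measurable_coor _ T2 n i) mf).
have sub : preimage_set_system [set: T1] f
    (g_sigma_preimage (fun (i : 'I_n) (x : 'rV[T2]_n) => x ord0 i)) `<=`
    measurable.
  rewrite -g_sigma_preimage_comp.
  apply: smallest_sub; first exact: sigma_algebra_measurable.
  case: n => [|n] in f mf *; first by rewrite big_ord0.
  rewrite -bigcup_mkord_ord; apply: bigcup_sub => i Ii.
  by move=> A [B mB <-]; exact: mf.
by move=> _ A mA; apply: sub; exists A.
Qed.

Section lebesgue_measure_rV.
Context {R : realType}.

Definition consr n (p : R * 'rV[R]_n) : 'rV[R]_n.+1 :=
  \row_(i < n.+1) if unlift ord0 i is Some j then p.2 ord0 j else p.1.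

Lemma measurable_consr n :
  measurable_fun [set: measurableTypeR R * 'rV[R]_n]
    (@consr n : _ -> 'rV[R]_n.+1).
Proof.
apply/measurable_fun_coorP => i; rewrite /consr.
case: (unliftP ord0 i) => [j|] ->.
  under eq_fun do rewrite mxE liftK.
  exact: (measurableT_comp (@measurable_coor _ _ n j) measurable_snd).
under eq_fun do rewrite mxE unlift_none.
exact: measurable_fst.
Qed.

Definition consr_measure n
    (m : {sigma_finite_measure set 'rV[R]_n -> \bar R}) :
    set 'rV[R]_n.+1 -> \bar R :=
  pushforward (@lebesgue_measure R \x m)%E (@consr n).

Section consr_measure_instances.
Variables (n : nat)
  (m : {sigma_finite_measure set 'rV[R]_n -> \bar R}).

Let consr0 : consr_measure m set0 = 0%E.
Proof. by rewrite /consr_measure /pushforward preimage_set0 measure0. Qed.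

Let consr_ge0 A : (0 <= consr_measure m A)%E.
Proof. by rewrite /consr_measure /pushforward measure_ge0. Qed.

Let consr_sigma_additive : semi_sigma_additive (consr_measure m).
Proof.
exact: (measure_semi_sigma_additive (s :=
  measure_function_pushforward__canonical__measure_function_Measure
    (lebesgue_measure \x m)%E (@measurable_consr n))).
Qed.

HB.instance Definition _ := @isMeasure.Build _ _ _ (consr_measure m)
  consr0 consr_ge0 consr_sigma_additive.

Let consr_sigma_finite : sigma_finite setT (consr_measure m).
Proof.
have /sigma_finiteP[F [TF ndF Foo]] := sigma_finiteT (@lebesgue_measure R).
have /sigma_finiteP[G [TG ndG Goo]] := sigma_finiteT m.
pose u (x : 'rV[R]_n.+1) : R * 'rV[R]_n :=
  (x ord0 ord0, \row_i x ord0 (lift ord0 i)).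
have consrK : cancel (@consr n) u.
  case=> a x; rewrite /u /consr mxE unlift_none; congr pair.
  by apply/rowP => i; rewrite !mxE liftK.
have mu_ : measurable_fun [set: 'rV[R]_n.+1]
    (u : _ -> measurableTypeR R * 'rV[R]_n).
  apply: measurable_fun_pair; first exact: measurable_coor.
  apply/measurable_fun_coorP => i.
  under eq_fun do rewrite mxE.
  exact: measurable_coor.
exists (fun k => u @^-1` (F k `*` G k)).
  apply/esym; rewrite -subTset => x _.
  have [k1 _ Fk1] : (\bigcup_k F k) (u x).1 by rewrite -TF.
  have [k2 _ Gk2] : (\bigcup_k G k) (u x).2 by rewrite -TG.
  exists (maxn k1 k2) => //; split.
    by move: Fk1; exact/subsetPset/ndF/leq_maxl.
  by move: Gk2; exact/subsetPset/ndG/leq_maxr.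
move=> k; have [mF Fk] := Foo k; have [mG Gk] := Goo k; split.
  by rewrite -[X in measurable X]setTI; apply: mu_ => //; exact: measurableX.
rewrite /consr_measure /pushforward -comp_preimage.
rewrite (_ : u \o _ = id); last by apply/funext => p /=; rewrite consrK.
by rewrite /= product_measure1E// lte_mul_pinfty// ge0_fin_numE.
Qed.

HB.instance Definition _ := Measure_isSigmaFinite.Build _ _ _
  (consr_measure m) consr_sigma_finite.

End consr_measure_instances.

Fixpoint lebesgue_rV n :
    {sigma_finite_measure set 'rV[R]_n -> \bar R} :=
  match n with
  | 0 => @dirac _ 'rV[R]_0 0 R
  | k.+1 => consr_measure (lebesgue_rV k)
  end.

End lebesgue_measure_rV.

Notation lebd := (lebesgue_rV _).

Section euclidean_space.
Context {R : realType} {d : nat}.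
Implicit Types (x xi : 'rV[R]_d) (phi g : 'rV[R]_d -> R).

Definition dot x xi : R := \sum_(i < d) x ord0 i * xi ord0 i.

(* The Euclidean norm; the library norm on ['rV[R]_d] is the sup norm. *)
Definition enorm x : R := Num.sqrt (dot x x).

Definition mdeg (a : 'I_d -> nat) : nat := (\sum_(i < d) a i)%N.

Definition monom (a : 'I_d -> nat) x : R := \prod_(i < d) x ord0 i ^+ a i.

(* Iterated partial derivatives are indexed by the word of the directions in
   which one differentiates; the order of derivation is [size w]. *)
Definition partials (w : seq 'I_d) phi : 'rV[R]_d -> R :=
  foldr (fun i (f : 'rV[R]_d -> R) x => 'D_(delta_mx ord0 i) f x) phi w.

Definition smooth phi : Prop :=
  forall (w : seq 'I_d) x, differentiable (partials w phi) x.

(* C_c^oo(D) *)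
Definition test_fun (D : set 'rV[R]_d) : set ('rV[R]_d -> R) :=
  [set g | [/\ smooth g, compact (closure [set x | g x != 0])
             & closure [set x | g x != 0] `<=` D]].

Definition schwartz : set ('rV[R]_d -> R) :=
  [set phi | smooth phi /\ forall (a : 'I_d -> nat) (w : seq 'I_d),
    exists C : R, forall x, `|monom a x * partials w phi x| <= C].

(* S_r(R^d) *)
Definition schwartz_mom (r : R) : set ('rV[R]_d -> R) :=
  [set phi | schwartz phi /\ forall a : 'I_d -> nat, (mdeg a)%:R <= r ->
    \int[lebd]_x (monom a x * phi x) = 0].

Definition schwartz_norm (n : nat) phi : R :=
  sup [set y | exists (a : 'I_d -> nat) (w : seq 'I_d) x,
    [/\ (mdeg a <= n)%N, (size w <= n)%N &
        y = `|monom a x * partials w phi x|]].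

Definition l2pair phi g : R := \int[lebd]_x (phi x * g x).

Definition cintegral (F : 'rV[R]_d -> R[i]) : R[i] :=
  ((\int[lebd]_x complex.Re (F x)) +i* (\int[lebd]_x complex.Im (F x)))%C.

Definition fourier phi xi : R[i] :=
  ((2 * pi) `^ (- (d%:R / 2)))%:C%C *
  cintegral (fun x =>
    (phi x)%:C%C * (cos (dot x xi) -i* sin (dot x xi))%C).

End euclidean_space.

(* A functional is given by its values on all functions, but only its values
   on the relevant space of test functions are meaningful: an element of S'_r is
   determined by its restriction to S_r, and takes junk values elsewhere. *)
Notation functional R d := (('rV[R]_d -> R) -> R).

Section distributions.
Context {R : realType} {d : nat}.
Implicit Types (phi g psi : 'rV[R]_d -> R) (T U : functional R d).
Implicit Types (D : set 'rV[R]_d) (F : 'rV[R]_d -> R[i]) (r s t : R).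

(* S'_r(R^d): continuous linear functionals on S_r for the Schwartz topology *)
Definition dual r : set (functional R d) :=
  [set T | (forall (c : R) phi psi,
             schwartz_mom r phi -> schwartz_mom r psi ->
             T (fun x => c * phi x + psi x) = c * T phi + T psi) /\
           exists (C : R) (n : nat), forall phi, schwartz_mom r phi ->
             `|T phi| <= C * schwartz_norm n phi].

Definition dist_of g : functional R d := l2pair g.

(* Support of a distribution: the complement of the union of all the open sets
   on which it vanishes *)
Definition dist_supp T : set 'rV[R]_d :=
  ~` \bigcup_(U in [set U : set 'rV[R]_d |
        open U /\ forall g, test_fun U g -> T g = 0]) U.

(* [F] is the Fourier transform of [T] in S'_{t-d/2}, and it belongs to
   L^2(|xi|^{2t} dxi); it is unique up to a.e. equality.  For real [phi], the
   duality defining the Fourier transform of [T] is the Parseval formula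
   T phi = int F (conj (fourier phi)). *)
Definition is_fourier t T F : Prop :=
  [/\ measurable_fun setT (fun xi => complex.Re (F xi)),
      measurable_fun setT (fun xi => complex.Im (F xi)),
      (\int[lebd]_xi ((enorm xi `^ (2 * t)) *
          (complex.Re (F xi) ^+ 2 + complex.Im (F xi) ^+ 2))%:E < +oo)%E
    & forall phi, schwartz_mom (t - d%:R / 2) phi ->
        (T phi)%:C%C = cintegral (fun xi => F xi * (fourier phi xi)^*%C)].

(* The homogeneous Sobolev space \dot H^t(R^d) *)
Definition hdot t : set (functional R d) :=
  [set T | dual (t - d%:R / 2) T /\ exists F, is_fourier t T F].

Definition fourier_hdot t T : 'rV[R]_d -> R[i] :=
  xget (fun=> 0) [set F | is_fourier t T F].

Definition hdot_inner t T U : R[i] :=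
  cintegral (fun xi => (enorm xi `^ (2 * t))%:C%C *
    (fourier_hdot t T xi * (fourier_hdot t U xi)^*%C)).

Definition hdot_norm t T : R := Num.sqrt (complex.Re (hdot_inner t T T)).

Definition hdot_closure t (A : set ('rV[R]_d -> R)) : set (functional R d) :=
  [set T | hdot t T /\ forall e : R, 0 < e ->
    exists2 g, A g & hdot_norm t (T \- dist_of g) < e].

Definition hurst s : R := s - d%:R / 2.

(* T_s(R^d) *)
Definition Tspace s : set (functional R d) :=
  hdot_closure (- s) (schwartz_mom (hurst s)).

(* \dot H^s_0(D) *)
Definition hdot0 s D : set (functional R d) := hdot_closure s (test_fun D).

Definition domain D : Prop := [/\ D !=set0, open D & connected D].

Definition allowable s D : Prop :=
  domain D /\ forall phi, schwartz phi -> exists C : R,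
    forall g, test_fun D g ->
      `|l2pair phi g| <= C * hdot_norm s (dist_of g).

(* The representative f_phi of [phi] in \dot H^s_0(D) *)
Definition riesz s D phi : functional R d :=
  get [set f | hdot0 s D f /\
    forall g, test_fun D g -> hdot_inner s f (dist_of g) = (l2pair phi g)%:C%C].

Definition hdot_dom_norm s D phi : R := hdot_norm s (riesz s D phi).

(* The orthogonal projection P_D of \dot H^s onto \dot H^s_0(D) *)
Definition projD s D T : functional R d :=
  get [set U | hdot0 s D U /\
    forall V, hdot0 s D V -> hdot_inner s (T \- U) V = 0].

Definition projHar s D T : functional R d := T \- projD s D T.

(* The element (-Delta)^{-s} phi of \dot H^s, with Fourier transform
   |xi|^{-2s} (fourier phi); the integral below is real, since Fourier
   transforms of real functions are Hermitian. *)
Definition inv_laplacian s phi : functional R d := fun psi =>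
  complex.Re (cintegral (fun xi =>
    ((enorm xi `^ (- (2 * s)))%:C%C * fourier phi xi) *
    (fourier psi xi)^*%C)).

End distributions.

Section random_fields.
Context {disp : measure_display} {Omega : measurableType disp} {R : realType}.
Variable P : probability Omega R.

(* X ~ N(0, v), where N(0, 0) is the Dirac mass at 0 *)
Definition centered_gaussian (v : R) (X : Omega -> R) : Prop :=
  measurable_fun setT X /\ forall A : set R, measurable A ->
    P (X @^-1` A) =
      if v == 0 then \d_(0 : R) A else normal_prob 0 (Num.sqrt v) A.

(* The sigma-algebra generated by the variables [X i], [i] in [J] *)
Definition sigma_of (I : Type) (J : set I) (X : I -> Omega -> R) :
    set (set Omega) :=
  <<s [set A | exists i (B : set R), [/\ J i, measurable B & A = X i @^-1` B]] >>.

Definition independent_sigma (G1 G2 : set (set Omega)) : Prop :=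
  forall A B, G1 A -> G2 B -> P (A `&` B) = (P A * P B)%E.

(* A random object generating [G1] is almost surely determined by one
   generating [G2] when it is measurable with respect to the P-completion
   of [G2]. *)
Definition as_determined (G1 G2 : set (set Omega)) : Prop :=
  forall A, G1 A -> exists2 B, G2 B & P.-negligible ((A `\` B) `|` (B `\` A)).

Context {d : nat}.
Implicit Types (h : Omega -> functional R d) (D : set 'rV[R]_d).

(* Random elements of S'_r, for the sigma-algebra generated by the
   evaluations *)
Definition random_dual (r : R) h : Prop :=
  (forall w, dual r (h w)) /\
  forall phi, schwartz_mom r phi -> measurable_fun setT (fun w => h w phi).

Definition sigma_field (V : set ('rV[R]_d -> R)) h : set (set Omega) :=
  sigma_of V (fun phi w => h w phi).

(* h ~ FGF_s(R^d) *)
Definition FGF (s : R) h : Prop :=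
  random_dual (hurst (d := d) s) h /\
  forall phi, schwartz_mom (hurst (d := d) s) phi ->
    centered_gaussian (hdot_norm (- s) (dist_of phi) ^+ 2) (fun w => h w phi).

(* h ~ FGF_s(D); the moment condition is void for a negative index, so that
   [random_dual (-1)] are the random tempered distributions. *)
Definition FGF_dom (s : R) D h : Prop :=
  random_dual (-1) h /\
  forall phi, schwartz phi ->
    centered_gaussian (hdot_dom_norm s D phi ^+ 2) (fun w => h w phi).

Definition harmonic_extension_field (s : R) D h : Prop :=
  random_dual (hurst (d := d) s) h /\
  forall phi, schwartz_mom (hurst (d := d) s) phi ->
    centered_gaussian (hdot_norm s (projHar s D (inv_laplacian s phi)) ^+ 2)
      (fun w => h w phi).

(* [Z] is a version of (h, psi), where (h, .) is extended from S_H to T_s as an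
   isometry into L^2(Omega) *)
Definition ext_pairing (s : R) h (psi : functional R d) (Z : Omega -> R) : Prop :=
  measurable_fun setT Z /\
  exists phi_ : nat -> 'rV[R]_d -> R,
    [/\ forall n, schwartz_mom (hurst (d := d) s) (phi_ n),
        (fun n => hdot_norm (- s) (psi \- dist_of (phi_ n))) @ \oo --> (0 : R)
      & (fun n => \int[P]_w (((h w (phi_ n) - Z w) ^+ 2)%R)%:E)%E @ \oo
          --> (0 : \bar R)%E].

(* The sigma-algebra of the values of [h] on the complement of [D] *)
Definition sigma_outside (s : R) D h : set (set Omega) :=
  sigma_of [set Z | exists psi : functional R d,
    [/\ Tspace s psi, dist_supp psi `<=` ~` D & ext_pairing s h psi Z]] id.

End random_fields.

(* Main.v *)
Require Import Defs.
From HB Require Import structures.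
From mathcomp Require Import all_boot all_order all_algebra.
From mathcomp Require Import ring lra.
From mathcomp Require Import complex.
From mathcomp Require Import all_classical all_reals all_analysis measurable_realfun.
Set Implicit Arguments.
Unset Strict Implicit.
Unset Printing Implicit Defensive.
Import Order.TTheory GRing.Theory Num.Theory.
Import numFieldNormedType.Exports.
Local Open Scope classical_set_scope.
Local Open Scope ring_scope.

(* On the Fourier side \dot H^t is the space of the L^2(|xi|^{2t} dxi) functions whose
   pairings with Fourier transforms of real test functions are real, and the
   transforms of S_H are dense in it.  The projection P_D sends (-Delta)^{-s} phi to
   the Riesz representative f_phi, so Pythagoras gives
     |phi|^2_{\dot H^{-s}(R^d)} =
       |phi|^2_{\dot H^{-s}(D)} + |P_D^Har (-Delta)^{-s} phi|^2,
   and a sum of independent centered Gaussians is Gaussian: h is an FGF_s(R^d).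

   For the measurability claims, density of S_H gives psi in S_H with
   (-Delta)^{-s} psi close to f_phi; then (h, psi) - (h_D, phi) has small variance, and
   (h_D, phi) is an almost sure limit of variables (h, psi_n).  Likewise, (h^Har, phi)
   is a version of (h, psi) for psi = (-Delta)^s P_D^Har (-Delta)^{-s} phi, an element
   of T_s supported outside of D. *)

(** * Integration on R^d *)

Section real_integral.
Context {disp : measure_display} {T : measurableType disp} {R : realType}.
Variable m : {measure set T -> \bar R}.
Implicit Types f g : T -> R.

Definition L1 f : Prop := m.-integrable setT (EFin \o f).

Lemma L1P f : L1 f <->
  measurable_fun setT f /\ (\int[m]_x `|f x|%:E < +oo)%E.
Proof.
split=> [/integrableP[mf fi]|[mf fi]]; first by split=> //; exact/measurable_EFinP.
by apply/integrableP; split=> //; exact/measurable_EFinP.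
Qed.

Lemma L1_measurable f : L1 f -> measurable_fun setT f.
Proof. by case/L1P. Qed.

Lemma L1_le g f : measurable_fun setT f -> L1 g ->
  (forall x, `|f x| <= g x) -> L1 f.
Proof.
move=> mf Lg fg; apply: (le_integrable measurableT) Lg; first exact/measurable_EFinP.
by move=> x _ /=; rewrite lee_fin (le_trans (fg x))// ler_norm.
Qed.

Lemma L1D f g : L1 f -> L1 g -> L1 (fun x => f x + g x).
Proof.
by move=> Lf Lg; apply: eq_integrable (integrableD measurableT Lf Lg).
Qed.

Lemma L1B f g : L1 f -> L1 g -> L1 (fun x => f x - g x).
Proof.
by move=> Lf Lg; apply: eq_integrable (integrableB measurableT Lf Lg).
Qed.

Lemma L1Z (c : R) f : L1 f -> L1 (fun x => c * f x).
Proof.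
by move=> Lf; apply: eq_integrable (integrableZl measurableT c Lf).
Qed.

Lemma L1N f : L1 f -> L1 (fun x => - f x).
Proof. by move=> /(L1Z (-1)); under eq_fun do rewrite mulN1r. Qed.

Lemma L10 : L1 (fun=> 0).
Proof. exact: integrable0. Qed.

Lemma L1_norm f : L1 f -> L1 (fun x => `|f x|).
Proof. exact: integrable_norm. Qed.

Lemma L1_Mb (C : R) f g : L1 f -> measurable_fun setT g ->
  (forall x, `|g x| <= C) -> L1 (fun x => f x * g x).
Proof.
move=> Lf mg gC; apply: (@L1_le (fun x => C * `|f x|)).
- by apply: measurable_funM => //; exact: L1_measurable.
- exact/L1Z/L1_norm.
- by move=> x; rewrite normrM mulrC ler_wpM2r.
Qed.

Lemma Rint_ge0E f : measurable_fun setT f -> (forall x, 0 <= f x) ->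
  (\int[m]_x (f x)%:E < +oo)%E -> L1 f.
Proof.
move=> mf f0 fi; apply/L1P; split=> //.
by under eq_integral do rewrite ger0_norm//.
Qed.

Lemma L1_ltoo f : L1 f -> (\int[m]_x (f x)%:E < +oo)%E.
Proof. by move=> Lf; rewrite integrable_lty. Qed.

Lemma RintE f : L1 f -> (\int[m]_x f x)%:E = (\int[m]_x (f x)%:E)%E.
Proof.
by move=> Lf; rewrite fineK//; exact: integrable_fin_num.
Qed.

Lemma RintD f g : L1 f -> L1 g ->
  \int[m]_x (f x + g x) = \int[m]_x f x + \int[m]_x g x.
Proof. exact: RintegralD. Qed.

Lemma RintB f g : L1 f -> L1 g ->
  \int[m]_x (f x - g x) = \int[m]_x f x - \int[m]_x g x.
Proof. exact: RintegralB. Qed.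

Lemma RintZ (c : R) f : L1 f -> \int[m]_x (c * f x) = c * \int[m]_x f x.
Proof. exact: RintegralZl. Qed.

Lemma RintN f : L1 f -> \int[m]_x (- f x) = - \int[m]_x f x.
Proof.
move=> Lf; rewrite -mulN1r -RintZ//; congr Rintegral.
by apply/funext => x; rewrite mulN1r.
Qed.

Lemma eq_Rint f g : f =1 g -> \int[m]_x f x = \int[m]_x g x.
Proof. by move=> /funext ->. Qed.

Lemma Rint_le f g : L1 f -> L1 g -> (forall x, f x <= g x) ->
  \int[m]_x f x <= \int[m]_x g x.
Proof. by move=> Lf Lg fg; apply: le_Rintegral. Qed.

Lemma Rint_norm f : L1 f -> `|\int[m]_x f x| <= \int[m]_x `|f x|.
Proof. exact: le_normr_Rintegral. Qed.

Lemma Rintegral0 : \int[m]_x (0 : R) = 0.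
Proof. by rewrite /Rintegral integral0. Qed.

Lemma L1_sum I (r : seq I) (F : I -> T -> R) : (forall i, L1 (F i)) ->
  L1 (fun x => \sum_(i <- r) F i x).
Proof.
move=> LF; elim: r => [|i r IH].
  by under eq_fun do rewrite big_nil; exact: L10.
by under eq_fun do rewrite big_cons; exact: L1D.
Qed.

Lemma Rint_sum I (r : seq I) (F : I -> T -> R) : (forall i, L1 (F i)) ->
  \int[m]_x (\sum_(i <- r) F i x) = \sum_(i <- r) \int[m]_x F i x.
Proof.
move=> LF; elim: r => [|i r IH].
  by under eq_Rint do rewrite big_nil; rewrite Rintegral0 big_nil.
under eq_Rint do rewrite big_cons; rewrite RintD ?IH ?big_cons//.
exact: L1_sum.
Qed.

Lemma Rint_ae f g : measurable_fun setT f -> measurable_fun setT g ->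
  {ae m, forall x, f x = g x} -> \int[m]_x f x = \int[m]_x g x.
Proof.
move=> mf mg fg; congr fine; apply: ae_eq_integral => //.
- exact/measurable_EFinP.
- exact/measurable_EFinP.
- by apply: filterS fg => x /= -> _.
Qed.

Lemma L1_ae f g : measurable_fun setT g -> L1 f ->
  {ae m, forall x, f x = g x} -> L1 g.
Proof.
move=> mg /L1P[mf fi] fg; apply/L1P; split=> //.
rewrite (ae_eq_integral (fun x => `|f x|%:E))//.
- by apply/measurable_EFinP; exact: measurableT_comp.
- by apply/measurable_EFinP; exact: measurableT_comp.
- by apply: filterS fg => x /= -> _.
Qed.

Lemma Rint_dct (f_ : nat -> T -> R) f g :
  (forall n, measurable_fun setT (f_ n)) -> measurable_fun setT f ->
  (forall x, f_ ^~ x @ \oo --> f x) -> L1 g -> (forall n x, `|f_ n x| <= g x) ->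
  (fun n => \int[m]_x f_ n x) @ \oo --> \int[m]_x f x.
Proof.
move=> mf_ mf f_f Lg f_g.
have [||||Lf _] := @dominated_convergence _ T R m setT measurableT
  (fun n => EFin \o f_ n) (EFin \o f) (EFin \o g) _ _ _ Lg.
- by move=> n; exact/measurable_EFinP.
- exact/measurable_EFinP.
- by apply: aeW => x _; apply: cvg_EFin; [exact: nearW|exact: f_f].
- by apply: aeW => x n _; rewrite /= lee_fin.
move=> h; apply: (@fine_cvg R _ _ _ _ (\int[m]_x f x)).
rewrite fineK; last exact: integrable_fin_num.
exact: h.
Qed.

End real_integral.

Section real_fubini.
Context d1 d2 {T1 : measurableType d1} {T2 : measurableType d2} {R : realType}.
Variables (m1 : {sigma_finite_measure set T1 -> \bar R})
  (m2 : {sigma_finite_measure set T2 -> \bar R}).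
Variables (a : T1 -> R) (b : T2 -> R) (f : T1 -> T2 -> R).
Hypotheses (La : L1 m1 a) (Lb : L1 m2 b)
  (mf : measurable_fun [set: T1 * T2] (fun p => f p.1 p.2))
  (fab : forall x y, `|f x y| <= `|a x| * `|b y|).

Let L1_section x : L1 m2 (f x).
Proof.
apply: L1_le (L1Z `|a x| (L1_norm Lb)) (fab x).
rewrite (_ : f x = (fun p => f p.1 p.2) \o pair x)//.
apply: measurableT_comp => //; exact: measurable_fun_pair.
Qed.

Let L1_section' y : L1 m1 (f ^~ y).
Proof.
apply: (@L1_le _ _ _ _ (fun x => `|b y| * `|a x|)) => [||x]; last by rewrite mulrC.
- rewrite (_ : f^~ y = (fun p => f p.1 p.2) \o (pair^~ y))//.
  apply: measurableT_comp => //; exact: measurable_fun_pair.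
- exact/L1Z/L1_norm.
Qed.

Let Lf : (m1 \x m2)%E.-integrable setT (fun p => (f p.1 p.2)%:E).
Proof.
apply/integrable12ltyP; first exact/measurable_EFinP.
apply: (@le_lt_trans _ _ (\int[m1]_x (`|a x| * \int[m2]_y `|b y|)%:E)%E).
  apply: ge0_le_integral => //=.
  - by move=> x _; apply: integral_ge0 => y _; rewrite lee_fin.
  - have mF : measurable_fun [set: T1 * T2] (fun p => (`|f p.1 p.2|)%:E).
      by apply/measurable_EFinP; exact: measurableT_comp.
    exact: (measurable_fun_fubini_tonelli_F _ mF).
  - apply/measurable_EFinP; apply: measurable_funM => //.
    exact: L1_measurable (L1_norm La).
  - move=> x _.
    rewrite -(RintE (L1_norm (L1_section x))) lee_fin -RintZ; last exact: L1_norm.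
    apply: Rint_le (fab x); first exact/L1_norm/L1_section.
    exact/L1Z/L1_norm.
apply: L1_ltoo; under eq_fun do rewrite mulrC; exact/L1Z/L1_norm.
Qed.

Lemma L1_Rint_section : L1 m1 (fun x => \int[m2]_y f x y).
Proof.
apply: eq_integrable (integrable_fubini_F Lf) => // x _.
by rewrite /= RintE.
Qed.

Lemma Rint_fubini :
  \int[m1]_x (\int[m2]_y f x y) = \int[m2]_y (\int[m1]_x f x y).
Proof.
rewrite [LHS]/Rintegral [RHS]/Rintegral; congr fine.
under eq_integral do rewrite (RintE (L1_section _)).
under [RHS]eq_integral do rewrite (RintE (L1_section' _)).
exact: (Fubini Lf).
Qed.

End real_fubini.

Section rV_norm.
Context {R : realType}.

Lemma rV_norm_le n (x : 'rV[R]_n) (e : R) : 0 <= e ->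
  (forall i, `|x ord0 i| <= e) -> `|x| <= e.
Proof.
move=> e0 xe; rewrite /Num.norm/= mx_normrE; apply: bigmax_le => // -[i j] _.
by rewrite ord1.
Qed.

End rV_norm.

Section lebd_toolkit.
Context {R : realType}.
Local Notation leb := (@lebesgue_measure R).
Local Notation mu d := (@lebesgue_rV R d).

Lemma ge0_integral_consr n (f : 'rV[R]_n.+1 -> \bar R) :
  measurable_fun setT f -> (forall x, 0 <= f x)%E ->
  (\int[mu n.+1]_x f x = \int[leb]_a \int[mu n]_x f (consr (a, x)))%E.
Proof.
move=> mf f0.
transitivity (\int[pushforward (leb \x mu n)%E (@consr _ n)]_x f x)%E.
  by [].
rewrite ge0_integral_pushforward//; last exact: measurable_consr.
rewrite preimage_setT fubini_tonelli1//.
  by apply: measurableT_comp => //; exact: measurable_consr.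
by move=> ? /=.
Qed.

Lemma measurable_consrl n (a : R) :
  measurable_fun setT (fun x : 'rV[R]_n => consr (a, x)).
Proof.
rewrite (_ : (fun _ => _) = (@consr _ n) \o pair a)//.
apply: measurableT_comp; first exact: measurable_consr.
exact: measurable_fun_pair.
Qed.

Lemma consr0 n (p : R * 'rV[R]_n) : consr p ord0 ord0 = p.1.
Proof. by rewrite mxE unlift_none. Qed.

Lemma consrS n (p : R * 'rV[R]_n) i : consr p ord0 (lift ord0 i) = p.2 ord0 i.
Proof. by rewrite mxE liftK. Qed.

Lemma dirac_lebd0 (f : 'rV[R]_0 -> \bar R) : (\int[mu 0]_x f x = f 0%R)%E.
Proof.
rewrite (_ : f = cst (f 0)) ?integral_cst//=; last first.
  by apply/funext => x; rewrite (thinmx0 x).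
by rewrite diracT mule1.
Qed.

Lemma ge0_integral_prod_coor n (f : 'I_n -> R -> R) :
  (forall i, measurable_fun setT (f i)) -> (forall i x, 0 <= f i x) ->
  (\int[mu n]_x (\prod_(i < n) f i (x ord0 i))%:E =
   \prod_(i < n) \int[leb]_a (f i a)%:E)%E.
Proof.
elim: n f => [|n IH] f mf f0; first by rewrite dirac_lebd0 !big_ord0.
have mprod k (g : 'I_k -> R -> R) : (forall i, measurable_fun setT (g i)) ->
    measurable_fun setT (fun x : 'rV[R]_k => \prod_(i < k) g i (x ord0 i)).
  move=> mg; apply: measurable_prod => i _.
  exact: (measurableT_comp (mg i) (@measurable_coor _ _ k i)).
rewrite ge0_integral_consr; last 2 first.
- by apply/measurable_EFinP; exact: mprod.
- by move=> x; rewrite lee_fin prodr_ge0.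
rewrite big_ord_recl/= -IH//.
under eq_integral => a _.
  under eq_integral => x _.
    rewrite big_ord_recl consr0/=.
    under eq_bigr do rewrite consrS/=.
    rewrite EFinM; over.
  rewrite /= ge0_integralZl_EFin//; last 2 first.
  - by move=> x _; rewrite lee_fin prodr_ge0.
  - by apply/measurable_EFinP; apply: (mprod n (fun i => f (lift ord0 i))).
  over.
rewrite ge0_integralZr//.
- by apply/measurable_EFinP; exact: (mf ord0).
- by move=> x _; rewrite lee_fin.
- by apply: integral_ge0 => x _; rewrite lee_fin prodr_ge0.
Qed.

Lemma L1_prod_coor n (f : 'I_n -> R -> R) :
  (forall i, L1 leb (f i)) ->
  L1 (mu n) (fun x => \prod_(i < n) f i (x ord0 i)).
Proof.
move=> Lf; apply/L1P; split.
  apply: measurable_prod => i _.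
  exact: (measurableT_comp (L1_measurable (Lf i)) (@measurable_coor _ _ n i)).
under eq_integral do rewrite normr_prod.
rewrite (ge0_integral_prod_coor (f := fun i a => `|f i a|))//; last first.
  by move=> i; apply: L1_measurable (L1_norm (Lf i)).
apply: (@proj2 (0 <= \prod_(i < n) \int[leb]_a `|f i a|%:E)%E).
elim/big_ind : _ => [|x y [x0 hx] [y0 hy]|i _]; rewrite ?ltry ?lee01//.
- by split; [exact: mule_ge0|rewrite lte_mul_pinfty// ge0_fin_numE].
- split; last exact: L1_ltoo (L1_norm (Lf i)).
  by apply: integral_ge0 => x _; rewrite lee_fin.
Qed.

Lemma lebd_coor0 n (i : 'I_n) (c : R) :
  mu n [set x | x ord0 i = c] = 0%E.
Proof.
have mE : measurable [set x : 'rV[R]_n | x ord0 i = c].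
  rewrite (_ : [set _ | _] = (fun x : 'rV[R]_n => x ord0 i) @^-1` [set c])//.
  by rewrite -[X in measurable X]setTI; apply: (@measurable_coor _ _ n i).
rewrite -[X in mu n X]setIT -integral_indic//.
transitivity (\int[mu n]_x (\prod_(j < n)
    (if j == i then \1_[set c] else cst 1) (x ord0 j) : R)%:E)%E.
  apply: eq_integral => x _; rewrite (bigD1 i)//= eqxx big1 ?mulr1.
    by rewrite !indicE; congr (_%:R%:E); apply/idP/idP; rewrite !inE.
  by move=> j /negbTE ->.
rewrite (ge0_integral_prod_coor
  (f := fun j => if j == i then \1_[set c] else cst 1)).
- rewrite (bigD1 i)//= eqxx integral_indic//= setIT lebesgue_measure_set1 mul0e//.
- by move=> j; case: eqP => // _; exact: measurable_indic.
- by move=> j x; case: eqP => _ //=; rewrite indicE.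
Qed.

Definition affine (c b : R) (a : R) : measurableTypeR R := c + b * a.

Lemma measurable_affine (c b : R) : measurable_fun setT (affine c b).
Proof. by apply: measurable_funD => //; exact: measurable_funM. Qed.

Lemma lebesgue_measure_affine (c b : R) : b != 0 -> forall A, measurable A ->
  (leb A = `|b|%:E * leb (affine c b @^-1` A))%E.
Proof.
move=> b0.
have b1 : 0 <= `|b| by [].
pose m := mscale (NngNum b1) (measure_function_pushforward__canonical__measure_function_Measure leb (measurable_affine c b)).
move=> A mA.
apply: (@lebesgue_measure_unique _ m) => // X [[x y]] _ <-.
rewrite [RHS](_ : _ = `|b|%:E * leb (affine c b @^-1` `]x, y]))%E//.
have [bpos|bneg] : b > 0 \/ b < 0 by case: (ltgtP b 0) b0; auto.
- rewrite (_ : _ @^-1` _ = `](x - c) / b, (y - c) / b]%classic); last first.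
    apply/seteqP; split => a; rewrite /affine /= !in_itv/= ltr_pdivrMr// ler_pdivlMr//.
      by case/andP=> ? ?; apply/andP; split; lra.
    by case/andP=> ? ?; apply/andP; split; lra.
  rewrite !lebesgue_measure_itv/= !lte_fin ltr_pM2r ?invr_gt0//.
  rewrite ltrD2r; case: ifPn => _; last by rewrite mule0.
  rewrite -!EFinB -EFinM gtr0_norm//; congr EFin; field; exact: lt0r_neq0.
- rewrite (_ : _ @^-1` _ = `[(y - c) / b, (x - c) / b[%classic); last first.
    apply/seteqP; split => a; rewrite /affine /= !in_itv/= ler_ndivrMr// ltr_ndivlMr//.
      by case/andP=> ? ?; apply/andP; split; lra.
    by case/andP=> ? ?; apply/andP; split; lra.
  rewrite !lebesgue_measure_itv/= !lte_fin ltr_nM2r ?invr_lt0//.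
  rewrite ltrD2r; case: ifPn => _; last by rewrite mule0.
  rewrite -!EFinB -EFinM ltr0_norm//; congr EFin; field; exact: ltr0_neq0.
Qed.

Lemma ge0_integral_affine1 (c b : R) (f : R -> \bar R) : b != 0 ->
  measurable_fun setT f -> (forall x, 0 <= f x)%E ->
  (\int[leb]_x f x = `|b|%:E * \int[leb]_x f (c + b * x)%R)%E.
Proof.
move=> b0 mf f0.
have b1 : 0 <= `|b| by [].
pose m := mscale (NngNum b1) (measure_function_pushforward__canonical__measure_function_Measure leb (measurable_affine c b)).
rewrite (eq_measure_integral m) => [|A mA _]; last exact: lebesgue_measure_affine.
rewrite /m ge0_integral_mscale//=; congr (_ * _)%E.
rewrite [LHS](_ : _ = \int[pushforward leb (affine c b)]_x f x)%E//.
by rewrite ge0_integral_pushforward//; exact: measurable_affine.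
Qed.

Lemma ge0_integral_affine n (c : 'rV[R]_n) (b : R) (f : 'rV[R]_n -> \bar R) :
  b != 0 -> measurable_fun setT f -> (forall x, 0 <= f x)%E ->
  (\int[mu n]_x f x = (`|b| ^+ n)%:E * \int[mu n]_x f (c + b *: x)%R)%E.
Proof.
move=> b0; elim: n c f => [|n IH] c f mf f0.
  by rewrite !dirac_lebd0 expr0 mul1e; congr f; apply/rowP; case.
have maff : measurable_fun setT (fun x : 'rV[R]_n.+1 => c + b *: x).
  apply/measurable_fun_coorP => i; under eq_fun do rewrite !mxE.
  apply: measurable_funD => //; apply: measurable_funM => //.
  exact: measurable_coor.
rewrite !ge0_integral_consr//; last exact: measurableT_comp.
pose c' : 'rV[R]_n := \row_i c ord0 (lift ord0 i).
have E a x : c + b *: consr (a, x) = consr (c ord0 ord0 + b * a, c' + b *: x).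
  apply/rowP => i; rewrite !mxE; case: unliftP => [j|] -> /=; by rewrite ?mxE.
pose g a := (\int[mu n]_x f (consr (a, x)))%E.
have mg : measurable_fun setT g.
  have mF : measurable_fun setT (f \o (@consr _ n)).
    by apply: measurableT_comp => //; exact: measurable_consr.
  by apply: (measurable_fun_fubini_tonelli_F _ mF) => ?; exact: f0.
have g0 a : (0 <= g a)%E by apply: integral_ge0.
rewrite -/(g _) [LHS](ge0_integral_affine1 (c ord0 ord0) b0)//.
rewrite exprS EFinM -muleA; congr (_ * _)%E.
rewrite -ge0_integralZl//; last 2 first.
- have mF : measurable_fun setT ((fun x => f (c + b *: x)) \o (@consr _ n)).
    by apply: measurableT_comp; [exact: measurableT_comp|exact: measurable_consr].
  by apply: (measurable_fun_fubini_tonelli_F _ mF) => ?; exact: f0.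
- by move=> a _; apply: integral_ge0.
apply: eq_integral => a _; under [in RHS]eq_integral do rewrite E.
apply: (IH c' (fun x => f (consr (c ord0 ord0 + b * a, x)))) => // .
exact: measurableT_comp mf (measurable_consrl _).
Qed.

Lemma L1_affine n (c : 'rV[R]_n) (b : R) (f : 'rV[R]_n -> R) : b != 0 ->
  L1 (mu n) f -> L1 (mu n) (fun x => f (c + b *: x)).
Proof.
move=> b0 /L1P[mf fi].
have maff : measurable_fun setT (fun x : 'rV[R]_n => c + b *: x).
  apply/measurable_fun_coorP => i; under eq_fun do rewrite !mxE.
  apply: measurable_funD => //; apply: measurable_funM => //.
  exact: measurable_coor.
apply/L1P; split; first exact: measurableT_comp mf maff.
move: fi; rewrite (@ge0_integral_affine n c b (fun x => `|f x|%:E))//; last first.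
  by apply/measurable_EFinP; exact: measurableT_comp.
have bn0 : (0 < (`|b| ^+ n)%:E)%E by rewrite lte_fin exprn_gt0// normr_gt0.
rewrite !ltey; apply: contra => /eqP ->.
by rewrite mulr_infty gtr0_sg ?mul1e// -lte_fin.
Qed.

Lemma Rint_affine n (c : 'rV[R]_n) (b : R) (f : 'rV[R]_n -> R) : b != 0 ->
  L1 (mu n) f ->
  \int[mu n]_x f x = `|b| ^+ n * \int[mu n]_x f (c + b *: x).
Proof.
move=> b0 Lf; apply: EFin_inj; rewrite EFinM RintE// RintE; last exact: L1_affine.
have mf := L1_measurable Lf.
rewrite [LHS]integralE [in RHS]integralE.
rewrite muleBr//; last first.
  exact: (integrable_add_def measurableT (L1_affine c b0 Lf)).
have mfE : measurable_fun setT (EFin \o f) by exact/measurable_EFinP.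
rewrite (@ge0_integral_affine n c b (fun x => (EFin \o f)^\+ x)%E)//; last exact: measurable_funepos.
rewrite [X in (_ - X)%E = _](@ge0_integral_affine n c b (fun x => (EFin \o f)^\- x)%E)//; last exact: measurable_funeneg. by congr (_ * _ - _ * _)%E; apply: eq_integral => x _; rewrite ?funeposE ?funenegE.
Qed.

Lemma Rint_translate n (c : 'rV[R]_n) (f : 'rV[R]_n -> R) : L1 (mu n) f ->
  \int[mu n]_x f (c + x) = \int[mu n]_x f x.
Proof.
move=> Lf; rewrite [RHS](@Rint_affine n c 1)// normr1 expr1n mul1r.
by under [RHS]eq_Rint do rewrite scale1r.
Qed.

Lemma Rint_opp n (f : 'rV[R]_n -> R) : L1 (mu n) f ->
  \int[mu n]_x f (- x) = \int[mu n]_x f x.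
Proof.
move=> Lf; rewrite [RHS](@Rint_affine n 0 (-1))// ?oppr_eq0 ?oner_eq0//.
rewrite normrN1 expr1n mul1r.
by under [RHS]eq_Rint do rewrite scaleN1r add0r.
Qed.

Lemma Rint_odd n (f : 'rV[R]_n -> R) : L1 (mu n) f ->
  (forall x, f (- x) = - f x) -> \int[mu n]_x f x = 0.
Proof.
move=> Lf fN; have := Rint_opp Lf; under eq_Rint do rewrite fN.
rewrite RintN// => /eqP; rewrite -subr_eq0 -opprD oppr_eq0 -mulr2n.
by rewrite -mulr_natl mulf_eq0 pnatr_eq0/= => /eqP.
Qed.

Lemma measurable_countable_fun d (T : measurableType d) d' (U : measurableType d')
   (C : countType) (z : T -> C) (g : C -> U) :
  (forall c, measurable (z @^-1` [set c])) -> measurable_fun setT (g \o z).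
Proof.
move=> mz _ B mB; rewrite setTI.
rewrite (_ : _ @^-1` B = \bigcup_c (z @^-1` [set c] `&` [set _ | B (g c)])).
  apply: countable_bigcupT_measurable => // c.
  have [Bc|nBc] := pselect (B (g c)).
    by rewrite (_ : [set _ | _] = setT) ?setIT//; apply/seteqP; split.
  by rewrite (_ : [set _ | _] = set0) ?setI0//; apply/seteqP; split.
apply/seteqP; split=> [x Bx|x [c _ [/= zc Bc]]]; first by exists (z x).
by rewrite /= zc.
Qed.

Lemma continuous_measurable_rV n (f : 'rV[R]_n -> R) :
  continuous f -> measurable_fun [set: 'rV[R]_n] f.
Proof.
move=> cf.
pose z k (x : 'rV[R]_n) : 'rV[int]_n := \row_i Num.floor (k.+1%:R * x ord0 i).
pose g k (c : 'rV[int]_n) : 'rV[R]_n := \row_i ((c ord0 i)%:~R / k.+1%:R).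
apply: (@measurable_fun_cvg _ _ _ _ (fun k => f \o g k \o z k)).
- move=> k; apply: (@measurable_countable_fun _ _ _ _ _ (z k) (f \o g k)) => c.
  rewrite (_ : _ @^-1` _ = \bigcap_(i : 'I_n)
     ((fun x : 'rV[R]_n => x ord0 i) @^-1`
        ((fun a => Num.floor (k.+1%:R * a)) @^-1` [set c ord0 i]))); last first.
    apply/seteqP; split=> [x <- i _ /=|x h]; first by rewrite mxE.
    by apply/rowP => i; rewrite mxE h.
  apply: fin_bigcap_measurable => // i _.
  rewrite -[X in measurable X]setTI; apply: (@measurable_coor _ _ n i) => //.
  rewrite (_ : _ @^-1` _ =
    `[(c ord0 i)%:~R / k.+1%:R, (c ord0 i + 1)%:~R / k.+1%:R[%classic)//.
  have k0 : 0 < k.+1%:R :> R by rewrite ltr0n.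
  apply/seteqP; split => a; rewrite /= in_itv/= ler_pdivrMr// ltr_pdivlMr// mulrC.
    by move=> <-; exact: floor_itv.
  exact: floor_def.
- move=> x _; apply: continuous_cvg; first exact: cf.
  apply/cvgrPdist_le => e e0; near=> k.
  apply: rV_norm_le => [|i]; first exact: ltW.
  rewrite !mxE; have k0 : 0 < k.+1%:R :> R by rewrite ltr0n.
  have /andP[h1 h2] := floor_itv (k.+1%:R * x ord0 i).
  set q := (Num.floor _)%:~R : R in h1 *; rewrite intrD -/q in h2.
  have h3 : x ord0 i <= (q + 1) / k.+1%:R.
    by rewrite ler_pdivlMr// [leLHS]mulrC; exact: ltW.
  have h4 : q / k.+1%:R <= x ord0 i by rewrite ler_pdivrMr// [leRHS]mulrC.
  rewrite ger0_norm ?subr_ge0// lerBlDr (le_trans h3)// mulrDl addrC lerD2r mul1r.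
  near: k; have /cvgrPdist_lt/(_ _ e0) := @cvg_harmonic R.
  by apply: filterS => k; rewrite sub0r normrN ger0_norm ?harmonic_ge0// => /ltW.
Unshelve. all: by end_near.
Qed.

End lebd_toolkit.

(** * Schwartz functions and their Fourier transforms *)

Section schwartz_seminorms.
Context {R : realType} {d : nat}.
Implicit Types (phi psi : 'rV[R]_d -> R) (x : 'rV[R]_d).

Definition coor_count k (g : {ffun 'I_k -> 'I_d}) : 'I_d -> nat :=
  fun i => (\sum_(l | g l == i) 1)%N.

Lemma mdeg_coor_count k (g : {ffun 'I_k -> 'I_d}) : mdeg (coor_count g) = k.
Proof.
rewrite /mdeg /coor_count -[RHS]card_ord -sum1_card.
by rewrite (partition_big (fun l => g l) predT).
Qed.

Lemma monom_coor_count k (g : {ffun 'I_k -> 'I_d}) x :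
  monom (coor_count g) x = \prod_(l < k) x ord0 (g l).
Proof.
rewrite /monom (partition_big (fun l => g l) predT)//=; apply: eq_bigr => i _.
rewrite (eq_bigr (fun=> x ord0 i)) => [|l /eqP->//].
by rewrite prodr_const /coor_count sum1_card.
Qed.

Lemma sum_coor_exp (u : 'I_d -> R) k :
  (\sum_(i < d) u i) ^+ k = \sum_(g : {ffun 'I_k -> 'I_d}) \prod_(l < k) u (g l).
Proof.
rewrite -[k in LHS]card_ord -prodr_const.
by rewrite (bigA_distr_bigA (fun _ : 'I_k => u)).
Qed.

Lemma monomD (a b : 'I_d -> nat) x :
  monom a x * monom b x = monom (fun i => a i + b i)%N x.
Proof. by rewrite /monom -big_split/=; apply: eq_bigr => i _; rewrite exprD. Qed.

Definition weight x : R := \prod_(i < d) oneDsqr (x ord0 i).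

Lemma weight_gt0 x : 0 < weight x.
Proof. by apply: prodr_gt0 => i _; rewrite (lt_le_trans ltr01)// oneDsqr_ge1. Qed.

Lemma weightE x : weight x =
  \sum_(f : {ffun 'I_d -> bool}) monom (fun i => (f i).*2) x.
Proof.
rewrite /weight (eq_bigr (fun i => \sum_(b : bool) x ord0 i ^+ b.*2)) => [|i _].
  by rewrite (bigA_distr_bigA (fun i (b : bool) => x ord0 i ^+ b.*2)).
by rewrite big_bool/= expr0 addrC.
Qed.

Lemma schwartz_norm_set0 n phi :
  [set y | exists (a : 'I_d -> nat) (w : seq 'I_d) x,
    [/\ (mdeg a <= n)%N, (size w <= n)%N &
        y = `|monom a x * partials w phi x|]] !=set0.
Proof.
exists `|monom (fun _ : 'I_d => 0%N) (0 : 'rV[R]_d) * phi 0|.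
by exists (fun=> 0%N), [::], 0; split => //; rewrite /mdeg big1.
Qed.

Lemma schwartz_has_sup n phi : schwartz phi ->
  has_sup [set y | exists (a : 'I_d -> nat) (w : seq 'I_d) x,
    [/\ (mdeg a <= n)%N, (size w <= n)%N &
        y = `|monom a x * partials w phi x|]].
Proof.
move=> [_ bphi]; split; first exact: schwartz_norm_set0.
have [C hC] : exists C : ('I_d -> nat) -> seq 'I_d -> R, forall a w x,
    `|monom a x * partials w phi x| <= C a w.
  have /choice[C hC] : forall p : ('I_d -> nat) * seq 'I_d, exists c : R,
      forall x, `|monom p.1 x * partials p.2 phi x| <= c.
    by move=> [a w]; exact: bphi.
  by exists (fun a w => C (a, w)) => a w x; exact: (hC (a, w)).
pose B := \sum_(f : {ffun 'I_d -> 'I_n.+1}) \sum_(k < n.+1) \sum_(w : k.-tuple 'I_d)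
   `|C (fun i => f i : nat) w|.
exists B => _ [a [w [x [an wn ->]]]].
apply: (le_trans (hC a w x)).
have ain i : (a i < n.+1)%N.
  by rewrite ltnS (leq_trans _ an)// /mdeg (bigD1 i)//= leq_addr.
pose f : {ffun 'I_d -> 'I_n.+1} := [ffun i => Ordinal (ain i)].
have -> : a = (fun i => f i : nat) by apply/funext => i; rewrite ffunE.
rewrite /B (bigD1 f)//= ler_wpDr//.
  by apply: sumr_ge0 => *; apply: sumr_ge0 => *; apply: sumr_ge0.
have wn' : (size w < n.+1)%N by [].
rewrite (bigD1 (Ordinal wn'))//= ler_wpDr//.
  by apply: sumr_ge0 => *; apply: sumr_ge0.
by rewrite (bigD1 (in_tuple w))//= ler_wpDr ?ler_norm//; apply: sumr_ge0.
Qed.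

Lemma le_schwartz_norm n phi (a : 'I_d -> nat) (w : seq 'I_d) x :
  schwartz phi -> (mdeg a <= n)%N -> (size w <= n)%N ->
  `|monom a x * partials w phi x| <= schwartz_norm n phi.
Proof.
move=> sphi an wn; apply: ub_le_sup; first by case: (schwartz_has_sup n sphi).
by exists a, w, x.
Qed.

Lemma schwartz_norm_le n phi (C : R) :
  (forall (a : 'I_d -> nat) (w : seq 'I_d) x, (mdeg a <= n)%N -> (size w <= n)%N ->
    `|monom a x * partials w phi x| <= C) -> schwartz_norm n phi <= C.
Proof.
move=> h; apply: sup_le_ub; first exact: schwartz_norm_set0.
by move=> _ [a [w [x [an wn ->]]]]; exact: h.
Qed.

Lemma schwartz_norm_ge0 n phi : schwartz phi -> 0 <= schwartz_norm n phi.
Proof.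
move=> sphi; apply: (le_trans (normr_ge0 (monom (fun _ : 'I_d => 0%N) (0 : 'rV[R]_d) * phi 0))).
by apply: (@le_schwartz_norm n phi _ [::]) => //; rewrite /mdeg big1.
Qed.

Lemma schwartz_norm_mono n m phi : schwartz phi -> (n <= m)%N ->
  schwartz_norm n phi <= schwartz_norm m phi.
Proof.
move=> sphi nm; apply: schwartz_norm_le => a w x an wn.
by apply: le_schwartz_norm => //; exact: leq_trans nm.
Qed.

Lemma partials_cat (w w' : seq 'I_d) phi :
  partials w (partials w' phi) = partials (w ++ w') phi.
Proof. by rewrite /partials foldr_cat. Qed.

Lemma schwartz_partials (w : seq 'I_d) phi : schwartz phi -> schwartz (partials w phi).
Proof.
move=> [sphi bphi]; split => [w' x|a w']; first by rewrite partials_cat.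
by have [C hC] := bphi a (w' ++ w); exists C => x; rewrite partials_cat.
Qed.

Lemma schwartz_norm_partials n (w : seq 'I_d) phi : schwartz phi ->
  schwartz_norm n (partials w phi) <= schwartz_norm (n + size w) phi.
Proof.
move=> sphi; apply: schwartz_norm_le => a w' x an wn.
rewrite partials_cat; apply: le_schwartz_norm => //.
  by rewrite (leq_trans an)// leq_addr.
by rewrite size_cat leq_add2r.
Qed.

Lemma smooth_lin (c : R) phi psi : smooth phi -> smooth psi ->
  forall w : seq 'I_d, partials w (fun x => c * phi x + psi x) =
    (fun x => c * partials w phi x + partials w psi x).
Proof.
move=> sp sq; elim=> [//|i w /= ->]; apply/funext => x.
rewrite (_ : (fun _ => _) = c \*: partials w phi + partials w psi)//.
have dp := @diff_derivable _ _ _ _ _ (delta_mx ord0 i) (sp w x).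
have dq := @diff_derivable _ _ _ _ _ (delta_mx ord0 i) (sq w x).
rewrite deriveD//; last exact: derivableZ.
by rewrite deriveZ.
Qed.

Lemma schwartz_lin (c : R) phi psi : schwartz phi -> schwartz psi ->
  schwartz (fun x => c * phi x + psi x).
Proof.
move=> [sp bp] [sq bq]; split=> [w x|a w].
  rewrite smooth_lin//.
  rewrite (_ : (fun _ => _) = c \*: partials w phi + partials w psi)//.
  by apply: differentiableD => //; exact: differentiableZ.
have [C1 h1] := bp a w; have [C2 h2] := bq a w.
exists (`|c| * C1 + C2) => x; rewrite smooth_lin// mulrDr.
rewrite (le_trans (ler_normD _ _))// lerD//.
by rewrite mulrCA normrM ler_wpM2l.
Qed.

Lemma schwartz0 : schwartz (fun _ : 'rV[R]_d => 0).
Proof.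
have p0 : forall w : seq 'I_d, partials w (fun _ : 'rV[R]_d => 0) = (fun=> 0 : R).
  elim=> [//|i w /= ->]; apply/funext => x.
  by rewrite (_ : (fun=> 0) = cst 0)// derive_cst.
split=> [w x|a w]; first by rewrite p0; exact: differentiable_cst.
by exists 0 => x; rewrite p0 mulr0 normr0.
Qed.

Lemma schwartz_continuous phi : schwartz phi -> continuous phi.
Proof. by move=> [sp _] x; apply: differentiable_continuous; exact: (sp [::]). Qed.

Lemma schwartz_measurable phi : schwartz phi -> measurable_fun setT phi.
Proof. by move=> sp; apply: continuous_measurable_rV; exact: schwartz_continuous. Qed.

Definition decay_const k : R :=
  #|{ffun 'I_d -> bool}|%:R * #|{ffun 'I_k -> 'I_d}|%:R.

Lemma schwartz_decay k phi x : schwartz phi ->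
  `|phi x| * (\sum_(i < d) `|x ord0 i|) ^+ k * weight x <=
  decay_const k * schwartz_norm (d.*2 + k) phi.
Proof.
move=> sp; rewrite sum_coor_exp mulr_sumr mulr_suml /decay_const.
rewrite [_%:R * _%:R]mulrC -mulrA mulr_natl -sumr_const.
apply: ler_sum => g _; rewrite weightE mulr_sumr mulr_natl -sumr_const.
apply: ler_sum => f _.
rewrite -normr_prod -monom_coor_count -[X in _ * X <= _]ger0_norm; last first.
  by apply: prodr_ge0 => i _; rewrite -muln2 exprM sqr_ge0.
rewrite -!normrM [phi x * _]mulrC mulrAC monomD.
apply: (@le_schwartz_norm _ _ _ [::]) => //.
rewrite /mdeg big_split/= -/(mdeg (coor_count g)) mdeg_coor_count addnC leq_add2r.
have := card_ord d; rewrite -[X in (_ <= X.*2)%N]card_ord -sum1_card -mul2n big_distrr/=.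
by move=> _; apply: leq_sum => i _; case: (f i).
Qed.

Lemma measurable_weight : measurable_fun setT weight.
Proof.
apply: measurable_prod => i _; apply: measurable_funD => //.
by apply: measurable_funX; exact: measurable_coor.
Qed.

Lemma L1_weightV : L1 (lebesgue_rV d) (fun x => (weight x)^-1).
Proof.
under eq_fun do rewrite /weight -prodfV.
apply: (@L1_prod_coor R d (fun _ a => (oneDsqr a)^-1)) => _.
have mo : measurable_fun setT (fun a : R => (oneDsqr a)^-1).
  by apply: continuous_measurable_fun; exact: continuous_oneDsqrV.
have o0 a : 0 <= (oneDsqr a)^-1 :> R by rewrite invr_ge0 (le_trans ler01)// oneDsqr_ge1.
apply: Rint_ge0E => //.
rewrite ge0_symfun_integralT//; last 2 first.
- exact: continuous_oneDsqrV.
- by move=> a /=; rewrite /oneDsqr sqrrN.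
rewrite -set_itvcy integral0y_oneDsqr; by rewrite -EFinM ltry.
Qed.

Lemma L1_decay (C : R) (f : 'rV[R]_d -> R) : measurable_fun setT f ->
  (forall x, `|f x| * weight x <= C) -> L1 (lebesgue_rV d) f.
Proof.
move=> mf fC; apply: L1_le (L1Z C L1_weightV) _ => // x.
by rewrite -ler_pdivrMr ?invr_gt0 ?weight_gt0// invrK.
Qed.

Lemma Rint_decay (C : R) (f : 'rV[R]_d -> R) : measurable_fun setT f ->
  (forall x, `|f x| * weight x <= C) ->
  \int[lebesgue_rV d]_x `|f x| <= C * \int[lebesgue_rV d]_x (weight x)^-1.
Proof.
move=> mf fC; rewrite -RintZ; last exact: L1_weightV.
apply: Rint_le => [||x]; [exact/L1_norm/L1_decay/fC|exact/L1Z/L1_weightV|].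
by rewrite -ler_pdivrMr ?invr_gt0 ?weight_gt0// invrK.
Qed.

Lemma schwartz_decay0 phi x : schwartz phi ->
  `|phi x| * weight x <= decay_const 0 * schwartz_norm d.*2 phi.
Proof. by move=> sp; have := schwartz_decay 0 x sp; rewrite expr0 mulr1 addn0. Qed.

Lemma schwartz_L1 phi : schwartz phi -> L1 (lebesgue_rV d) phi.
Proof.
move=> sp; apply: L1_decay (fun x => schwartz_decay0 x sp).
exact: schwartz_measurable.
Qed.

Lemma schwartz_bounded phi x : schwartz phi -> `|phi x| <= schwartz_norm 0 phi.
Proof.
move=> sp; have := @le_schwartz_norm 0 phi (fun=> 0%N) [::] x sp.
by rewrite /mdeg/= big1// /monom big1// mul1r; apply.
Qed.

End schwartz_seminorms.

Section directional_derivatives.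
Context {R : realType} {V : normedModType R}.
Implicit Types (f : V -> R) (a v : V).

Lemma is_derive_line f a v (h df : R) :
  is_derive (a + h *: v) v f df -> is_derive h 1 (fun t : R => f (a + t *: v)) df.
Proof.
move=> [fv fE].
have E : (fun t : R => t^-1 *: (((fun u : R => f (a + u *: v)) \o shift h) (t *: 1) -
    f (a + h *: v))) =
  (fun t : R => t^-1 *: ((f \o shift (a + h *: v)) (t *: v) - f (a + h *: v))).
  apply/funext => t /=; congr (_ *: (f _ - _)).
  by rewrite [t *: 1]mulr1 scalerDl addrCA.
by apply: DeriveDef; rewrite /derivable /derive E.
Qed.

Lemma line_is_derive f a v (df : R) :
  is_derive (0 : R) 1 (fun t : R => f (a + t *: v)) df -> is_derive a v f df.
Proof.
move=> [fv fE].
have E : (fun t : R => t^-1 *: (((fun u : R => f (a + u *: v)) \o shift 0) (t *: 1) -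
    f (a + 0 *: v))) =
  (fun t : R => t^-1 *: ((f \o shift a) (t *: v) - f a)).
  apply/funext => t /=; congr (_ *: (f _ - f _)).
    by rewrite [t *: 1]mulr1 addr0 addrC.
  by rewrite scale0r addr0.
by apply: DeriveDef; move: fv fE; rewrite /derivable /derive E.
Qed.

End directional_derivatives.

Section integration_by_parts_rV.
Context {R : realType} {d : nat}.
Local Notation mu := (@lebesgue_rV R d).
Local Notation e i := (delta_mx ord0 i : 'rV[R]_d).

Lemma weight_shift (x : 'rV[R]_d) (i : 'I_d) (c : R) : `|c| <= 1 ->
  weight x <= 3 * weight (x + c *: e i).
Proof.
move=> c1; rewrite /weight (bigD1 i)//= [X in _ <= _ * X](bigD1 i)//= mulrA.
have -> : \prod_(j < d | j != i) oneDsqr ((x + c *: e i) ord0 j) =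
          \prod_(j < d | j != i) oneDsqr (x ord0 j).
  by apply: eq_bigr => j ji; rewrite !mxE eqxx/= (negbTE ji) mulr0 addr0.
apply: ler_wpM2r.
  by apply: prodr_ge0 => j _; rewrite (le_trans ler01)// oneDsqr_ge1.
rewrite !mxE !eqxx/= mulr1 /oneDsqr.
have c2 : c ^+ 2 <= 1 by rewrite -[c ^+ 2]ger0_norm ?sqr_ge0// normrX exprn_ile1.
have := sqr_ge0 (x ord0 i + 2 * c); nra.
Qed.

(* Translation invariance: the difference quotients along a coordinate have
   zero integral, and they converge dominatedly to the derivative. *)
Lemma Rint_coor_derive (i : 'I_d) (F G : 'rV[R]_d -> R) (C : R) :
  measurable_fun setT F -> measurable_fun setT G ->
  (forall x, is_derive x (e i) F (G x)) ->
  (forall x, `|F x| * weight x <= C) -> (forall x, `|G x| * weight x <= C) ->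
  \int[mu]_x G x = 0.
Proof.
move=> mF mG dF bF bG.
pose t n : R := n.+1%:R^-1.
have t0 n : 0 < t n by rewrite invr_gt0 ltr0n.
have t1 n : t n <= 1 by rewrite invf_le1 ?ltr0n// ler1n.
pose q n x := (t n)^-1 * (F (t n *: e i + x) - F x).
have mFt n : measurable_fun setT (fun x => F (t n *: e i + x)).
  apply: measurableT_comp mF _; apply/measurable_fun_coorP => j.
  under eq_fun do rewrite !mxE; apply: measurable_funD => //.
  exact: measurable_coor.
have LF : L1 mu F by apply: L1_decay bF.
have LFt n : L1 mu (fun x => F (t n *: e i + x)).
  have := L1_affine (t n *: e i) (oner_neq0 R) LF.
  by under eq_fun do rewrite scale1r.
have q0 n : \int[mu]_x q n x = 0.
  by rewrite RintZ ?RintB ?Rint_translate ?subrr ?mulr0//; exact: L1B.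
have cq x : q ^~ x @ \oo --> G x.
  have [fv fE] := dF x.
  have /cvgr_dnbhsP : (h^-1 *: ((F \o shift x) (h *: e i) - F x)) @[h --> 0^'] --> G x.
    by rewrite -fE; exact: fv.
  apply; split=> [n|]; first by rewrite gt_eqF.
  exact: cvg_harmonic.
have bq n x : `|q n x| <= (3 * C) * (weight x)^-1.
  have [c c01 Ec] : exists2 c, c \in `]0, t n[ &
      F (x + t n *: e i) - F (x + 0 *: e i) = G (x + c *: e i) * (t n - 0).
    apply: (MVT (f := fun h => F (x + h *: e i)) (df := fun h => G (x + h *: e i))).
    - exact: t0.
    - by move=> h _; apply: is_derive_line.
    - apply: continuous_subspaceT => h; apply: differentiable_continuous.
      apply/derivable1_diffP.
      by have [] := is_derive_line (dF (x + h *: e i)).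
  rewrite scale0r addr0 subr0 in Ec.
  rewrite /q [t n *: _ + x]addrC Ec mulrCA mulVf ?gt_eqF// mulr1.
  rewrite ler_pdivlMr ?weight_gt0//.
  move: c01; rewrite in_itv/= => /andP[c0 ct].
  have c1 : `|c| <= 1 by rewrite gtr0_norm// (le_trans (ltW ct)).
  have := weight_shift x i c1; have := bG (x + c *: e i).
  have := normr_ge0 (G (x + c *: e i)); move: (`|G _|) (weight _) (weight _) => g w w'.
  move=> g0 h1 h2; nra.
have mq n : measurable_fun setT (q n).
  by apply: measurable_funM => //; exact: measurable_funB.
have h := Rint_dct mq mG cq (L1Z (3 * C) L1_weightV) bq.
rewrite (_ : (fun _ => _) = fun=> 0) in h; last by apply/funext => n; exact: q0.
by rewrite -(cvg_lim _ h)//; exact: lim_cst.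
Qed.

End integration_by_parts_rV.

Section fourier_parts.
Context {R : realType} {d : nat}.
Local Notation mu := (@lebesgue_rV R d).
Local Notation e i := (delta_mx ord0 i : 'rV[R]_d).
Implicit Types (phi psi : 'rV[R]_d -> R) (x xi : 'rV[R]_d).

Definition fourier_const : R := (2 * pi) `^ (- (d%:R / 2)).

Definition fourier_re phi xi : R :=
  fourier_const * \int[mu]_x (phi x * cos (dot x xi)).

Definition fourier_im phi xi : R :=
  fourier_const * \int[mu]_x (phi x * - sin (dot x xi)).

Lemma fourierE phi xi : fourier phi xi = (fourier_re phi xi +i* fourier_im phi xi)%C.
Proof.
rewrite /fourier /cintegral /fourier_re /fourier_im -/fourier_const.
apply/eqP; rewrite eq_complex /=; apply/andP; split; apply/eqP.
  rewrite mul0r subr0; congr (_ * _); apply: eq_Rint => x /=.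
  by rewrite mul0r subr0.
rewrite mul0r addr0; congr (_ * _); apply: eq_Rint => x /=.
by rewrite mul0r addr0.
Qed.

Lemma dotC x xi : dot x xi = dot xi x.
Proof. by rewrite /dot; apply: eq_bigr => i _; rewrite mulrC. Qed.

Lemma dotDl x y xi : dot (x + y) xi = dot x xi + dot y xi.
Proof. by rewrite /dot -big_split/=; apply: eq_bigr => i _; rewrite mxE mulrDl. Qed.

Lemma dotZl (c : R) x xi : dot (c *: x) xi = c * dot x xi.
Proof. by rewrite /dot mulr_sumr; apply: eq_bigr => i _; rewrite mxE mulrA. Qed.

Lemma dotNl x xi : dot (- x) xi = - dot x xi.
Proof. by rewrite -scaleN1r dotZl mulN1r. Qed.

Lemma dot_delta i xi : dot (e i) xi = xi ord0 i.
Proof.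
rewrite /dot (bigD1 i)//= big1 => [|j ji]; first by rewrite !mxE !eqxx mul1r addr0.
by rewrite !mxE (negbTE ji) andbF mul0r.
Qed.

Lemma measurable_dot : measurable_fun [set: 'rV[R]_d * 'rV[R]_d]
  (fun p => dot p.1 p.2).
Proof.
apply: measurable_sum => i; apply: measurable_funM.
  exact: (measurableT_comp (@measurable_coor _ _ d i) measurable_fst).
exact: (measurableT_comp (@measurable_coor _ _ d i) measurable_snd).
Qed.

Lemma measurable_dotl xi : measurable_fun setT (dot^~ xi : 'rV[R]_d -> R).
Proof.
apply: measurable_sum => i; apply: measurable_funM => //; exact: measurable_coor.
Qed.

Lemma measurable_cos : measurable_fun setT (@cos R).
Proof. by apply: continuous_measurable_fun; exact: continuous_cos. Qed.

Lemma measurable_sin : measurable_fun setT (@sin R).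
Proof. by apply: continuous_measurable_fun; exact: continuous_sin. Qed.

Lemma cos_norm_le1 (a : R) : `|cos a| <= 1.
Proof. by rewrite ler_norml cos_geN1 cos_le1. Qed.

Lemma sin_norm_le1 (a : R) : `|sin a| <= 1.
Proof. by rewrite ler_norml sin_geN1 sin_le1. Qed.

Lemma L1_cos phi xi : L1 mu phi -> L1 mu (fun x => phi x * cos (dot x xi)).
Proof.
move=> L; apply: (@L1_Mb _ _ _ _ 1) => // [|x]; last exact: cos_norm_le1.
exact: measurableT_comp measurable_cos (measurable_dotl xi).
Qed.

Lemma L1_sin phi xi : L1 mu phi -> L1 mu (fun x => phi x * sin (dot x xi)).
Proof.
move=> L; apply: (@L1_Mb _ _ _ _ 1) => // [|x]; last exact: sin_norm_le1.
exact: measurableT_comp measurable_sin (measurable_dotl xi).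
Qed.

Lemma L1_sinN phi xi : L1 mu phi -> L1 mu (fun x => phi x * - sin (dot x xi)).
Proof.
by move=> /(L1_sin xi)/L1N; under eq_fun do rewrite -mulrN.
Qed.

(* The weight makes the integrand integrable for the product measure, which
   reduces measurability in [xi] to Fubini's theorem. *)
Lemma measurable_Rint_trig (T : R -> R) phi : measurable_fun setT T ->
  (forall a, `|T a| <= 1) -> L1 mu phi ->
  measurable_fun setT (fun xi => \int[mu]_x (phi x * T (dot x xi))).
Proof.
move=> mT T1 L.
have mf : measurable_fun [set: 'rV[R]_d * 'rV[R]_d]
    (fun p => (weight p.1)^-1 * (phi p.2 * T (dot p.2 p.1))).
  apply: measurable_funM.
    apply: (measurableT_comp (f := fun x => (weight x)^-1)) => //.
    exact: L1_measurable L1_weightV.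
  apply: measurable_funM; first exact: measurableT_comp (L1_measurable L) measurable_snd.
  apply: measurableT_comp mT _; under eq_fun do rewrite dotC; exact: measurable_dot.
have := @L1_Rint_section _ _ _ _ _ mu mu (fun x => (weight x)^-1) phi
  (fun xi x => (weight xi)^-1 * (phi x * T (dot x xi))) L1_weightV L mf.
have bd xi x : `|(weight xi)^-1 * (phi x * T (dot x xi))| <= `|(weight xi)^-1| * `|phi x|.
  by rewrite normrM ler_wpM2l// normrM ler_piMr.
move=> /(_ bd)/L1_measurable mw.
have := measurable_funM (@measurable_weight R d) mw.
apply: eq_measurable_fun => xi _ /=.
rewrite RintZ ?mulrA ?divff ?mul1r ?gt_eqF ?weight_gt0//.
apply: (@L1_Mb _ _ _ _ 1) => //.
exact: measurableT_comp mT (measurable_dotl xi).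
Qed.

Lemma measurable_fourier_re phi : L1 mu phi -> measurable_fun setT (fourier_re phi).
Proof.
move=> L; apply: measurable_funM => //.
by apply: measurable_Rint_trig => //; [exact: measurable_cos|exact: cos_norm_le1].
Qed.

Lemma measurable_fourier_im phi : L1 mu phi -> measurable_fun setT (fourier_im phi).
Proof.
move=> L; apply: measurable_funM => //.
apply: (@measurable_Rint_trig (fun a => - sin a)) => // [|a].
  by apply: measurable_funN; exact: measurable_sin.
by rewrite normrN; exact: sin_norm_le1.
Qed.

Lemma fourier_re_lin (c : R) phi psi xi : L1 mu phi -> L1 mu psi ->
  fourier_re (fun x => c * phi x + psi x) xi =
  c * fourier_re phi xi + fourier_re psi xi.
Proof.
move=> L L'; rewrite /fourier_re mulrCA -mulrDr; congr (_ * _).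
rewrite -(RintZ c (L1_cos xi L)) -(RintD (L1Z c (L1_cos xi L)) (L1_cos xi L')).
by apply: eq_Rint => x; rewrite mulrDl mulrA.
Qed.

Lemma fourier_im_lin (c : R) phi psi xi : L1 mu phi -> L1 mu psi ->
  fourier_im (fun x => c * phi x + psi x) xi =
  c * fourier_im phi xi + fourier_im psi xi.
Proof.
move=> L L'; rewrite /fourier_im mulrCA -mulrDr; congr (_ * _).
rewrite -(RintZ c (L1_sinN xi L)) -(RintD (L1Z c (L1_sinN xi L)) (L1_sinN xi L')).
by apply: eq_Rint => x; rewrite mulrDl mulrA.
Qed.

Lemma fourier_reN phi xi : fourier_re phi (- xi) = fourier_re phi xi.
Proof.
congr (_ * _); apply: eq_Rint => x.
by rewrite dotC dotNl cosN dotC.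
Qed.

Lemma fourier_imN phi xi : L1 mu phi -> fourier_im phi (- xi) = - fourier_im phi xi.
Proof.
move=> L; rewrite /fourier_im -mulrN -RintN; last exact: L1_sinN.
congr (_ * _); apply: eq_Rint => x.
by rewrite dotC dotNl sinN dotC mulrN.
Qed.

Lemma is_derive_cos_dot xi i x :
  is_derive x (e i) (fun x => cos (dot x xi)) (- sin (dot x xi) * xi ord0 i).
Proof.
apply: line_is_derive.
rewrite (_ : (fun _ => _) = cos \o (fun t : R => dot x xi + t * xi ord0 i)); last first.
  by apply/funext => t /=; rewrite dotDl dotZl dot_delta.
apply: is_derive1_comp.
  by rewrite mul0r addr0; exact: is_derive_cos.
rewrite (_ : (fun _ => _) = cst (dot x xi) + xi ord0 i \*: id); last first.
  by apply/funext => t /=; rewrite mulrC.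
by apply: is_derive_eq; rewrite add0r [_ *: 1]mulr1.
Qed.

End fourier_parts.

Section fourier_derivative.
Context {R : realType} {d : nat}.
Local Notation mu := (@lebesgue_rV R d).
Local Notation e i := (delta_mx ord0 i : 'rV[R]_d).
Implicit Types (phi psi : 'rV[R]_d -> R) (x xi : 'rV[R]_d).

Lemma is_derive_sin_dot xi i x :
  is_derive x (e i) (fun x => sin (dot x xi)) (cos (dot x xi) * xi ord0 i).
Proof.
apply: line_is_derive.
rewrite (_ : (fun _ => _) = sin \o (fun t : R => dot x xi + t * xi ord0 i)); last first.
  by apply/funext => t /=; rewrite dotDl dotZl dot_delta.
apply: is_derive1_comp.
  by rewrite mul0r addr0; exact: is_derive_sin.
rewrite (_ : (fun _ => _) = cst (dot x xi) + xi ord0 i \*: id); last first.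
  by apply/funext => t /=; rewrite mulrC.
by apply: is_derive_eq; rewrite add0r [_ *: 1]mulr1.
Qed.

Lemma schwartz_is_derive phi i x : schwartz phi ->
  is_derive x (e i) phi (partials [:: i] phi x).
Proof.
move=> [sp _]; apply: derivableP; exact: (@diff_derivable _ _ _ _ _ (e i) (sp [::] x)).
Qed.

Lemma schwartz_decay_monom (a : 'I_d -> nat) phi : schwartz phi ->
  exists C, forall x, `|monom a x * phi x| * weight x <= C.
Proof.
move=> sp; exists (#|{ffun 'I_d -> bool}|%:R * schwartz_norm (d.*2 + mdeg a) phi) => x.
rewrite weightE mulr_sumr mulr_natl -sumr_const.
apply: ler_sum => f _.
rewrite -[X in _ * X <= _]ger0_norm; last first.
  by apply: prodr_ge0 => i _; rewrite -muln2 exprM sqr_ge0.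
rewrite -!normrM mulrAC monomD.
apply: (@le_schwartz_norm _ _ _ _ _ [::]) => //.
rewrite /mdeg big_split/= addnC leq_add2r.
rewrite -[X in (_ <= X.*2)%N](card_ord d) -sum1_card -mul2n big_distrr/=.
by apply: leq_sum => i _; case: (f i).
Qed.

Lemma measurable_monom (a : 'I_d -> nat) : measurable_fun setT (monom a : 'rV[R]_d -> R).
Proof.
by apply: measurable_prod => i _; apply: measurable_funX; exact: measurable_coor.
Qed.

Lemma L1_monom (a : 'I_d -> nat) phi : schwartz phi ->
  L1 mu (fun x => monom a x * phi x).
Proof.
move=> sp; have [C hC] := schwartz_decay_monom a sp.
apply: L1_decay hC; apply: measurable_funM; first exact: measurable_monom.
exact: schwartz_measurable.
Qed.

Lemma is_derive_monom (a : 'I_d -> nat) i x :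
  is_derive x (e i) (monom a : 'rV[R]_d -> R)
    ((a i)%:R * monom (fun j => if j == i then (a i).-1 else a j) x).
Proof.
apply: line_is_derive.
pose c := \prod_(j < d | j != i) x ord0 j ^+ a j.
rewrite (_ : (fun _ => _) = c \*: ((cst (x ord0 i) + id) ^+ (a i))); last first.
  apply/funext => t; rewrite /monom (bigD1 i)//= !mxE !eqxx/= mulr1 mulrC.
  congr (_ * _); last by rewrite fctE.
  by apply: eq_bigr => j ji; rewrite !mxE eqxx/= (negbTE ji) mulr0 addr0.
apply: is_derive_eq.
rewrite /monom (bigD1 i)//= eqxx.
rewrite [(cst _ + id) 0](_ : _ = x ord0 i); last by rewrite fctE /= addr0.
rewrite (eq_bigr (fun j => x ord0 j ^+ a j)) => [|j /negbTE->//].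
by rewrite -/c /GRing.scale/= add0r mulr1 mulrC -mulrA.
Qed.

Lemma Rint_coor_derive_schwartz phi i xi : schwartz phi ->
  \int[mu]_x (partials [:: i] phi x * cos (dot x xi)) =
    xi ord0 i * \int[mu]_x (phi x * sin (dot x xi)) /\
  \int[mu]_x (partials [:: i] phi x * sin (dot x xi)) =
    - (xi ord0 i * \int[mu]_x (phi x * cos (dot x xi))).
Proof.
move=> sp; have sp' := schwartz_partials [:: i] sp.
have L := schwartz_L1 sp; have L' := schwartz_L1 sp'.
pose C0 := @decay_const R d 0 * schwartz_norm d.*2 phi : R.
pose C1 := @decay_const R d 0 * schwartz_norm d.*2 (partials [:: i] phi) : R.
have b0 x : `|phi x| * weight x <= C0 by exact: schwartz_decay0.
have b1 x : `|partials [:: i] phi x| * weight x <= C1 by exact: schwartz_decay0.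
have C00 : 0 <= C0.
  by apply: le_trans (b0 0); rewrite mulr_ge0// ltW// weight_gt0.
have C10 : 0 <= C1.
  by apply: le_trans (b1 0); rewrite mulr_ge0// ltW// weight_gt0.
have bt (T : R -> R) x psi C : (forall a, `|T a| <= 1) -> `|psi x| * weight x <= C ->
    `|psi x * T (dot x xi)| * weight x <= C.
  move=> T1; apply: le_trans; apply: ler_wpM2r; first by rewrite ltW// weight_gt0.
  by rewrite normrM ler_piMr.
have key (T T' : R -> R) : measurable_fun setT T -> measurable_fun setT T' ->
    (forall a, `|T a| <= 1) -> (forall a, `|T' a| <= 1) ->
    (forall x, is_derive x (e i) (fun x => T (dot x xi)) (T' (dot x xi) * xi ord0 i)) ->
    \int[mu]_x (partials [:: i] phi x * T (dot x xi)) =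
    - (xi ord0 i * \int[mu]_x (phi x * T' (dot x xi))).
  move=> mT mT' T1 T'1 dT.
  have mTx : measurable_fun setT (fun x => T (dot x xi)).
    exact: measurableT_comp mT (measurable_dotl xi).
  have mTx' : measurable_fun setT (fun x => T' (dot x xi)).
    exact: measurableT_comp mT' (measurable_dotl xi).
  have LT : L1 mu (fun x => partials [:: i] phi x * T (dot x xi)).
    by apply: (@L1_Mb _ _ _ _ 1) => //.
  have LT' : L1 mu (fun x => phi x * T' (dot x xi)).
    by apply: (@L1_Mb _ _ _ _ 1) => //.
  have := @Rint_coor_derive R d i (fun x => phi x * T (dot x xi))
    (fun x => partials [:: i] phi x * T (dot x xi) + xi ord0 i * (phi x * T' (dot x xi)))
    (C0 + (C1 + `|xi ord0 i| * C0)).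
  rewrite RintD ?RintZ//; last exact: L1Z.
  move=> h; apply/eqP; rewrite -addr_eq0; apply/eqP; apply: h.
  - by apply: measurable_funM => //; exact: schwartz_measurable.
  - by apply: (@L1_measurable _ _ _ mu); apply: L1D => //; exact: L1Z.
  - move=> x.
    have := is_deriveM (schwartz_is_derive i x sp) (dT x).
    rewrite (_ : _ *: _ + _ *: _ = partials [:: i] phi x * T (dot x xi) +
      xi ord0 i * (phi x * T' (dot x xi)))//.
    by rewrite /GRing.scale/=; ring.
  - move=> x; apply: (le_trans (bt T x phi C0 T1 (b0 x))).
    by rewrite lerDl addr_ge0// mulr_ge0.
  - move=> x; rewrite (@le_trans _ _ (`|partials [:: i] phi x * T (dot x xi)| * weight x +
      `|xi ord0 i * (phi x * T' (dot x xi))| * weight x))//.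
      by rewrite -mulrDl ler_wpM2r ?ler_normD// ltW// weight_gt0.
    rewrite -[leLHS]add0r; apply: lerD => //; apply: lerD.
      exact: bt.
    by rewrite normrM -mulrA ler_wpM2l//; exact: bt.
split.
  have msN : measurable_fun setT (fun a : R => - sin a).
    by apply: measurable_funN; exact: measurable_sin.
  have sN1 (a : R) : `|- sin a| <= 1 by rewrite normrN; exact: sin_norm_le1.
  have -> := key cos (fun a => - sin a) measurable_cos msN cos_norm_le1 sN1
    (is_derive_cos_dot xi i).
  rewrite -mulrN -RintN; last exact: L1_sinN.
  by congr (_ * _); apply: eq_Rint => x; rewrite -mulrN opprK.
apply: key.
- exact: measurable_sin.
- exact: measurable_cos.
- exact: sin_norm_le1.
- exact: cos_norm_le1.
- exact: is_derive_sin_dot.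
Qed.

Lemma fourier_re_partial phi i xi : schwartz phi ->
  fourier_re (partials [:: i] phi) xi = - (xi ord0 i * fourier_im phi xi).
Proof.
move=> sp; rewrite /fourier_re (Rint_coor_derive_schwartz i xi sp).1 /fourier_im.
have -> : \int[mu]_x (phi x * - sin (dot x xi)) = - \int[mu]_x (phi x * sin (dot x xi)).
  rewrite -RintN; last exact/L1_sin/schwartz_L1.
  by apply: eq_Rint => x; rewrite mulrN.
by rewrite !mulrN opprK mulrCA.
Qed.

Lemma fourier_im_partial phi i xi : schwartz phi ->
  fourier_im (partials [:: i] phi) xi = xi ord0 i * fourier_re phi xi.
Proof.
move=> sp; rewrite /fourier_im.
have -> : \int[mu]_x (partials [:: i] phi x * - sin (dot x xi)) =
    - \int[mu]_x (partials [:: i] phi x * sin (dot x xi)).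
  rewrite -RintN; last exact/L1_sin/schwartz_L1/(schwartz_partials [:: i]).
  by apply: eq_Rint => x; rewrite mulrN.
by rewrite (Rint_coor_derive_schwartz i xi sp).2 opprK /fourier_re mulrCA.
Qed.

Definition fourier_sq phi xi : R := fourier_re phi xi ^+ 2 + fourier_im phi xi ^+ 2.

Lemma moment_partials (a : 'I_d -> nat) phi i k : schwartz phi -> (a i < k)%N ->
  \int[mu]_x (monom a x * partials (nseq k i) phi x) = 0.
Proof.
move=> sp; elim: k a => // k IH a ak.
have sk := schwartz_partials (nseq k i) sp.
have sk1 := schwartz_partials [:: i] sk.
pose a' j := if j == i then (a i).-1 else a j.
have [C hC] := schwartz_decay_monom a sk.
have [C1 hC1] := schwartz_decay_monom a sk1.
have [C2 hC2] := schwartz_decay_monom a' sk.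
have w0 x : 0 <= weight x by rewrite ltW// weight_gt0.
have pos (f : 'rV[R]_d -> R) c : (forall x, `|f x| * weight x <= c) -> 0 <= c.
  by move=> /(_ 0); apply: le_trans; rewrite mulr_ge0.
have := @Rint_coor_derive R d i (fun x => monom a x * partials (nseq k i) phi x)
  (fun x => monom a x * partials (nseq k.+1 i) phi x +
     (a i)%:R * (monom a' x * partials (nseq k i) phi x)) (C + (C1 + (a i)%:R * C2)).
rewrite RintD ?RintZ; [|exact: L1_monom|exact: L1_monom|exact/L1Z/L1_monom].
have -> : (a i)%:R * \int[mu]_x (monom a' x * partials (nseq k i) phi x) = 0.
  case: (posnP (a i)) => [->|ai0]; first by rewrite mul0r.
  by rewrite IH ?mulr0// /a' eqxx -ltnS prednK.
rewrite addr0; apply.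
- exact/L1_measurable/L1_monom.
- by apply: L1_measurable; apply: L1D; [exact: (L1_monom a sk1)|exact/L1Z/L1_monom].
- move=> x; have := is_deriveM (is_derive_monom a i x) (schwartz_is_derive i x sk).
  rewrite (_ : _ *: _ + _ *: _ = monom a x * partials (nseq k.+1 i) phi x +
     (a i)%:R * (monom a' x * partials (nseq k i) phi x))//.
  by rewrite /GRing.scale/= -/a' [partials (nseq k i) phi x * _]mulrC mulrA.
- move=> x; apply: (le_trans (hC x)); rewrite lerDl addr_ge0//; first exact: pos hC1.
  by rewrite mulr_ge0//; exact: pos hC2.
- move=> x; rewrite (le_trans (ler_wpM2r (w0 x) (ler_normD _ _)))// mulrDl.
  rewrite -[leLHS]add0r lerD//; first exact: pos hC.
  rewrite lerD//.
  by rewrite normrM -mulrA ger0_norm ?ler0n// ler_wpM2l ?ler0n.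
Qed.

End fourier_derivative.

(** * Gaussian regularisation and Plancherel *)

Section gaussian_functions.
Context {R : realType}.

Definition gauss1 (q : {poly R}) (c a : R) : R := q.[a] * expR (- (a - c) ^+ 2 / 2).

Lemma gauss1_moment (n : nat) (b : R) : b ^+ n.*2 * expR (- b ^+ 2 / 2) <= n.*2%:R ^+ n.
Proof.
case: n => [|n].
  by rewrite double0 !expr0 mul1r expR_le1 mulNr oppr_le0 divr_ge0// sqr_ge0.
rewrite mulNr expRN ler_pdivrMr ?expR_gt0//.
have n0 : 0 < n.+1.*2%:R :> R by rewrite ltr0n.
have -> : b ^+ 2 / 2 = n.+1%:R * (b ^+ 2 / n.+1.*2%:R).
  rewrite -muln2 natrM invfM mulrCA; congr (_ * _).
  by rewrite mulrA divff ?mul1r// pnatr_eq0.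
rewrite expRM_natl -exprMn -muln2 mulnC exprM lerXn2r ?nnegrE ?sqr_ge0 ?mulr_ge0 ?expR_ge0 ?ler0n//.
rewrite -ler_pdivrMl//; apply: le_trans (expR_ge1Dx _).
by rewrite mulnC muln2 mulrC lerDr.
Qed.

Lemma gauss1_monom_bound (n : nat) (b : R) :
  `|b ^+ n * expR (- b ^+ 2 / 2)| <= 1 + n.*2%:R ^+ n.
Proof.
rewrite normrM [X in _ * X]ger0_norm ?expR_ge0//.
have e1 : expR (- b ^+ 2 / 2) <= 1.
  by rewrite expR_le1 mulNr oppr_le0 divr_ge0// sqr_ge0.
have [b1|b1] := leP `|b| 1.
  rewrite (@le_trans _ _ 1)// ?lerDl ?exprn_ge0//.
  rewrite normrX -[leRHS]mulr1 ler_pM ?expR_ge0// ?exprn_ge0// exprn_ile1//.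
rewrite (@le_trans _ _ (n.*2%:R ^+ n))// ?lerDr//.
apply: le_trans (gauss1_moment n b); rewrite ler_wpM2r ?expR_ge0//.
rewrite normrX -muln2 mulnC exprM -(normr_id b) -real_normK ?num_real// -exprM.
rewrite normr_id mulnC; apply: ler_weXn2l; first exact: ltW.
by rewrite muln2 -addnn leq_addr.
Qed.

Lemma gauss1_bound (q : {poly R}) (c : R) : exists C, forall a, `|gauss1 q c a| <= C.
Proof.
pose p := q \Po ('X + c%:P).
have E a : q.[a] = p.[a - c] by rewrite /p horner_comp !hornerE subrK.
exists (\sum_(i < size p) `|p`_i| * (1 + i.*2%:R ^+ i)) => a.
rewrite /gauss1 E horner_coef mulr_suml (le_trans (ler_norm_sum _ _ _))//.
apply: ler_sum => i _; rewrite -mulrA normrM ler_wpM2l//.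
exact: gauss1_monom_bound.
Qed.

Lemma is_derive_gauss1 q c (a : R) :
  is_derive a 1 (gauss1 q c) (gauss1 (q^`() - q * ('X - c%:P)) c a).
Proof.
rewrite (_ : gauss1 q c = horner q * (expR \o (fun a => - (a - c) ^+ 2 / 2)))//.
have d1 : is_derive a 1 (horner q) (q^`()).[a].
  by rewrite derivE derive1E; apply: derivableP; exact: derivable_horner.
have d2 : is_derive a 1 (expR \o (fun a => - (a - c) ^+ 2 / 2))
    (expR (- (a - c) ^+ 2 / 2) * (- (a - c))).
  apply: is_derive1_comp.
  rewrite (_ : (fun _ => _) = (- 2^-1) \*: ((id - cst c) ^+ 2)); last first.
    by apply/funext => t /=; rewrite /GRing.scale/= mulNr mulrC mulNr.
  apply: is_derive_eq.
  by rewrite /GRing.scale/= subr0 mulr1 expr1 mulNr mulrA mulVf ?mul1r.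
apply: is_derive_eq; rewrite /gauss1 /= !hornerE.
rewrite -[_.[a] *: _]/(_ * _) -[_ *: _]/(_ * _); ring.
Qed.

Lemma continuous_gauss1 q c : continuous (gauss1 q c).
Proof.
move=> a; apply: differentiable_continuous; apply/derivable1_diffP.
by have [] := is_derive_gauss1 q c a.
Qed.

Lemma integral_gauss1 : (\int[lebesgue_measure]_a (gauss1 1 0 a)%:E =
  (Num.sqrt (2 * pi))%:E)%E.
Proof.
have s0 : Num.sqrt (2 * pi) != 0 :> R by rewrite gt_eqF// sqrtr_gt0 mulr_gt0// pi_gt0.
have E a : gauss1 1 0 a = Num.sqrt (2 * pi) * normal_pdf 0 1 a.
  rewrite /gauss1 hornerC mul1r normal_pdfE ?oner_neq0// /normal_peak /normal_fun.
  by rewrite expr1n mul1r -[pi *+ 2]mulr_natl mulrA divff// mul1r.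
under eq_integral do rewrite E EFinM.
rewrite integralZl//=; last exact: integrable_normal_pdf.
by rewrite integral_normal_pdf mule1.
Qed.

Lemma L1_gauss1 : L1 lebesgue_measure (gauss1 1 0).
Proof.
apply: Rint_ge0E.
- by apply: continuous_measurable_fun; exact: continuous_gauss1.
- by move=> a; rewrite /gauss1 hornerC mul1r expR_ge0.
- by rewrite integral_gauss1 ltry.
Qed.

Context {d : nat}.
Local Notation mu := (@lebesgue_rV R d).
Local Notation e i := (delta_mx ord0 i : 'rV[R]_d).

Definition gaussp (q : 'I_d -> {poly R}) (c x : 'rV[R]_d) : R :=
  \prod_(i < d) gauss1 (q i) (c ord0 i) (x ord0 i).

Lemma is_derive_gaussp q c x i : is_derive x (e i) (gaussp q c)
  (gaussp (fun j => if j == i then (q i)^`() - q i * ('X - (c ord0 i)%:P) else q j) c x).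
Proof.
apply: line_is_derive.
pose k := \prod_(j < d | j != i) gauss1 (q j) (c ord0 j) (x ord0 j).
rewrite (_ : (fun _ => _) = k \*: (gauss1 (q i) (c ord0 i) \o (cst (x ord0 i) + id))); last first.
  apply/funext => t; rewrite /gaussp (bigD1 i)//= !mxE !eqxx/= mulr1 mulrC.
  congr (_ * _).
  by apply: eq_bigr => j ji; rewrite !mxE eqxx/= (negbTE ji) mulr0 addr0.
have h : is_derive (0 : R) 1 (gauss1 (q i) (c ord0 i) \o (cst (x ord0 i) + id))
   (gauss1 ((q i)^`() - q i * ('X - (c ord0 i)%:P)) (c ord0 i) (x ord0 i) * 1).
  apply: is_derive1_comp.
    by rewrite fctE /= addr0; exact: is_derive_gauss1.
  by apply: is_derive_eq; rewrite add0r.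
apply: is_derive_eq; rewrite /gaussp [RHS](bigD1 i)//= eqxx /GRing.scale/= mulr1 mulrC.
by congr (_ * _); apply: eq_bigr => j /negbTE ->.
Qed.

Lemma differentiable_prod (V : normedModType R) (I : Type) (r : seq I)
    (f : I -> V -> R) x : (forall i, differentiable (f i) x) ->
  differentiable (fun y => \prod_(i <- r) f i y) x.
Proof.
move=> df; elim: r => [|i r IH].
  by under eq_fun do rewrite big_nil; exact: differentiable_cst.
by under eq_fun do rewrite big_cons; exact: differentiableM.
Qed.

Lemma differentiable_gaussp q c x : differentiable (gaussp q c) x.
Proof.
apply: differentiable_prod => i.
apply: (@differentiable_comp _ _ _ _ (fun y : 'rV[R]_d => y ord0 i)).
  exact: differentiable_coord.
apply/derivable1_diffP; by have [] := is_derive_gauss1 (q i) (c ord0 i) (x ord0 i).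
Qed.

Lemma partials_gaussp (w : seq 'I_d) q c : exists q', partials w (gaussp q c) = gaussp q' c.
Proof.
elim: w => [|i w [q' IH]]; first by exists q.
exists (fun j => if j == i then (q' i)^`() - q' i * ('X - (c ord0 i)%:P) else q' j).
rewrite /= IH; apply/funext => x; by have [_ ->] := is_derive_gaussp q' c x i.
Qed.

Lemma schwartz_gaussp q c : schwartz (gaussp q c).
Proof.
split=> [w x|a w].
  by have [q' ->] := partials_gaussp w q c; exact: differentiable_gaussp.
have [q' ->] := partials_gaussp w q c.
have /choice[C hC] : forall i, exists C, forall t,
    `|gauss1 ('X^(a i) * q' i) (c ord0 i) t| <= C.
  by move=> i; exact: gauss1_bound.
exists (\prod_i C i) => x; rewrite /monom /gaussp -big_split/= normr_prod.
apply: ler_prod => i _; rewrite normr_ge0/=.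
by have := hC i (x ord0 i); rewrite /gauss1 hornerM hornerXn mulrA.
Qed.

End gaussian_functions.

Section gaussian_fourier.
Context {R : realType} {d : nat}.
Local Notation mu := (@lebesgue_rV R d).
Local Notation e i := (delta_mx ord0 i : 'rV[R]_d).
Implicit Types (f g phi : 'rV[R]_d -> R) (x y xi : 'rV[R]_d).

Definition gauss x : R := gaussp (fun=> 1) 0 x.

Definition gauss_mass : R := Num.sqrt (2 * pi) ^+ d.

Lemma gaussE x : gauss x = expR (- dot x x / 2).
Proof.
rewrite /gauss /gaussp /dot -sumrN mulr_suml expR_sum; apply: eq_bigr => i _.
by rewrite /gauss1 hornerC mul1r mxE subr0 -expr2.
Qed.

Lemma gauss_gt0 x : 0 < gauss x.
Proof. by rewrite gaussE expR_gt0. Qed.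

Lemma dot_ge0 x : 0 <= dot x x.
Proof. by rewrite /dot sumr_ge0// => i _; rewrite -expr2 sqr_ge0. Qed.

Lemma gauss_le1 x : gauss x <= 1.
Proof. by rewrite gaussE expR_le1 mulNr oppr_le0 divr_ge0// dot_ge0. Qed.

Lemma gaussN x : gauss (- x) = gauss x.
Proof. by rewrite !gaussE dotNl dotC dotNl opprK. Qed.

Lemma schwartz_gauss : schwartz gauss.
Proof. exact: schwartz_gaussp. Qed.

Lemma L1_gauss : L1 mu gauss.
Proof. exact: schwartz_L1 schwartz_gauss. Qed.

Lemma Rint_gauss : \int[mu]_x gauss x = gauss_mass.
Proof.
apply: EFin_inj; rewrite RintE; last exact: L1_gauss.
rewrite (eq_integral (fun x => (\prod_(i < d) gauss1 1 0 (x ord0 i))%:E)); last first.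
  by move=> x _; rewrite /gauss /gaussp; under eq_bigr do rewrite mxE.
rewrite (ge0_integral_prod_coor (f := fun=> gauss1 1 0)).
- rewrite (eq_bigr _ (fun _ _ => integral_gauss1)).
  rewrite /gauss_mass -[X in _ ^+ X](card_ord d) -prodr_const.
  by rewrite (big_morph EFin (fun a b : R => EFinM a b) (erefl 1%E)).
- by move=> _; exact: L1_measurable L1_gauss1.
- by move=> _ a; rewrite /gauss1 hornerC mul1r expR_ge0.
Qed.

Lemma partial_gauss i x : partials [:: i] gauss x = - (x ord0 i * gauss x).
Proof.
have [_ /= ->] := is_derive_gaussp (fun=> 1) 0 x i.
rewrite /gauss /gaussp (bigD1 i)//= eqxx [in RHS](bigD1 i)//= mulrA -[RHS]mulNr.
congr (_ * _); last by apply: eq_bigr => j /negbTE ->.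
rewrite /gauss1 !mxE -[1]/(1%:P) derivC !hornerE subr0 mulNr.
congr (- _); rewrite -[RHS]/(x ord0 i * 1 * expR (- x ord0 i ^+ 2 / 2)); by rewrite mulr1.
Qed.

Definition tr_cos f xi : R := \int[mu]_x (f x * cos (dot x xi)).
Definition tr_sin f xi : R := \int[mu]_x (f x * sin (dot x xi)).

(* Along the ray through [xi] the transform solves a linear ODE, as integration by
   parts shows, and it is known at the origin. *)
Lemma tr_cos_gauss xi : tr_cos gauss xi = gauss_mass * gauss xi.
Proof.
pose u (t : R) := \int[mu]_x (gauss x * cos (t * dot x xi)).
have dE (t : R) x : dot x (t *: xi) = t * dot x xi.
  by rewrite dotC dotZl dotC.
have Lc (t : R) : L1 mu (fun x => gauss x * cos (t * dot x xi)).
  by have := L1_cos (t *: xi) L1_gauss; under eq_fun do rewrite dE.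
have Lx : L1 mu (fun x => gauss x * dot x xi).
  have := @L1_sum _ _ _ mu 'I_d (index_enum 'I_d)
    (fun i x => - xi ord0 i * partials [:: i] gauss x).
  move=> /(_ (fun i => L1Z _ (schwartz_L1 (schwartz_partials [:: i] schwartz_gauss)))).
  congr (L1 mu); apply/funext => x; rewrite /dot mulr_sumr; apply: eq_bigr => i _.
  by rewrite partial_gauss; ring.
have dd (t : R) x : is_derive t 1 (fun t => gauss x * cos (t * dot x xi))
    (- (gauss x * dot x xi * sin (t * dot x xi))).
  rewrite (_ : (fun _ => _) = gauss x \*: (cos \o (dot x xi \*: id))); last first.
    by apply/funext => s /=; rewrite [dot x xi *: s]mulrC.
  have h : is_derive t 1 (cos \o (dot x xi \*: id)) (- sin (t * dot x xi) * dot x xi).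
    apply: is_derive1_comp; first by rewrite /= [dot x xi *: t]mulrC; exact: is_derive_cos.
    by apply: is_derive_eq; rewrite [_ *: 1]mulr1.
  by apply: is_derive_eq; rewrite -[_ *: _]/(_ * _); ring.
have du (t : R) : is_derive t 1 u (- (t * dot xi xi) * u t).
  have It : `]t - 1, t + 1[%classic t by rewrite /= in_itv/=; apply/andP; split; lra.
  have d1 (s : R) x : partial1of2 (fun t x => gauss x * cos (t * dot x xi)) s x =
      - (gauss x * dot x xi * sin (s * dot x xi)).
    by rewrite partial1of2E; have [_ ->] := dd s x.
  have bd (s : R) x : `|partial1of2 (fun t x => gauss x * cos (t * dot x xi)) s x| <=
      `|gauss x * dot x xi|.
    by rewrite d1 normrN normrM ler_piMr// sin_norm_le1.
  have hd := @derivable_under_integral R _ _ mu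
    (fun t x => gauss x * cos (t * dot x xi)) setT measurableT t (t - 1) (t + 1) It
    (fun s _ => Lc s) (fun s x _ _ => @ex_derive _ _ _ _ _ _ _ (dd s x))
    (fun x => `|gauss x * dot x xi|) (fun=> normr_ge0 _) (L1_norm Lx)
    (fun s x _ _ => bd s x).
  have hv := @differentiation_under_integral R _ _ mu
    (fun t x => gauss x * cos (t * dot x xi)) setT measurableT t (t - 1) (t + 1) It
    (fun s _ => Lc s) (fun s x _ _ => @ex_derive _ _ _ _ _ _ _ (dd s x))
    (fun x => `|gauss x * dot x xi|) (fun=> normr_ge0 _) (L1_norm Lx)
    (fun s x _ _ => bd s x).
  apply: DeriveDef; first exact: hd.
  rewrite -derive1E hv.
  rewrite (eq_Rint _ (g := fun x => \sum_(i < d) xi ord0 i *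
     (partials [:: i] gauss x * sin (dot x (t *: xi))))) => [|x]; last first.
    rewrite d1 dE {1}/dot mulr_sumr mulr_suml -sumrN; apply: eq_bigr => i _.
    by rewrite partial_gauss; ring.
  have LS i : L1 mu (fun x => xi ord0 i * (partials [:: i] gauss x * sin (dot x (t *: xi)))).
    by apply: L1Z; apply: L1_sin; exact: schwartz_L1 (schwartz_partials [:: i] schwartz_gauss).
  rewrite Rint_sum// /dot mulr_sumr -sumrN mulr_suml; apply: eq_bigr => i _.
  rewrite RintZ; last by apply: L1_sin; exact: schwartz_L1 (schwartz_partials [:: i] schwartz_gauss).
  rewrite (Rint_coor_derive_schwartz i _ schwartz_gauss).2 mxE.
  have -> : \int[mu]_x (gauss x * cos (dot x (t *: xi))) = u t.
    by apply: eq_Rint => x; rewrite dE.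
  ring.
pose E (t : R) := expR (t ^+ 2 * (dot xi xi / 2)).
have dE' (t : R) : is_derive t 1 E (E t * (t * dot xi xi)).
  rewrite (_ : E = expR \o ((dot xi xi / 2) \*: (id ^+ 2))); last first.
    by apply/funext => s; rewrite /E /= [_ *: _]mulrC.
  apply: is_derive1_comp.
  apply: is_derive_eq; rewrite -[_ *: _]/(_ * _) -[_%:A]/(_ * _) /= expr1; lra.
have v0 : u 1 * E 1 = u 0 * E 0.
  apply: (@is_derive_0_is_cst _ (u * E)) => t.
  by apply: is_derive_eq; rewrite -[_ *: _]/(_ * _) -[E t *: _]/(_ * _); ring.
rewrite /tr_cos (eq_Rint _ (g := fun x => gauss x * cos (1 * dot x xi))) => [|x]; last by rewrite mul1r.
rewrite -/(u 1).
have -> : gauss_mass = u 0.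
  by rewrite -Rint_gauss; apply: eq_Rint => x; rewrite mul0r cos0 mulr1.
move: v0; rewrite /E expr1n expr0n mul0r expR0 mulr1 mul1r => <-.
by rewrite gaussE -mulrA mulNr expRN divff ?mulr1// gt_eqF// expR_gt0.
Qed.

End gaussian_fourier.

Section gaussian_regularisation.
Context {R : realType} {d : nat}.
Local Notation mu := (@lebesgue_rV R d).
Implicit Types (f g u phi psi : 'rV[R]_d -> R) (x y xi : 'rV[R]_d).
Local Notation Z := (@gauss_mass R d).

Lemma gauss_mass_gt0 : 0 < Z.
Proof. by rewrite exprn_gt0// sqrtr_gt0 mulr_gt0// pi_gt0. Qed.

Lemma fourier_constE : @fourier_const R d = Z^-1.
Proof.
have p0 : 0 <= 2 * pi :> R by rewrite mulr_ge0// pi_ge0.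
rewrite /fourier_const /gauss_mass powRN; congr (_^-1).
by rewrite [_ / _]mulrC powRrM powR12_sqrt// powR_mulrn// sqrtr_ge0.
Qed.

Lemma measurable_scale (b : R) : measurable_fun setT (fun x : 'rV[R]_d => b *: x).
Proof.
apply/measurable_fun_coorP => i; under eq_fun do rewrite mxE.
by apply: measurable_funM => //; exact: measurable_coor.
Qed.

Lemma measurable_transl (c : 'rV[R]_d) : measurable_fun setT (fun x : 'rV[R]_d => c + x).
Proof.
apply/measurable_fun_coorP => i; under eq_fun do rewrite mxE.
by apply: measurable_funD => //; exact: measurable_coor.
Qed.

Lemma Rint_trig_swap (T : R -> R) f g : measurable_fun setT T ->
  (forall a, `|T a| <= 1) -> L1 mu f -> L1 mu g ->
  \int[mu]_xi (f xi * \int[mu]_x (g x * T (dot x xi))) =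
  \int[mu]_x (g x * \int[mu]_xi (f xi * T (dot xi x))).
Proof.
move=> mT T1 Lf Lg.
have LT h y : L1 mu h -> L1 mu (fun x => h x * T (dot x y)).
  move=> Lh; apply: (@L1_Mb _ _ _ _ 1) => //.
  exact: measurableT_comp mT (measurable_dotl y).
have := @Rint_fubini _ _ _ _ _ mu mu f g (fun xi x => f xi * (g x * T (dot x xi))) Lf Lg.
have mF : measurable_fun [set: 'rV[R]_d * 'rV[R]_d]
    (fun p => f p.1 * (g p.2 * T (dot p.2 p.1))).
  apply: measurable_funM; first exact: measurableT_comp (L1_measurable Lf) measurable_fst.
  apply: measurable_funM; first exact: measurableT_comp (L1_measurable Lg) measurable_snd.
  by apply: measurableT_comp mT _; under eq_fun do rewrite dotC; exact: measurable_dot.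
have bF y x : `|f y * (g x * T (dot x y))| <= `|f y| * `|g x|.
  by rewrite normrM ler_wpM2l// normrM ler_piMr.
move=> /(_ mF bF) swap.
transitivity (\int[mu]_xi \int[mu]_x (f xi * (g x * T (dot x xi)))).
  by apply: eq_Rint => xi; rewrite (RintZ _ (LT g xi Lg)).
rewrite swap; apply: eq_Rint => x; rewrite -RintZ; last exact: LT.
by apply: eq_Rint => xi; rewrite dotC mulrCA.
Qed.

Definition gauss_scaled (e : R) xi : R := gauss (e *: xi).

Lemma gauss_scaled_le1 e xi : gauss_scaled e xi <= 1.
Proof. exact: gauss_le1. Qed.

Lemma gauss_scaled_gt0 e xi : 0 < gauss_scaled e xi.
Proof. exact: gauss_gt0. Qed.

Lemma measurable_gauss : measurable_fun setT (gauss : 'rV[R]_d -> R).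
Proof. exact: L1_measurable L1_gauss. Qed.

Lemma measurable_gauss_scaled e : measurable_fun setT (gauss_scaled e).
Proof. exact: measurableT_comp measurable_gauss (measurable_scale e). Qed.

Lemma L1_gauss_scaled (e : R) : 0 < e -> L1 mu (gauss_scaled e).
Proof.
move=> e0; have := L1_affine 0 (lt0r_neq0 e0) (@L1_gauss R d).
by congr (L1 mu _); apply/funext => x; rewrite add0r.
Qed.

Lemma tr_cos_gauss_scaled (e : R) z : 0 < e ->
  tr_cos (gauss_scaled e) z = (e ^+ d)^-1 * (Z * gauss (e^-1 *: z)).
Proof.
move=> e0; have en0 := lt0r_neq0 e0.
rewrite -tr_cos_gauss /tr_cos.
have L : L1 mu (fun x => gauss x * cos (dot x (e^-1 *: z))) by exact: L1_cos L1_gauss.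
rewrite [in RHS](Rint_affine 0 en0 L) gtr0_norm// mulKf ?expf_neq0//.
apply: eq_Rint => x; rewrite add0r /gauss_scaled; congr (_ * cos _).
by rewrite dotZl [dot x (_ *: z)]dotC dotZl mulrA divff// mul1r dotC.
Qed.

(* Up to normalisation, the convolution of [g] with a Gaussian of width [e], i.e. the
   Fourier inverse of the transform of [g] damped by a wide Gaussian. *)
Definition regularise (e : R) g y : R :=
  \int[mu]_x (g x * tr_cos (gauss_scaled e) (x - y)).

Lemma regulariseE (e : R) g y : 0 < e -> L1 mu g ->
  regularise e g y = Z * \int[mu]_z (g (y + e *: z) * gauss z).
Proof.
move=> e0 Lg; have en0 := lt0r_neq0 e0.
have mg := L1_measurable Lg.
have mh : measurable_fun setT (fun x => gauss (e^-1 *: (x - y))).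
  apply: measurableT_comp measurable_gauss _; apply: measurableT_comp (measurable_scale _) _.
  by under eq_fun do rewrite addrC; exact: measurable_transl.
have L : L1 mu (fun x => g x * gauss (e^-1 *: (x - y))).
  apply: (@L1_Mb _ _ _ _ 1) => // x.
  by rewrite ger0_norm ?gauss_le1// ltW// gauss_gt0.
rewrite /regularise.
transitivity (\int[mu]_x ((e ^+ d)^-1 * Z * (g x * gauss (e^-1 *: (x - y))))).
  by apply: eq_Rint => x; rewrite tr_cos_gauss_scaled//; ring.
rewrite (RintZ _ L) (Rint_affine y en0 L) gtr0_norm//.
rewrite (eq_Rint _ (g := fun z : 'rV[R]_d => g (y + e *: z) * gauss z)) => [|z]; last first.
  by rewrite [y + _ - y]addrC addKr scalerA mulVf// scale1r.
move: (Rintegral _ _ _) => I.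
by rewrite [(e ^+ d)^-1 * Z]mulrC -mulrA mulKf// expf_neq0.
Qed.

Lemma L1_regularise_integrand (e : R) g y (M : R) : measurable_fun setT g ->
  (forall x, `|g x| <= M) -> L1 mu (fun z => g (y + e *: z) * gauss z).
Proof.
move=> mg gM; under eq_fun do rewrite mulrC.
apply: (@L1_Mb _ _ _ _ M) => //; first exact: L1_gauss.
apply: measurableT_comp mg _.
exact: measurableT_comp (measurable_transl y) (measurable_scale e).
Qed.

Lemma regularise_bounded (e : R) g y (M : R) : 0 < e -> L1 mu g ->
  (forall x, `|g x| <= M) -> `|regularise e g y| <= Z * (M * Z).
Proof.
move=> e0 Lg gM; have mg := L1_measurable Lg.
rewrite regulariseE// normrM gtr0_norm ?gauss_mass_gt0//.
apply: ler_wpM2l; first by rewrite ltW// gauss_mass_gt0.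
have L := L1_regularise_integrand e y mg gM.
apply: (le_trans (Rint_norm L)).
rewrite -(@Rint_gauss R d) -RintZ; last exact: L1_gauss.
apply: Rint_le; [exact: L1_norm|exact/L1Z/L1_gauss|] => x.
by rewrite normrM [X in _ * X]gtr0_norm ?gauss_gt0// ler_wpM2r// ltW// gauss_gt0.
Qed.

Lemma regularise_cvg g y (M : R) : L1 mu g -> continuous g ->
  (forall x, `|g x| <= M) ->
  (fun n => regularise n.+1%:R^-1 g y) @ \oo --> Z * (Z * g y).
Proof.
move=> Lg cg gM; have mg := L1_measurable Lg.
have e0 n : 0 < n.+1%:R^-1 :> R by rewrite invr_gt0 ltr0n.
under eq_fun do rewrite regulariseE//.
apply: cvgM; first exact: cvg_cst.
rewrite mulrC -(@Rint_gauss R d) -RintZ; last exact: L1_gauss.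
apply: (@Rint_dct _ _ _ _ _ _ (fun z => M * gauss z)).
- by move=> n; apply: L1_measurable; exact: L1_regularise_integrand gM.
- by apply: measurable_funM => //; exact: measurable_gauss.
- move=> z; apply: cvgM; last exact: cvg_cst.
  apply: continuous_cvg; first exact: cg.
  rewrite -[X in _ --> X]addr0; apply: cvgD; first exact: cvg_cst.
  rewrite -(scale0r z); apply: cvgZr_tmp.
  exact: cvg_harmonic.
- exact/L1Z/L1_gauss.
- move=> n z; rewrite normrM [X in _ * X]gtr0_norm ?gauss_gt0// ler_wpM2r//.
  by rewrite ltW// gauss_gt0.
Qed.

End gaussian_regularisation.

Section plancherel.
Context {R : realType} {d : nat}.
Local Notation mu := (@lebesgue_rV R d).
Implicit Types (f g u phi psi : 'rV[R]_d -> R) (x y xi : 'rV[R]_d).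
Local Notation Z := (@gauss_mass R d).

Lemma measurable_tr_cos f : L1 mu f -> measurable_fun setT (tr_cos f).
Proof. by apply: measurable_Rint_trig; [exact: measurable_cos|exact: cos_norm_le1]. Qed.

Lemma measurable_tr_sin f : L1 mu f -> measurable_fun setT (tr_sin f).
Proof. by apply: measurable_Rint_trig; [exact: measurable_sin|exact: sin_norm_le1]. Qed.

Lemma tr_cos_bounded f xi : L1 mu f -> `|tr_cos f xi| <= \int[mu]_x `|f x|.
Proof.
move=> Lf; have L := L1_cos xi Lf; apply: (le_trans (Rint_norm L)).
apply: Rint_le; [exact: L1_norm|exact: L1_norm|] => x.
by rewrite normrM ler_piMr// cos_norm_le1.
Qed.

Lemma tr_sin_bounded f xi : L1 mu f -> `|tr_sin f xi| <= \int[mu]_x `|f x|.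
Proof.
move=> Lf; have L := L1_sin xi Lf; apply: (le_trans (Rint_norm L)).
apply: Rint_le; [exact: L1_norm|exact: L1_norm|] => x.
by rewrite normrM ler_piMr// sin_norm_le1.
Qed.

Definition tr_dot f g xi : R := tr_cos f xi * tr_cos g xi + tr_sin f xi * tr_sin g xi.

Lemma measurable_tr_dot f g : L1 mu f -> L1 mu g -> measurable_fun setT (tr_dot f g).
Proof.
move=> Lf Lg.
apply: measurable_funD.
  exact: measurable_funM (measurable_tr_cos Lf) (measurable_tr_cos Lg).
exact: measurable_funM (measurable_tr_sin Lf) (measurable_tr_sin Lg).
Qed.

Lemma regularise_pairing (e : R) f g : 0 < e -> L1 mu f -> L1 mu g ->
  \int[mu]_x (g x * regularise e f x) =
  \int[mu]_xi (gauss_scaled e xi * tr_dot f g xi).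
Proof.
move=> e0 Lf Lg; have Lgs := @L1_gauss_scaled R d e e0.
have LC : L1 mu (fun xi => gauss_scaled e xi * tr_cos f xi).
  by apply: (L1_Mb Lgs) => [|xi]; [exact: measurable_tr_cos|exact: tr_cos_bounded].
have LS : L1 mu (fun xi => gauss_scaled e xi * tr_sin f xi).
  by apply: (L1_Mb Lgs) => [|xi]; [exact: measurable_tr_sin|exact: tr_sin_bounded].
have LCC : L1 mu (fun xi => gauss_scaled e xi * tr_cos f xi * tr_cos g xi).
  by apply: (L1_Mb LC) => [|xi]; [exact: measurable_tr_cos|exact: tr_cos_bounded].
have LSS : L1 mu (fun xi => gauss_scaled e xi * tr_sin f xi * tr_sin g xi).
  by apply: (L1_Mb LS) => [|xi]; [exact: measurable_tr_sin|exact: tr_sin_bounded].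
transitivity (\int[mu]_xi (gauss_scaled e xi * tr_cos f xi * tr_cos g xi +
    gauss_scaled e xi * tr_sin f xi * tr_sin g xi)); last first.
  by apply: eq_Rint => xi; rewrite /tr_dot mulrDr !mulrA.
rewrite (RintD LCC LSS).
rewrite (Rint_trig_swap measurable_cos cos_norm_le1 LC Lg).
rewrite (Rint_trig_swap measurable_sin sin_norm_le1 LS Lg).
have inner (T : R -> R) x : measurable_fun setT T -> (forall a, `|T a| <= 1) ->
    \int[mu]_xi (gauss_scaled e xi * (\int[mu]_y (f y * T (dot y xi))) * T (dot xi x)) =
    \int[mu]_y (f y * \int[mu]_xi (gauss_scaled e xi * T (dot xi x) * T (dot xi y))).
  move=> mT T1.
  have LT : L1 mu (fun xi => gauss_scaled e xi * T (dot xi x)).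
    by apply: (L1_Mb Lgs) => //; exact: measurableT_comp mT (measurable_dotl x).
  rewrite -(Rint_trig_swap mT T1 LT Lf).
  by apply: eq_Rint => xi; rewrite mulrAC.
have LT (T : R -> R) x y : measurable_fun setT T -> (forall a, `|T a| <= 1) ->
    L1 mu (fun xi => gauss_scaled e xi * T (dot xi x) * T (dot xi y)).
  move=> mT T1; apply: (@L1_Mb _ _ _ _ 1) => //; last first.
    exact: measurableT_comp mT (measurable_dotl y).
  by apply: (L1_Mb Lgs) => //; exact: measurableT_comp mT (measurable_dotl x).
have kernel x y : tr_cos (gauss_scaled e) (y - x) =
    \int[mu]_xi (gauss_scaled e xi * cos (dot xi x) * cos (dot xi y)) +
    \int[mu]_xi (gauss_scaled e xi * sin (dot xi x) * sin (dot xi y)).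
  rewrite -(RintD (LT cos x y measurable_cos cos_norm_le1) (LT sin x y measurable_sin sin_norm_le1)).
  apply: eq_Rint => xi; rewrite [dot xi (y - x)]dotC dotDl dotNl cosB.
  by rewrite [dot y xi]dotC [dot x xi]dotC; ring.
have LfT (T : R -> R) x : measurable_fun setT T -> (forall a, `|T a| <= 1) ->
    L1 mu (fun y => f y * \int[mu]_xi (gauss_scaled e xi * T (dot xi x) * T (dot xi y))).
  move=> mT T1.
  have LT1 : L1 mu (fun xi => gauss_scaled e xi * T (dot xi x)).
    by apply: (L1_Mb Lgs) => //; exact: measurableT_comp mT (measurable_dotl x).
  apply: (@L1_Mb _ _ _ _ (\int[mu]_xi `|gauss_scaled e xi * T (dot xi x)|)) => //.
    exact: measurable_Rint_trig.
  move=> y; apply: (le_trans (Rint_norm (LT T x y mT T1))).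
  apply: Rint_le; [exact/L1_norm/LT|exact: L1_norm|] => xi.
  by rewrite normrM ler_piMr.
have outer (T : R -> R) (F : 'rV[R]_d -> R) (M : R) : measurable_fun setT T ->
    (forall a, `|T a| <= 1) -> L1 mu F ->
    L1 mu (fun x => g x * \int[mu]_xi (F xi * T (dot xi x))).
  move=> mT T1 LF; apply: (@L1_Mb _ _ _ _ (\int[mu]_xi `|F xi|)) => //.
    exact: measurable_Rint_trig.
  move=> x.
  have LFT : L1 mu (fun xi => F xi * T (dot xi x)).
    by apply: (@L1_Mb _ _ _ _ 1) => //; exact: measurableT_comp mT (measurable_dotl x).
  apply: (le_trans (Rint_norm LFT)).
  apply: Rint_le; [exact: L1_norm|exact: L1_norm|] => xi.
  by rewrite normrM ler_piMr.
rewrite -RintD; last 2 first.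
- by apply: outer => //; [exact: measurable_cos|exact: cos_norm_le1].
- by apply: outer => //; [exact: measurable_sin|exact: sin_norm_le1].
apply: eq_Rint => x; rewrite -mulrDr; congr (_ * _).
rewrite /regularise (inner cos x measurable_cos cos_norm_le1).
rewrite (inner sin x measurable_sin sin_norm_le1).
rewrite -(RintD (LfT cos x measurable_cos cos_norm_le1) (LfT sin x measurable_sin sin_norm_le1)).
by apply: eq_Rint => y; rewrite -mulrDr -kernel.
Qed.

Lemma regularise_measurable (e : R) f : 0 < e -> L1 mu f ->
  measurable_fun setT (regularise e f).
Proof.
move=> e0 Lf.
have Lgs := @L1_gauss_scaled R d e e0.
have mk : measurable_fun setT (tr_cos (gauss_scaled e) : 'rV[R]_d -> R).
  exact: measurable_tr_cos.
have mf : measurable_fun [set: 'rV[R]_d * 'rV[R]_d]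
    (fun p => (weight p.1)^-1 * (f p.2 * tr_cos (gauss_scaled e) (p.2 - p.1))).
  apply: measurable_funM.
    exact: measurableT_comp (L1_measurable L1_weightV) measurable_fst.
  apply: measurable_funM; first exact: measurableT_comp (L1_measurable Lf) measurable_snd.
  apply: measurableT_comp mk _; apply/measurable_fun_coorP => i.
  under eq_fun do rewrite !mxE; apply: measurable_funB.
    exact: (measurableT_comp (@measurable_coor _ _ d i) measurable_snd).
  exact: (measurableT_comp (@measurable_coor _ _ d i) measurable_fst).
pose M := \int[mu]_x `|gauss_scaled e x|.
have := @L1_Rint_section _ _ _ _ _ mu mu (fun x => (weight x)^-1) (fun x => M * f x)
  (fun y x => (weight y)^-1 * (f x * tr_cos (gauss_scaled e) (x - y)))
  L1_weightV (L1Z M Lf) mf.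
have M0 : 0 <= M by apply: Rintegral_ge0.
have bd y x : `|(weight y)^-1 * (f x * tr_cos (gauss_scaled e) (x - y))| <=
    `|(weight y)^-1| * `|M * f x|.
  rewrite normrM ler_wpM2l// normrM [X in _ <= X]normrM mulrC ler_wpM2r//.
  by rewrite (ger0_norm M0); exact: tr_cos_bounded.
move=> /(_ bd)/L1_measurable mw.
have := measurable_funM (@measurable_weight R d) mw.
apply: eq_measurable_fun => y _ /=.
rewrite RintZ ?mulrA ?divff ?mul1r ?gt_eqF ?weight_gt0//.
apply: (@L1_Mb _ _ _ _ M) => //.
  apply: measurableT_comp mk _; under eq_fun do rewrite addrC; exact: measurable_transl.
by move=> x; exact: tr_cos_bounded.
Qed.

Lemma regularise_pairing_cvg f g (M : R) : L1 mu f -> L1 mu g -> continuous f ->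
  (forall x, `|f x| <= M) ->
  (fun n => \int[mu]_xi (gauss_scaled n.+1%:R^-1 xi * tr_dot f g xi)) @ \oo -->
  Z ^+ 2 * \int[mu]_x (g x * f x).
Proof.
move=> Lf Lg cf fM.
have e0 n : 0 < n.+1%:R^-1 :> R by rewrite invr_gt0 ltr0n.
have mf := L1_measurable Lf; have mg := L1_measurable Lg.
have Lgf : L1 mu (fun x => g x * f x) by apply: (@L1_Mb _ _ _ _ M).
rewrite -RintZ//.
under eq_fun do rewrite -regularise_pairing//.
apply: (@Rint_dct _ _ _ _ _ _ (fun x => Z * (M * Z) * `|g x|)).
- by move=> n; apply: measurable_funM => //; exact: regularise_measurable.
- by apply: measurable_funM => //; exact: measurable_funM.
- move=> x; rewrite (_ : Z ^+ 2 * (g x * f x) = g x * (Z * (Z * f x))); last by ring.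
  by apply: cvgM; [exact: cvg_cst|exact: regularise_cvg fM].
- exact/L1Z/L1_norm.
- move=> n x; rewrite normrM mulrC ler_wpM2r//; exact: regularise_bounded.
Qed.

Lemma gauss_scaled_cvg xi : (fun n => gauss_scaled n.+1%:R^-1 xi) @ \oo --> (1 : R).
Proof.
rewrite [X in _ --> X](_ : 1 = gauss (0 : 'rV[R]_d)); last first.
  by rewrite gaussE -{1}(scale0r (0 : 'rV[R]_d)) dotZl mul0r oppr0 mul0r expR0.
apply: continuous_cvg; first exact: (schwartz_continuous schwartz_gauss).
rewrite -[X in _ --> X](scale0r xi); apply: cvgZr_tmp; exact: cvg_harmonic.
Qed.

Lemma L1_tr_dot_diag f (M : R) : L1 mu f -> continuous f ->
  (forall x, `|f x| <= M) -> L1 mu (tr_dot f f).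
Proof.
move=> Lf cf fM.
have F0 xi : 0 <= tr_dot f f xi by rewrite addr_ge0// -expr2 sqr_ge0.
have mF := measurable_tr_dot Lf Lf.
apply: Rint_ge0E => //.
have e0 n : 0 < n.+1%:R^-1 :> R by rewrite invr_gt0 ltr0n.
have Lh n : L1 mu (fun xi => gauss_scaled n.+1%:R^-1 xi * tr_dot f f xi).
  apply: (@L1_Mb _ _ _ _ ((\int[mu]_x `|f x|) ^+ 2 + (\int[mu]_x `|f x|) ^+ 2)) => //.
    exact: L1_gauss_scaled.
  move=> xi; rewrite ger0_norm// /tr_dot -!expr2 lerD//.
    by rewrite -[leLHS]real_normK ?num_real// lerXn2r ?nnegrE ?Rintegral_ge0 ?tr_cos_bounded.
  by rewrite -[leLHS]real_normK ?num_real// lerXn2r ?nnegrE ?Rintegral_ge0 ?tr_sin_bounded.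
pose h n xi := (gauss_scaled n.+1%:R^-1 xi * tr_dot f f xi)%:E.
have mh n : measurable_fun setT (h n) by exact/measurable_EFinP/L1_measurable/Lh.
have h0 n xi : setT xi -> (0 <= h n xi)%E.
  by move=> _; rewrite lee_fin mulr_ge0// ltW// gauss_scaled_gt0.
have ndh xi : setT xi -> {homo (fun n => h n xi) : m n / (m <= n)%N >-> (m <= n)%E}.
  move=> _ m n mn; rewrite lee_fin ler_wpM2r//.
  rewrite /gauss_scaled !gaussE ler_expR !mulNr lerN2 ler_wpM2r ?invr_ge0//.
  rewrite !dotZl ![dot xi (_ *: _)]dotC !dotZl.
  have mn' : n.+1%:R^-1 <= m.+1%:R^-1 :> R by rewrite lef_pV2 ?posrE ?ltr0n// ler_nat.
  by apply: ler_pM => //; rewrite ?invr_ge0 ?mulr_ge0 ?invr_ge0 ?dot_ge0// ler_wpM2r ?dot_ge0.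
have lim1 := @cvg_monotone_convergence _ _ _ mu setT measurableT h mh h0 ndh.
have lim2 := regularise_pairing_cvg Lf Lf cf fM.
rewrite (eq_integral (fun xi => limn (h^~ xi))).
  rewrite -(cvg_lim _ lim1)//.
  suff -> : limn (fun n => \int[mu]_x h n x)%E =
      (Z ^+ 2 * \int[mu]_x (f x * f x))%:E by rewrite ltry.
  apply/cvg_lim => //.
  rewrite (_ : (fun n => _) = EFin \o
    (fun n => \int[mu]_xi (gauss_scaled n.+1%:R^-1 xi * tr_dot f f xi))).
    by apply: cvg_EFin => //; exact: nearW.
  by apply/funext => n /=; rewrite RintE.
move=> xi _; apply/esym/cvg_lim => //; apply: cvg_EFin; first exact: nearW.
rewrite -[X in _ --> X]mul1r; apply: cvgM; [exact: gauss_scaled_cvg|exact: cvg_cst].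
Qed.

Lemma L1_tr_dot f g (M N : R) : L1 mu f -> continuous f ->
  (forall x, `|f x| <= M) -> L1 mu g -> continuous g ->
  (forall x, `|g x| <= N) -> L1 mu (tr_dot f g).
Proof.
move=> Lf cf fM Lg cg gN.
apply: L1_le (L1D (L1_tr_dot_diag Lf cf fM) (L1_tr_dot_diag Lg cg gN)) _.
  exact: measurable_tr_dot.
move=> xi; rewrite /tr_dot ler_norml; apply/andP; split.
  have := sqr_ge0 (tr_cos f xi + tr_cos g xi).
  have := sqr_ge0 (tr_sin f xi + tr_sin g xi).
  have := sqr_ge0 (tr_cos f xi); have := sqr_ge0 (tr_cos g xi).
  have := sqr_ge0 (tr_sin f xi); have := sqr_ge0 (tr_sin g xi).
  nra.
have := sqr_ge0 (tr_cos f xi - tr_cos g xi).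
have := sqr_ge0 (tr_sin f xi - tr_sin g xi).
have := sqr_ge0 (tr_cos f xi); have := sqr_ge0 (tr_cos g xi).
have := sqr_ge0 (tr_sin f xi); have := sqr_ge0 (tr_sin g xi).
nra.
Qed.

Lemma Rint_tr_dot f g (M N : R) : L1 mu f -> continuous f ->
  (forall x, `|f x| <= M) -> L1 mu g -> continuous g ->
  (forall x, `|g x| <= N) ->
  \int[mu]_xi tr_dot f g xi = Z ^+ 2 * \int[mu]_x (g x * f x).
Proof.
move=> Lf cf fM Lg cg gN; have L := L1_tr_dot Lf cf fM Lg cg gN.
have lim2 := regularise_pairing_cvg Lf Lg cf fM.
have mF := measurable_tr_dot Lf Lg.
rewrite -(cvg_lim _ lim2)//; apply/esym/cvg_lim => //.
apply: (@Rint_dct _ _ _ _ _ _ (fun xi => `|tr_dot f g xi|)) => //.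
- by move=> n; apply: measurable_funM => //; exact: measurable_gauss_scaled.
- move=> xi; rewrite -[X in _ --> X]mul1r.
  by apply: cvgM; [exact: gauss_scaled_cvg|exact: cvg_cst].
- exact: L1_norm.
- by move=> n xi; rewrite normrM ler_piMl// gtr0_norm ?gauss_scaled_gt0// gauss_scaled_le1.
Qed.

Lemma tr_zero_pairing u g (M : R) : L1 mu u -> (forall xi, tr_cos u xi = 0) ->
  (forall xi, tr_sin u xi = 0) -> L1 mu g -> continuous g ->
  (forall x, `|g x| <= M) -> \int[mu]_x (u x * g x) = 0.
Proof.
move=> Lu C0 S0 Lg cg gM.
have := regularise_pairing_cvg Lg Lu cg gM.
rewrite (_ : (fun _ => _) = fun=> 0); last first.
  apply/funext => n; under eq_Rint do rewrite /tr_dot C0 S0 !mulr0 addr0 mulr0.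
  exact: Rintegral0.
move=> /cvg_lim h; have := h (@norm_hausdorff _ _); rewrite lim_cst// => /esym/eqP.
by rewrite mulf_eq0 expf_eq0/= gt_eqF ?gauss_mass_gt0//= => /eqP.
Qed.

End plancherel.

Section fourier_uniqueness.
Context {R : realType} {d : nat}.
Local Notation mu := (@lebesgue_rV R d).
Implicit Types (u : 'rV[R]_d -> R) (x y xi : 'rV[R]_d).

Definition ray (a : 'rV[R]_d) : set 'rV[R]_d := [set x | forall i, a ord0 i < x ord0 i].

Definition rays : set (set 'rV[R]_d) := range ray.

Lemma rays_setI : setI_closed rays.
Proof.
move=> _ _ [a _ <-] [b _ <-].
exists (\row_i Num.max (a ord0 i) (b ord0 i)) => //; apply/seteqP; split => x /=.
  by move=> h; split=> i; have := h i; rewrite mxE gt_max => /andP[].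
by move=> [ha hb] i; rewrite mxE gt_max ha hb.
Qed.

Lemma ray_bigcap (a : 'rV[R]_d) : ray a =
  \bigcap_(i : 'I_d) ((fun x : 'rV[R]_d => x ord0 i) @^-1` `]a ord0 i, +oo[%classic).
Proof.
apply/seteqP; split => x /= h i; first by move=> _ /=; rewrite in_itv/= h.
by have := h i I; rewrite /= in_itv/= andbT.
Qed.

Lemma ray_measurable a : measurable (ray a).
Proof.
rewrite ray_bigcap; apply: fin_bigcap_measurable => // i _.
by rewrite -[X in measurable X]setTI; apply: (@measurable_coor _ _ d i).
Qed.

Lemma exists_nat_gt (I : finType) (f : I -> R) : exists n : nat, forall i, f i < n%:R.
Proof.
exists (\sum_i Num.bound `|f i|)%N => i.
rewrite (le_lt_trans (ler_norm _))// (lt_le_trans (archi_boundP _))//.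
by rewrite ler_nat (bigD1 i)//= leq_addr.
Qed.

Lemma rays_measurable : @measurable _ 'rV[R]_d = <<s rays >>.
Proof.
apply/seteqP; split; last first.
  apply: smallest_sub; first exact: sigma_algebra_measurable.
  by move=> _ [a _ <-]; exact: ray_measurable.
have coorP i : @measurable_fun _ _ (g_sigma_algebraType rays) R setT
    (fun x : 'rV[R]_d => x ord0 i).
  apply: (measurability _ (RGenOInfty.measurableE R)) => _ [_ [a ->] <-].
  rewrite setTI.
  rewrite (_ : _ @^-1` _ = \bigcup_n ray
    (\row_j (if j == i then a else - n%:R))).
    apply: bigcupT_measurable => n; apply: sub_sigma_algebra.
    by exists (\row_j (if j == i then a else - n%:R)).
  apply/seteqP; split => x /=; rewrite in_itv/= andbT.
    move=> ax; have [n hn] := exists_nat_gt (fun i => - x ord0 i).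
    by exists n => // j; rewrite mxE; case: eqP => [->//|_]; rewrite ltrNl.
  by move=> [n _ /(_ i)]; rewrite mxE eqxx.
apply: smallest_sub; first exact: smallest_sigma_algebra.
elim/big_ind : _ => [//|A B hA hB C [/hA//|/hB//]|i _ A [B mB <-]].
by have := coorP i measurableT B mB.
Qed.

Definition ramp (n : nat) (a t : R) : R :=
  let p := (t - a + `|t - a|) / 2 in n.+1%:R * p / (1 + n.+1%:R * p).

Lemma ramp_pos a t : 0 <= (t - a + `|t - a|) / 2 :> R.
Proof. by rewrite divr_ge0// addrC -lerBlDr sub0r -normrN ler_norm. Qed.

Lemma ramp_bounds n a t : 0 <= ramp n a t <= 1.
Proof.
have p0 := ramp_pos a t; rewrite /ramp; move: (_ / 2) p0 => p p0.
have np : 0 <= n.+1%:R * p by rewrite mulr_ge0.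
have np1 : 0 < 1 + n.+1%:R * p by rewrite ltr_pwDl.
by rewrite divr_ge0 ?(ltW np1)//= ler_pdivrMr// mul1r lerDr.
Qed.

Lemma continuous_ramp n a : continuous (ramp n a).
Proof.
move=> t; have p0 := ramp_pos a t.
have cp : (fun t => n.+1%:R * ((t - a + `|t - a|) / 2)) @ t -->
    n.+1%:R * ((t - a + `|t - a|) / 2).
  apply: cvgM; first exact: cvg_cst.
  apply: cvgM; last exact: cvg_cst.
  have ca : (fun t => t - a) @ t --> t - a by apply: cvgB; [exact: cvg_id|exact: cvg_cst].
  by apply: cvgD => //; exact: cvg_norm.
apply: cvgM => //; apply: cvgV; last by apply: cvgD => //; exact: cvg_cst.
by rewrite gt_eqF// ltr_pwDl// mulr_ge0.
Qed.

Lemma ramp_cvg a t : (fun n => ramp n a t) @ \oo --> ((a < t)%R%:R : R).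
Proof.
have p0 := ramp_pos a t; rewrite /ramp.
case: ltP => [at_|ta].
  have -> : t - a + `|t - a| = 2 * (t - a) by rewrite ger0_norm ?subr_ge0 1?ltW//; ring.
  rewrite mulrC mulKf//; have b0 : 0 < t - a by rewrite subr_gt0.
  move: (t - a) b0 => b b0.
  apply/cvgrPdist_le => e e0.
  have eb : 0 < e * b by rewrite mulr_gt0.
  have /cvgrPdist_lt/(_ _ eb) := @cvg_harmonic R.
  apply: filterS => n; rewrite sub0r normrN ger0_norm ?harmonic_ge0// => /ltW h.
  have n0 : 0 < n.+1%:R :> R by rewrite ltr0n.
  have nb : 0 < 1 + n.+1%:R * b by rewrite ltr_pwDl// mulr_ge0// ltW.
  have -> : true%:R - n.+1%:R * b / (1 + n.+1%:R * b) = (1 + n.+1%:R * b)^-1.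
    by rewrite -[true%:R](divff (lt0r_neq0 nb)) -mulrBl addrK mul1r.
  rewrite ger0_norm ?invr_ge0 ?(ltW nb)//.
  rewrite -[leLHS]mul1r ler_pdivrMr//.
  move: h; rewrite /harmonic -[leLHS]mul1r ler_pdivrMr// => h.
  by rewrite (le_trans h)// mulrDr mulr1 -[leLHS]add0r lerD ?(ltW e0)//; lra.
have -> : t - a + `|t - a| = 0 by rewrite ler0_norm ?subr_le0// subrr.
under eq_fun do rewrite mul0r mulr0 mul0r.
exact: cvg_cst.
Qed.

Lemma cvg_bigprod (T : Type) (F : set_system T) {FF : Filter F} (I : Type) (r : seq I)
    (f : I -> T -> R) (l : I -> R) :
  (forall i, f i @ F --> l i) ->
  (fun n => \prod_(i <- r) f i n) @ F --> \prod_(i <- r) l i.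
Proof.
move=> fl; elim: r => [|i r IH].
  by rewrite big_nil; under eq_fun do rewrite big_nil; exact: cvg_cst.
by rewrite big_cons; under eq_fun do rewrite big_cons; exact: cvgM.
Qed.

Lemma Rint_rays_zero u a : L1 mu u -> (forall xi, tr_cos u xi = 0) ->
  (forall xi, tr_sin u xi = 0) ->
  \int[mu]_x (u x * gauss x * \1_(ray a) x) = 0.
Proof.
move=> Lu C0 S0.
pose r n x := \prod_(i < d) ramp n (a ord0 i) (x ord0 i).
pose g n x := gauss x * r n x.
have r01 n x : 0 <= r n x <= 1.
  apply/andP; split.
    by apply: prodr_ge0 => i _; have /andP[] := ramp_bounds n (a ord0 i) (x ord0 i).
  by apply: prodr_ile1 => i _; exact: ramp_bounds.
have rn1 n x : `|r n x| <= 1 by have /andP[r0 r1] := r01 n x; rewrite ger0_norm.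
have cr n : continuous (r n).
  move=> x; apply: (@cvg_bigprod _ (nbhs x)) => i.
  apply: (@continuous_comp _ _ _ (fun y : 'rV[R]_d => y ord0 i)).
    exact: coord_continuous.
  exact: continuous_ramp.
have mr n : measurable_fun setT (r n) by exact: continuous_measurable_rV.
have gg1 x : `|gauss x| <= 1 :> R by rewrite gtr0_norm ?gauss_gt0// gauss_le1.
have Lg n : L1 mu (g n) by apply: (@L1_Mb _ _ _ _ 1) => //; exact: L1_gauss.
have Lug : L1 mu (fun x => u x * gauss x).
  by apply: (@L1_Mb _ _ _ _ 1) => //; exact: measurable_gauss.
have z n : \int[mu]_x (u x * gauss x * r n x) = 0.
  under eq_Rint do rewrite -mulrA.
  apply: (@tr_zero_pairing _ _ u (g n) 1) => //.
    by move=> x; exact: (cvgM (schwartz_continuous schwartz_gauss (x:=x)) (cr n x)).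
  by move=> x; rewrite normrM -[leRHS]mulr1 ler_pM.
have : (fun n => \int[mu]_x (u x * gauss x * r n x)) @ \oo -->
   \int[mu]_x (u x * gauss x * \1_(ray a) x).
  apply: (@Rint_dct _ _ _ _ _ _ (fun x => `|u x * gauss x|)).
  - by move=> n; apply: measurable_funM => //; exact: L1_measurable Lug.
  - apply: measurable_funM; first exact: L1_measurable Lug.
    by apply: measurable_indic; exact: ray_measurable.
  - move=> x; apply: cvgM; first exact: cvg_cst.
    rewrite (_ : \1__ x = \prod_(i < d) (a ord0 i < x ord0 i)%R%:R).
      by apply: cvg_bigprod => i; exact: ramp_cvg.
    rewrite indicE; have [h|h] := pselect (ray a x).
      by rewrite mem_set// big1// => i _; rewrite h.
    have [i hi] : exists i, ~ a ord0 i < x ord0 i by apply/existsNP.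
    by rewrite memNset// (bigD1 i)//= (negbTE (introN idP hi)) mul0r.
  - exact: L1_norm.
  - by move=> n x; rewrite normrM ler_piMr.
under eq_fun do rewrite z.
by move=> /cvg_lim h; have := h (@norm_hausdorff _ _); rewrite lim_cst.
Qed.

Lemma L1_indic (v : 'rV[R]_d -> R) A : L1 mu v -> measurable A ->
  L1 mu (fun x => v x * \1_A x).
Proof.
move=> Lv mA; apply: (@L1_Mb _ _ _ _ 1) => // x.
by rewrite indicE; case: (_ \in _); rewrite ?normr0 ?normr1.
Qed.

Lemma L1_eq0_of_rays (v : 'rV[R]_d -> R) : L1 mu v ->
  (forall A, rays A -> \int[mu]_x (v x * \1_A x) = 0) ->
  {ae mu, forall x, v x = 0}.
Proof.
move=> Lv v0.
have dom A x : `|v x * \1_A x| <= `|v x|.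
  by rewrite normrM ler_piMr// indicE; case: (_ \in _); rewrite ?normr0 ?normr1.
have mvi A : measurable A -> measurable_fun setT (fun x => v x * \1_A x).
  by move=> mA; exact: L1_measurable (L1_indic Lv mA).
have intT : \int[mu]_x (v x * \1_[set: 'rV[R]_d] x) = 0.
  pose F n : set 'rV[R]_d := ray (const_mx (- n%:R)).
  have : (fun n => \int[mu]_x (v x * \1_(F n) x)) @ \oo -->
      \int[mu]_x (v x * \1_[set: 'rV[R]_d] x).
    apply: (@Rint_dct _ _ _ _ _ _ (fun x => `|v x|)) => //.
    - by move=> n; apply: mvi; exact: ray_measurable.
    - exact: mvi.
    - move=> x; apply: cvg_near_cst.
      have [n hn] := exists_nat_gt (fun i => - x ord0 i).
      exists n => // m /= nm; congr (_ * _); rewrite !indicE !mem_set//=.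
      by move=> i; rewrite mxE ltrNl (lt_le_trans (hn i))// ler_nat.
    - exact: L1_norm.
  rewrite (_ : (fun _ => _) = fun=> 0).
    by move=> /cvg_lim h; have := h (@norm_hausdorff _ _); rewrite lim_cst.
  by apply/funext => n; apply: v0; exists (const_mx (- n%:R)).
have all A : measurable A -> \int[mu]_x (v x * \1_A x) = 0.
  rewrite [X in X A]rays_measurable.
  move: A; apply: (dynkin_induction rays_measurable rays_setI) => [|A GA|S mS S0|F mF tF F0].
  - exact: intT.
  - exact: v0.
  - rewrite (eq_Rint _ (g := fun x => v x - v x * \1_S x)) => [|x].
      rewrite RintB ?S0 ?subr0//; last exact: L1_indic.
      by rewrite -[RHS]intT; apply: eq_Rint => x; rewrite indicT mulr1.
    by rewrite !indicE in_setC; case: (_ \in _); rewrite /= ?mulr1 ?mulr0 ?subr0 ?subrr.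
  - have ind0 n : \int[mu]_x (v x * \sum_(k < n) \1_(F k) x) = 0.
      under eq_Rint do rewrite mulr_sumr.
      by rewrite Rint_sum ?big1// => k; exact: L1_indic.
    have : (fun n => \int[mu]_x (v x * \sum_(k < n) \1_(F k) x)) @ \oo -->
        \int[mu]_x (v x * \1_(\bigcup_k F k) x).
      have sumE n x : \sum_(k < n) \1_(F k) x = \1_(\bigcup_(k in `I_n) F k) x :> R.
        rewrite indicE; have [[k /= kn Fkx]|h] := pselect ((\bigcup_(k in `I_n) F k) x).
          rewrite mem_set; last by exists k.
          rewrite (bigD1 (Ordinal kn))//= indicE mem_set// big1 ?addr0// => j jk.
          rewrite indicE memNset// => Fjx; move/eqP : jk; apply; apply: val_inj => /=.
          by apply: (tF _ _ I I); exists x.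
        rewrite memNset// big1// => j _; rewrite indicE memNset// => Fjx.
        by apply: h; exists j => //=.
      apply: (@Rint_dct _ _ _ _ _ _ (fun x => `|v x|)) => //.
      - move=> n; under eq_fun do rewrite sumE.
        by apply: mvi; apply: bigcup_measurable => k _; exact: mF.
      - by apply: mvi; exact: bigcupT_measurable.
      - move=> x; apply: cvg_near_cst.
        have [[k _ Fkx]|h] := pselect ((\bigcup_k F k) x).
          exists k.+1 => // n /= kn; rewrite sumE !indicE !mem_set//; first by exists k.
          by exists k.
        exists 0%N => // n _; rewrite sumE !indicE !memNset//.
        by move=> [k _ Fkx]; apply: h; exists k.
      - exact: L1_norm.
      - by move=> n x; rewrite sumE.
    rewrite (_ : (fun _ => _) = fun=> 0); last by apply/funext => n; exact: ind0.
    by move=> /cvg_lim h; have := h (@norm_hausdorff _ _); rewrite lim_cst.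
have : ae_eq mu setT (EFin \o v) (cst 0%E).
  apply: (@integral_ae_eq _ _ _ mu setT measurableT) => // E _ mE.
  rewrite integral0 integral_mkcond.
  have h := congr1 (@EFin R) (all E mE); rewrite RintE in h; last exact: L1_indic.
  rewrite -[RHS]h; apply: eq_integral => x _.
  by rewrite patchE indicE; case: (_ \in _); rewrite ?mulr1 ?mulr0.
by apply: filterS => x h; have [] := h I.
Qed.

Lemma fourier_unique u : L1 mu u -> (forall xi, tr_cos u xi = 0) ->
  (forall xi, tr_sin u xi = 0) -> {ae mu, forall x, u x = 0}.
Proof.
move=> Lu C0 S0.
have Lug : L1 mu (fun x => u x * gauss x).
  apply: (@L1_Mb _ _ _ _ 1) => // [|x]; first exact: measurable_gauss.
  by rewrite gtr0_norm ?gauss_gt0// gauss_le1.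
have := L1_eq0_of_rays Lug.
have h A : rays A -> \int[mu]_x (u x * gauss x * \1_A x) = 0.
  by move=> [a _ <-]; exact: Rint_rays_zero.
move=> /(_ h); apply: filterS => x /eqP.
by rewrite mulf_eq0 (gt_eqF (gauss_gt0 x)) orbF => /eqP.
Qed.

End fourier_uniqueness.

(** * Weighted L^2 bounds for Fourier transforms *)

Section power_singularity.
Context {R : realType}.
Local Notation leb := (@lebesgue_measure R).

Lemma derivable_powR_pos (p x : R) : 0 < x -> derivable (fun a : R => a `^ p) x 1.
Proof. by move=> x0; apply: derivable_powR; rewrite in_itv/= x0. Qed.

Lemma continuous_powR_pos (p x : R) : 0 < x -> {for x, continuous (fun a : R => a `^ p)}.
Proof.
by move=> x0; apply: differentiable_continuous; apply/derivable1_diffP/derivable_powR_pos.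
Qed.

Lemma integral_powR_trunc (p e : R) : p < 1 -> 0 < e < 1 ->
  (\int[leb]_(x in `[e, 1%R]) (x `^ (- p))%:E <= ((1 - p)^-1)%:E)%E.
Proof.
move=> p1 /andP[e0 e1].
have p10 : 0 < 1 - p by rewrite subr_gt0.
have pos x : x \in `]e, 1[ -> 0 < x by rewrite in_itv/= => /andP[+ _]; exact: lt_trans.
rewrite (@continuous_FTC2 _ _ (fun x => (1 - p)^-1 * x `^ (1 - p)) e 1 e1).
- by rewrite powR1 mulr1 -EFinB lee_fin gerBl mulr_ge0 ?powR_ge0// invr_ge0 ltW.
- apply: continuous_in_subspaceT => x; rewrite inE/= in_itv/= => /andP[ex _].
  by apply: continuous_powR_pos; exact: lt_le_trans ex.
- have cF x : 0 < x -> {for x, continuous (fun x => (1 - p)^-1 * x `^ (1 - p))}.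
    by move=> x0; apply: cvgM; [exact: cvg_cst|exact: continuous_powR_pos].
  split.
  + by move=> x /pos x0; apply: derivableM => //; exact: derivable_powR_pos.
  + by apply: cvg_at_right_filter; exact: cF.
  + by apply: cvg_at_left_filter; exact: cF.
- move=> x /pos x0; rewrite derive1E deriveM//; last exact: derivable_powR_pos.
  rewrite derive_cst scaler0 addr0 -derive1E powR_derive1 ?in_itv/= ?x0//.
  rewrite -[_ *: _]/(_ * _) mulrA mulVf ?mul1r ?gt_eqF//; congr (_ `^ _); ring.
Qed.

Definition sing (p a : R) : R := if `|a| <= 1 then `|a| `^ (- p) else 0.

Lemma sing_ge0 p a : 0 <= sing p a.
Proof. by rewrite /sing; case: ifP => // _; exact: powR_ge0. Qed.

Lemma measurable_powR_norm (p : R) : measurable_fun setT (fun a : R => `|a| `^ p).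
Proof. exact: measurableT_comp (measurable_powR p) (@normr_measurable _ _). Qed.

Lemma measurable_sing p : measurable_fun setT (sing p).
Proof.
apply: measurable_fun_ifT => //; last exact: measurable_powR_norm.
exact: measurable_fun_ler.
Qed.

Lemma L1_sing p : p < 1 -> L1 leb (sing p).
Proof.
move=> p1; apply: Rint_ge0E; [exact: measurable_sing|exact: sing_ge0|].
have half : (\int[leb]_(x in `]0%R, 1%R]) (sing p x)%:E <= ((1 - p)^-1)%:E)%E.
  pose F n : set R := `[n.+2%:R^-1, 1]%classic.
  have cup : \bigcup_n F n = `]0, 1]%classic.
    apply/seteqP; split => x.
      move=> [n _]; rewrite /F/= !in_itv/= => /andP[+ ->]; rewrite andbT.
      by apply: lt_le_trans; rewrite invr_gt0.
    rewrite /= in_itv/= => /andP[x0 x1].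
    exists (Num.bound x^-1) => //; rewrite /F/= in_itv/= x1 andbT.
    rewrite -[leRHS]invrK lef_pV2 ?posrE ?invr_gt0//.
    rewrite (le_trans (ltW (archi_boundP _)))// ?invr_ge0 ?(ltW x0)// ler_nat.
    by rewrite -addn2 leq_addr.
  have ndF : nondecreasing_seq F.
    move=> m n mn; rewrite subsetEset => x; rewrite /F/= !in_itv/= => /andP[h ->].
    by rewrite andbT (le_trans _ h)// lef_pV2 ?posrE// ler_nat !ltnS.
  have mF i : measurable (F i) by exact: measurable_itv.
  have ms i : measurable_fun (F i) (fun x => (sing p x)%:E).
    by apply/measurable_EFinP/measurable_funTS; exact: measurable_sing.
  have s0 i x : F i x -> (0 <= (sing p x)%:E)%E by rewrite lee_fin sing_ge0.
  have := @ge0_nondecreasing_set_cvg_integral _ (measurableTypeR R) R F (fun x => (sing p x)%:E) leb ndF mF ms s0.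
  rewrite cup => /cvg_lim <-//; apply: lime_le.
    by apply: ereal_nondecreasing_is_cvgn; exact: ge0_nondecreasing_set_nondecreasing_integral.
  apply: nearW => n; apply: le_trans (@integral_powR_trunc p n.+2%:R^-1 p1 _).
    rewrite le_eqVlt; apply/orP; left; apply/eqP; apply: eq_integral => x.
    rewrite inE /F/= in_itv/= => /andP[nx x1]; congr EFin.
    by rewrite /sing ger0_norm ?x1// (le_trans _ nx).
  by rewrite invr_gt0 ltr0n/= invf_lt1// ltr1n.
pose pos a := sing p a * \1_`]0, 1]%classic a.
have mpos : measurable_fun setT pos.
  by apply: measurable_funM; [exact: measurable_sing|exact: measurable_indic].
have pos0 a : 0 <= pos a by rewrite mulr_ge0 ?sing_ge0// indicE.
have Lpos : L1 leb pos.
  apply: Rint_ge0E => //; apply: le_lt_trans (ltry (1 - p)^-1); apply: le_trans half.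
  rewrite [leRHS]integral_mkcond le_eqVlt; apply/orP; left; apply/eqP.
  apply: eq_integral => a _; rewrite patchE /pos indicE.
  by case: (_ \in _); rewrite ?mulr1 ?mulr0.
have Lneg : L1 leb (fun a => pos (- a)).
  apply: Rint_ge0E => //; first by apply: (measurableT_comp (f := pos)).
  have := @ge0_integral_affine1 R 0 (-1) (EFin \o pos) _ _ _.
  rewrite normrN1 mul1e oppr_eq0 oner_eq0 => /(_ isT) h.
  under eq_integral do rewrite -mulN1r -[-1 * _]add0r.
  rewrite -h; [exact: L1_ltoo|exact/measurable_EFinP|by move=> a; rewrite lee_fin].
have L0 : L1 leb (\1_[set 0] : R -> R).
  apply: Rint_ge0E => [|a|]; [exact: measurable_indic|by rewrite indicE|].
  by rewrite integral_indic//= setIT lebesgue_measure_set1.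
apply: L1_ltoo; apply: L1_le (L1D (L1D Lpos Lneg) L0) _ => [|a].
  exact: measurable_sing.
rewrite ger0_norm ?sing_ge0// /pos !indicE.
have [a0|a0|->] := ltgtP a 0.
- have [a1|a1] := leP (- a) 1.
    rewrite [(- a \in _)]mem_set/=; last by rewrite in_itv/= oppr_gt0 a0 a1.
    by rewrite /sing normrN mulr1 -addrA addrCA lerDl addr_ge0 ?mulr_ge0 ?sing_ge0.
  by rewrite {1}/sing ltr0_norm// (lt_geF a1) !addr_ge0 ?mulr_ge0 ?sing_ge0.
- have [a1|a1] := leP a 1.
    rewrite [(a \in _)]mem_set/=; last by rewrite in_itv/= a0 a1.
    by rewrite mulr1 -addrA lerDl addr_ge0 ?mulr_ge0 ?sing_ge0.
  by rewrite {1}/sing gtr0_norm// (lt_geF a1) !addr_ge0 ?mulr_ge0 ?sing_ge0.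
- rewrite [(0 \in [set 0])]mem_set//= -[leLHS]add0r lerD//.
    by rewrite addr_ge0 ?mulr_ge0 ?sing_ge0.
  rewrite /sing normr0 ler01; have [->|p0] := eqVneq p 0; first by rewrite oppr0 powRr0.
  by rewrite powR0 ?oppr_eq0.
Qed.

End power_singularity.

Section taylor_trig.
Context {R : realType}.

Definition antideriv (p : {poly R}) : {poly R} :=
  \poly_(i < (size p).+1) (p`_i.-1 / i%:R).

Lemma deriv_antideriv p : (antideriv p)^`() = p.
Proof.
apply/polyP => i; rewrite coef_deriv coef_poly ltnS /=.
case: ltnP => [_|h]; last by rewrite mul0rn nth_default.
by rewrite -[(_ / _) *+ _]mulr_natr divfK// pnatr_eq0.
Qed.

Lemma antideriv0 p : (antideriv p).[0] = 0.
Proof. by rewrite horner_coef0 coef_poly/= invr0 mulr0. Qed.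

Lemma size_antideriv (p : {poly R}) k : (size p <= k)%N -> (size (antideriv p) <= k.+1)%N.
Proof. by move=> pk; rewrite (leq_trans (size_poly _ _)). Qed.

Lemma is_derive_horner (p : {poly R}) (u : R) : is_derive u 1 (horner p) (p^`()).[u].
Proof. by rewrite derivE derive1E; apply: derivableP; exact: derivable_horner. Qed.

Lemma derive_pow_bound (f df : R -> R) k : (forall u : R, is_derive u 1 f (df u)) ->
  f 0 = 0 -> (forall u, `|df u| <= `|u| ^+ k) -> forall u, `|f u| <= `|u| ^+ k.+1.
Proof.
move=> fd f0 dfk u.
have cf : continuous f.
  by move=> v; apply: differentiable_continuous; apply/derivable1_diffP; have [] := fd v.
have [u0|u0|->] := ltgtP u 0; last by rewrite f0 !normr0 exprS mul0r.
- have [c] := MVT u0 (fun x _ => fd x) (continuous_subspaceT cf).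
  rewrite in_itv/= => /andP[uc c0]; rewrite f0 !sub0r => h.
  rewrite -normrN h normrM normrN exprS mulrC ler_wpM2l// (le_trans (dfk c))//.
  by rewrite lerXn2r ?nnegrE// !ltr0_norm// lerN2 ltW.
- have [c] := MVT u0 (fun x _ => fd x) (continuous_subspaceT cf).
  rewrite in_itv/= => /andP[c0 cu]; rewrite f0 !subr0 => ->.
  rewrite normrM exprS mulrC ler_wpM2l// (le_trans (dfk c))//.
  by rewrite lerXn2r ?nnegrE// !gtr0_norm// ltW.
Qed.

Lemma trig_taylor k : exists p q : {poly R}, [/\ (size p <= k)%N, (size q <= k)%N &
  forall u, `|cos u - p.[u]| <= `|u| ^+ k /\ `|sin u - q.[u]| <= `|u| ^+ k].
Proof.
elim: k => [|k [p [q [sp sq h]]]].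
  exists 0, 0; split=> [||u]; rewrite ?size_poly0// !horner0 !subr0 expr0.
  by split; [exact: cos_norm_le1|exact: sin_norm_le1].
exists (1 - antideriv q), (antideriv p); split.
- rewrite (leq_trans (size_polyD _ _))// geq_max size_polyN size_antideriv// andbT.
  by rewrite size_poly1.
- exact: size_antideriv.
- move=> u; split.
    apply: (@derive_pow_bound (fun u => cos u - (1 - antideriv q).[u])
      (fun u => - (sin u - q.[u]))) => [v||v].
    + have dh := is_derive_horner (1 - antideriv q) v.
      have := is_deriveB (is_derive_cos v) dh.
      by rewrite derivB derivC deriv_antideriv sub0r hornerN opprD.
    + by rewrite cos0 hornerD hornerN antideriv0 subr0 hornerC subrr.
    + by rewrite normrN; exact: (h v).2.
  apply: (@derive_pow_bound (fun u => sin u - (antideriv p).[u])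
    (fun u => (cos u - p.[u]))) => [v||v].
  + have dh := is_derive_horner (antideriv p) v.
    by have := is_deriveB (is_derive_sin v) dh; rewrite deriv_antideriv.
  + by rewrite sin0 antideriv0 subr0.
  + exact: (h v).1.
Qed.

End taylor_trig.

Section fourier_estimates.
Context {R : realType} {d : nat}.
Local Notation mu := (@lebesgue_rV R d).
Implicit Types (phi psi : 'rV[R]_d -> R) (x xi : 'rV[R]_d).
Local Notation Z := (@gauss_mass R d).

Lemma fourier_reE phi xi : fourier_re phi xi = Z^-1 * tr_cos phi xi.
Proof. by rewrite /fourier_re fourier_constE. Qed.

Lemma fourier_imE phi xi : L1 mu phi -> fourier_im phi xi = - (Z^-1 * tr_sin phi xi).
Proof.
move=> L; rewrite /fourier_im fourier_constE -mulrN -RintN; last exact: L1_sin.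
by congr (_ * _); apply: eq_Rint => x; rewrite mulrN.
Qed.

Definition fourier_dot phi psi xi : R :=
  fourier_re phi xi * fourier_re psi xi + fourier_im phi xi * fourier_im psi xi.

Lemma fourier_dotE phi psi xi : L1 mu phi -> L1 mu psi ->
  fourier_dot phi psi xi = (Z ^+ 2)^-1 * tr_dot phi psi xi.
Proof.
move=> L L'; rewrite /fourier_dot !fourier_reE !fourier_imE// /tr_dot.
rewrite expr2 invfM; move: (Z^-1) => z; ring.
Qed.

Lemma fourier_sqE phi xi : fourier_sq phi xi = fourier_dot phi phi xi.
Proof. by rewrite /fourier_dot -!expr2. Qed.

Lemma parseval phi psi : schwartz phi -> schwartz psi ->
  L1 mu (fourier_dot phi psi) /\ \int[mu]_xi fourier_dot phi psi xi = l2pair phi psi.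
Proof.
move=> sp sq; have Lp := schwartz_L1 sp; have Lq := schwartz_L1 sq.
have cp := schwartz_continuous sp; have cq := schwartz_continuous sq.
have bp x := schwartz_bounded x sp; have bq x := schwartz_bounded x sq.
have L := L1_tr_dot Lp cp bp Lq cq bq.
have E xi := fourier_dotE xi Lp Lq.
split; first by apply: eq_integrable (L1Z (Z ^+ 2)^-1 L) => // xi _ /=; rewrite E.
rewrite (eq_Rint _ E) RintZ// (Rint_tr_dot Lp cp bp Lq cq bq) mulrA mulVf ?mul1r; last first.
  by rewrite expf_eq0/= gt_eqF// gauss_mass_gt0.
by apply: eq_Rint => x; rewrite mulrC.
Qed.

Lemma fourier_sq_ge0 phi xi : 0 <= fourier_sq phi xi.
Proof. by rewrite addr_ge0// sqr_ge0. Qed.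

Lemma L1_fourier_sq phi : schwartz phi -> L1 mu (fourier_sq phi).
Proof.
move=> sp; have [L _] := parseval sp sp.
by apply: eq_integrable L => // xi _ /=; rewrite fourier_sqE.
Qed.

Lemma plancherel phi : schwartz phi ->
  \int[mu]_xi fourier_sq phi xi = \int[mu]_x (phi x ^+ 2).
Proof.
move=> sp; rewrite (eq_Rint _ (@fourier_sqE phi)) (parseval sp sp).2.
by apply: eq_Rint => x; rewrite expr2.
Qed.

Definition weight_mass : R := \int[mu]_x (weight x)^-1.

Lemma weight_mass_ge0 : 0 <= weight_mass.
Proof. by apply: Rintegral_ge0 => x _; rewrite invr_ge0 ltW// weight_gt0. Qed.

Lemma decay_const_ge0 k : 0 <= @decay_const R d k.
Proof. by rewrite mulr_ge0. Qed.

Lemma schwartz_L2_le phi : schwartz phi ->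
  \int[mu]_x (phi x ^+ 2) <=
    @decay_const R d 0 * weight_mass * schwartz_norm d.*2 phi ^+ 2.
Proof.
move=> sp; have Lp := schwartz_L1 sp; have bp x := schwartz_bounded x sp.
have N0 := schwartz_norm_ge0 d.*2 sp.
have L2 : L1 mu (fun x => phi x ^+ 2).
  by apply: (L1_Mb Lp (L1_measurable Lp) bp).
apply: (@le_trans _ _ (\int[mu]_x (schwartz_norm d.*2 phi * `|phi x|))).
  apply: Rint_le => //; first exact/L1Z/L1_norm.
  move=> x; rewrite -real_normK ?num_real// expr2 ler_wpM2r//.
  by rewrite (le_trans (bp x))// schwartz_norm_mono.
rewrite RintZ; last exact: L1_norm.
have h := Rint_decay (L1_measurable Lp) (fun x => schwartz_decay0 x sp).
rewrite (le_trans (ler_wpM2l N0 h))// -/weight_mass le_eqVlt; apply/orP; left.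
by apply/eqP; ring.
Qed.

Lemma fourier_sq_word (w : seq 'I_d) phi xi : schwartz phi ->
  fourier_sq (partials w phi) xi = (\prod_(i <- w) xi ord0 i ^+ 2) * fourier_sq phi xi.
Proof.
move=> sp; elim: w => [|i w IH]; first by rewrite big_nil mul1r.
have sw := schwartz_partials w sp.
rewrite (_ : partials (i :: w) phi = partials [:: i] (partials w phi))//.
rewrite /fourier_sq fourier_re_partial// fourier_im_partial//.
rewrite big_cons -mulrA -IH /fourier_sq; ring.
Qed.

Lemma dot_sqr xi : dot xi xi = \sum_(i < d) xi ord0 i ^+ 2.
Proof. by apply: eq_bigr => i _; rewrite expr2. Qed.

Lemma enorm_ge0 xi : 0 <= enorm xi.
Proof. exact: sqrtr_ge0. Qed.

Lemma enorm_sqr xi : enorm xi ^+ 2 = dot xi xi.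
Proof. by rewrite sqr_sqrtr// dot_ge0. Qed.

Lemma high_frequency m phi xi : schwartz phi ->
  enorm xi ^+ m.*2 * fourier_sq phi xi =
  \sum_(g : {ffun 'I_m -> 'I_d}) fourier_sq (partials [seq g l | l <- enum 'I_m] phi) xi.
Proof.
move=> sp; rewrite -muln2 mulnC exprM enorm_sqr dot_sqr.
rewrite (sum_coor_exp (fun i => xi ord0 i ^+ 2)) mulr_suml.
apply: eq_bigr => g _; rewrite fourier_sq_word// big_map; congr (_ * _).
by rewrite big_enum.
Qed.

Lemma coor_le_enorm xi i : `|xi ord0 i| <= enorm xi.
Proof.
rewrite -(@ler_pXn2r _ 2)// ?nnegrE ?enorm_ge0// enorm_sqr real_normK ?num_real//.
by rewrite dot_sqr (bigD1 i)//= lerDl sumr_ge0// => j _; rewrite sqr_ge0.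
Qed.

Lemma dot_le_enorm x xi : `|dot x xi| <= enorm xi * \sum_(i < d) `|x ord0 i|.
Proof.
rewrite /dot (le_trans (ler_norm_sum _ _ _))// mulr_sumr; apply: ler_sum => i _.
by rewrite normrM mulrC ler_wpM2r// coor_le_enorm.
Qed.

Lemma Rint_dot_pow_zero phi xi k j : schwartz phi -> (j < k)%N ->
  (forall a : 'I_d -> nat, (mdeg a < k)%N -> \int[mu]_x (monom a x * phi x) = 0) ->
  L1 mu (fun x => dot x xi ^+ j * phi x) /\
  \int[mu]_x (dot x xi ^+ j * phi x) = 0.
Proof.
move=> sp jk mom.
pose c (g : {ffun 'I_j -> 'I_d}) := \prod_(l < j) xi ord0 (g l).
have E x : dot x xi ^+ j * phi x =
    \sum_(g : {ffun 'I_j -> 'I_d}) c g * (monom (coor_count g) x * phi x).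
  rewrite /dot (sum_coor_exp (fun i => x ord0 i * xi ord0 i)) mulr_suml.
  apply: eq_bigr => g _; rewrite big_split/= -monom_coor_count /c; ring.
have Lg g : L1 mu (fun x => c g * (monom (coor_count g) x * phi x)).
  exact/L1Z/L1_monom.
split.
  by apply: eq_integrable (L1_sum _ Lg) => // x _ /=; rewrite E.
rewrite (eq_Rint _ E) Rint_sum// big1// => g _.
by rewrite RintZ ?mom ?mulr0 ?mdeg_coor_count//; exact: L1_monom.
Qed.

Lemma Rint_horner_dot_zero phi xi k (p : {poly R}) : schwartz phi -> (size p <= k)%N ->
  (forall a : 'I_d -> nat, (mdeg a < k)%N -> \int[mu]_x (monom a x * phi x) = 0) ->
  L1 mu (fun x => phi x * p.[dot x xi]) /\ \int[mu]_x (phi x * p.[dot x xi]) = 0.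
Proof.
move=> sp pk mom.
have E x : phi x * p.[dot x xi] = \sum_(j < size p) p`_j * (dot x xi ^+ j * phi x).
  rewrite horner_coef mulr_sumr; apply: eq_bigr => j _; ring.
have jk (j : 'I_(size p)) : (j < k)%N by rewrite (leq_trans _ pk).
have Lj (j : 'I_(size p)) : L1 mu (fun x => p`_j * (dot x xi ^+ j * phi x)).
  by apply: L1Z; exact: (Rint_dot_pow_zero xi sp (jk j) mom).1.
split.
  by apply: eq_integrable (L1_sum _ Lj) => // x _ /=; rewrite E.
rewrite (eq_Rint _ E) Rint_sum// big1// => j _.
have [L0 z] := Rint_dot_pow_zero xi sp (jk j) mom.
by rewrite RintZ// z mulr0.
Qed.

(* The moment conditions remove the Taylor polynomial of the kernel. *)
Lemma low_frequency k phi xi : schwartz phi ->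
  (forall a : 'I_d -> nat, (mdeg a < k)%N -> \int[mu]_x (monom a x * phi x) = 0) ->
  fourier_sq phi xi <= 2 * (Z^-1 * (@decay_const R d k * weight_mass *
    schwartz_norm (d.*2 + k) phi)) ^+ 2 * enorm xi ^+ k.*2.
Proof.
move=> sp mom; have Lp := schwartz_L1 sp; have mp := L1_measurable Lp.
have [p [q [sp' sq' pq]]] := @trig_taylor R k.
pose M := @decay_const R d k * weight_mass * schwartz_norm (d.*2 + k) phi.
have M0 : 0 <= M.
  by rewrite /M !mulr_ge0 ?weight_mass_ge0 ?decay_const_ge0 ?schwartz_norm_ge0.
pose S x : R := (\sum_(i < d) `|x ord0 i|) ^+ k.
have S0 x : 0 <= S x by rewrite exprn_ge0// sumr_ge0.
have mS : measurable_fun setT (fun x => phi x * S x).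
  apply: measurable_funM => //; apply: measurable_funX.
  by apply: measurable_sum => i; apply: measurableT_comp => //; exact: measurable_coor.
have bS x : `|phi x * S x| * weight x <= @decay_const R d k * schwartz_norm (d.*2 + k) phi.
  by rewrite normrM (ger0_norm (S0 x)); exact: schwartz_decay.
have LS := L1_decay mS bS.
have IS : \int[mu]_x `|phi x * S x| <= M.
  by apply: le_trans (Rint_decay mS bS) _; rewrite /M mulrAC.
have key (T : R -> R) (r : {poly R}) : measurable_fun setT T -> (size r <= k)%N ->
    (forall u, `|T u - r.[u]| <= `|u| ^+ k) -> (forall a, `|T a| <= 1) ->
    `|\int[mu]_x (phi x * T (dot x xi))| <= enorm xi ^+ k * M.
  move=> mT sr Tr T1.
  have [Lr zr] := Rint_horner_dot_zero xi sp sr mom.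
  have LT : L1 mu (fun x => phi x * T (dot x xi)).
    by apply: (@L1_Mb _ _ _ _ 1) => //; exact: measurableT_comp mT (measurable_dotl xi).
  rewrite -[X in `|X|]subr0 -zr -RintB//.
  apply: (le_trans (Rint_norm (L1B LT Lr))).
  apply: le_trans (ler_wpM2l (exprn_ge0 _ (enorm_ge0 _)) IS); rewrite -RintZ; last exact: L1_norm.
  apply: Rint_le; [exact/L1_norm/L1B|exact/L1Z/L1_norm|] => x.
  rewrite -mulrBr !normrM (ger0_norm (S0 x)) mulrCA ler_wpM2l// (le_trans (Tr _))//.
  by rewrite -exprMn lerXn2r ?nnegrE ?mulr_ge0 ?enorm_ge0 ?sumr_ge0 ?dot_le_enorm.
have hc := key cos p measurable_cos sp' (fun u => (pq u).1) cos_norm_le1.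
have hs := key sin q measurable_sin sq' (fun u => (pq u).2) sin_norm_le1.
have Z0 : 0 <= Z^-1 by rewrite invr_ge0 ltW// gauss_mass_gt0.
have sq_le (a : R) : `|a| <= enorm xi ^+ k * M ->
    (Z^-1 * a) ^+ 2 <= (Z^-1 * M) ^+ 2 * enorm xi ^+ k.*2.
  move=> h; rewrite -muln2 exprM -exprMn -[leLHS]real_normK ?num_real//.
  have h' : `|Z^-1 * a| <= Z^-1 * M * enorm xi ^+ k.
    by rewrite normrM (ger0_norm Z0) -mulrA ler_wpM2l// mulrC.
  by rewrite lerXn2r// ?nnegrE// (le_trans _ h').
rewrite -/M -mulrA mulr_natl mulr2n /fourier_sq fourier_reE fourier_imE// sqrrN.
by rewrite lerD// sq_le.
Qed.

End fourier_estimates.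

Section weighted_fourier.
Context {R : realType} {d : nat}.
Hypothesis d0 : (0 < d)%N.
Local Notation mu := (@lebesgue_rV R d).
Implicit Types (phi psi : 'rV[R]_d -> R) (x xi : 'rV[R]_d) (t : R).
Local Notation Z := (@gauss_mass R d).

Definition wt t xi : R := enorm xi `^ (2 * t).

Lemma wt_ge0 t xi : 0 <= wt t xi.
Proof. exact: powR_ge0. Qed.

Lemma measurable_enorm : measurable_fun setT (@enorm R d).
Proof.
apply: (measurableT_comp (f := @Num.sqrt R)).
  by apply: continuous_measurable_fun; exact: sqrt_continuous.
by apply: measurable_sum => i; apply: measurable_funM; exact: measurable_coor.
Qed.

Lemma measurable_wt t : measurable_fun setT (wt t).
Proof. exact: measurableT_comp (measurable_powR _) measurable_enorm. Qed.

Lemma ae_coor_neq0 : {ae mu, forall xi : 'rV[R]_d, forall i, xi ord0 i != 0}.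
Proof.
apply: filter_forall => i.
exists [set xi : 'rV[R]_d | xi ord0 i = 0]; split.
- rewrite (_ : [set _ | _] = (fun x : 'rV[R]_d => x ord0 i) @^-1` [set 0])//.
  by rewrite -[X in measurable X]setTI; apply: (@measurable_coor _ _ d i).
- exact: lebd_coor0.
- by move=> xi /= /negP; rewrite negbK => /eqP.
Qed.

Lemma moment_order (r : R) : exists k : nat, r < k%:R /\ forall j, (j < k)%N -> j%:R <= r.
Proof.
have [r0|r0] := leP 0 r; last by exists 0%N.
have /andP[h1 h2] := truncn_itv r0.
exists (Num.truncn r).+1; split=> // j jk.
by rewrite (le_trans _ h1)// ler_nat -ltnS.
Qed.

Lemma enorm_gt0 xi : (forall i, xi ord0 i != 0) -> 0 < enorm xi.
Proof.
move=> h; rewrite (lt_le_trans _ (coor_le_enorm xi (Ordinal d0)))//.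
by rewrite normr_gt0.
Qed.

Lemma low_frequency_weight (p : R) xi : 0 <= p -> (forall i, xi ord0 i != 0) ->
  enorm xi <= 1 -> enorm xi `^ (- (p * d%:R)) <= \prod_(i < d) sing p (xi ord0 i).
Proof.
move=> p0 h e1; have e0 := enorm_gt0 h.
rewrite -mulNr powRrM powR_mulrn ?powR_ge0//.
rewrite -[d in _ ^+ d]card_ord -prodr_const; apply: ler_prod => i _.
rewrite powR_ge0/= /sing (le_trans (coor_le_enorm xi i) e1).
by rewrite !powRN lef_pV2 ?posrE ?powR_gt0 ?normr_gt0// ge0_ler_powR ?nnegrE ?coor_le_enorm// ltW.
Qed.

Lemma weighted_fourier_bound t : exists (C : R) (n : nat), 0 <= C /\
  forall phi, schwartz_mom (t - d%:R / 2) phi ->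
    L1 mu (fun xi => wt (- t) xi * fourier_sq phi xi) /\
    \int[mu]_xi (wt (- t) xi * fourier_sq phi xi) <= C * schwartz_norm n phi ^+ 2.
Proof.
have [k [rk kr]] := moment_order (t - d%:R / 2).
have dR : 0 < d%:R :> R by rewrite ltr0n.
pose p : R := Num.max 0 (2 * t - 2 * k%:R) / d%:R.
have p0 : 0 <= p by rewrite divr_ge0 ?le_max ?lexx// ltW.
have p1 : p < 1 by rewrite ltr_pdivrMr// mul1r gt_max dR/=; lra.
pose m := Num.bound `|t|.
have tm : - t <= m%:R.
  by rewrite (le_trans (ler_norm _))// normrN ltW// archi_boundP.
pose I1 := \int[mu]_xi (\prod_(i < d) sing p (xi ord0 i)).
have L1s : L1 mu (fun xi => \prod_(i < d) sing p (xi ord0 i)).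
  by apply: (@L1_prod_coor R d (fun _ => sing p)) => _; exact: L1_sing.
pose A := Z^-1 * (@decay_const R d k * @weight_mass R d).
pose B := @decay_const R d 0 * @weight_mass R d.
have I10 : 0 <= I1 by apply: Rintegral_ge0 => xi _; apply: prodr_ge0 => i _; exact: sing_ge0.
have B0 : 0 <= B by rewrite mulr_ge0 ?decay_const_ge0 ?weight_mass_ge0.
exists (2 * A ^+ 2 * I1 + #|{ffun 'I_m -> 'I_d}|%:R * B), (d.*2 + k + m)%N; split.
  apply: addr_ge0; last by apply: mulr_ge0.
  by apply: mulr_ge0 => //; apply: mulr_ge0 => //; exact: sqr_ge0.
move=> phi [sp mom].
pose N := schwartz_norm (d.*2 + k + m) phi.
have N0 : 0 <= N := schwartz_norm_ge0 _ sp.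
have mom' (a : 'I_d -> nat) : (mdeg a < k)%N -> \int[mu]_x (monom a x * phi x) = 0.
  by move=> ak; apply: mom; exact: kr.
pose W (g : {ffun 'I_m -> 'I_d}) := [seq g l | l <- enum 'I_m].
pose low xi := 2 * (A * N) ^+ 2 * \prod_(i < d) sing p (xi ord0 i).
pose high xi := \sum_(g : {ffun 'I_m -> 'I_d}) fourier_sq (partials (W g) phi) xi.
have Llow : L1 mu low by exact: L1Z.
have sW g : schwartz (partials (W g) phi) by exact: schwartz_partials.
have Lhigh : L1 mu high by apply: L1_sum => g; exact: L1_fourier_sq.
have low0 xi : 0 <= low xi.
  apply: mulr_ge0; first by rewrite mulr_ge0 ?sqr_ge0.
  by apply: prodr_ge0 => i _; exact: sing_ge0.
have high0 xi : 0 <= high xi by apply: sumr_ge0 => g _; exact: fourier_sq_ge0.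
have mF : measurable_fun setT (fun xi => wt (- t) xi * fourier_sq phi xi).
  by apply: measurable_funM; [exact: measurable_wt|exact: L1_measurable (L1_fourier_sq sp)].
have F0 xi : 0 <= wt (- t) xi * fourier_sq phi xi.
  by rewrite mulr_ge0 ?wt_ge0 ?fourier_sq_ge0.
have bound xi : (forall i, xi ord0 i != 0) ->
    wt (- t) xi * fourier_sq phi xi <= low xi + high xi.
  move=> h; have e0 := enorm_gt0 h.
  have [e1|e1] := leP (enorm xi) 1.
    rewrite (@le_trans _ _ (low xi)) ?lerDl//.
    have := low_frequency xi sp mom'; set Q := 2 * _ ^+ 2 => lf.
    have QA : Q <= 2 * (A * N) ^+ 2.
      rewrite /Q /A ler_wpM2l// -!mulrA lerXn2r ?nnegrE ?mulr_ge0 ?invr_ge0 ?(ltW (@gauss_mass_gt0 R d))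
        ?decay_const_ge0 ?weight_mass_ge0 ?schwartz_norm_ge0//.
      rewrite !ler_wpM2l ?invr_ge0 ?(ltW (@gauss_mass_gt0 R d)) ?decay_const_ge0 ?weight_mass_ge0//.
      by rewrite schwartz_norm_mono// leq_addr.
    rewrite (le_trans (ler_wpM2l (wt_ge0 _ _) lf))// mulrCA.
    apply: ler_pM => //; first by rewrite /Q mulr_ge0 ?sqr_ge0.
      by rewrite mulr_ge0 ?wt_ge0// exprn_ge0// ltW.
    apply: le_trans (low_frequency_weight p0 h e1).
    rewrite /wt -powR_mulrn ?(ltW e0)// -powRD; last by rewrite (gt_eqF e0) implybT.
    apply: ger_powR; first by rewrite e0.
    rewrite /p divfK ?gt_eqF// -muln2 natrM.
    have : 2 * t - 2 * k%:R <= Num.max 0 (2 * t - 2 * k%:R) by rewrite le_max lexx orbT.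
    lra.
  rewrite (@le_trans _ _ (high xi)) ?lerDr//.
  rewrite /high -high_frequency// ler_wpM2r ?fourier_sq_ge0//.
  rewrite /wt -powR_mulrn ?enorm_ge0//; apply: ler_powR; first exact: ltW.
  by rewrite -muln2 natrM mulrC ler_wpM2r.
pose S := [set xi : 'rV[R]_d | forall i, xi ord0 i != 0].
have mS : measurable S.
  rewrite (_ : S = \bigcap_(i : 'I_d) ((fun x : 'rV[R]_d => x ord0 i) @^-1` (~` [set 0]))).
    apply: fin_bigcap_measurable => // i _.
    rewrite -[X in measurable X]setTI; apply: (@measurable_coor _ _ d i) => //.
    exact: measurableC.
  apply/seteqP; split => xi /= h i; first by move=> _ /=; exact/eqP.
  by apply/eqP; exact: (h i I).
pose G xi := wt (- t) xi * fourier_sq phi xi * \1_S xi.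
have GF : {ae mu, forall xi, G xi = wt (- t) xi * fourier_sq phi xi}.
  by apply: filterS ae_coor_neq0 => xi h; rewrite /G indicE mem_set// mulr1.
have G0 xi : 0 <= G xi by rewrite /G mulr_ge0// indicE.
have mG : measurable_fun setT G by apply: measurable_funM => //; exact: measurable_indic.
have Gb xi : G xi <= low xi + high xi.
  rewrite /G indicE; have [h|h] := pselect (S xi); first by rewrite mem_set// mulr1 bound.
  by rewrite memNset// mulr0 addr_ge0.
have LG : L1 mu G.
  by apply: (L1_le mG (L1D Llow Lhigh)) => xi; rewrite ger0_norm.
split; first exact: L1_ae GF.
rewrite -(Rint_ae mG mF GF).
apply: (le_trans (Rint_le LG (L1D Llow Lhigh) Gb)).
rewrite RintD// mulrDl lerD//.
  rewrite /low RintZ// -/I1 -/N le_eqVlt; apply/orP; left; apply/eqP; ring.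
rewrite /high Rint_sum => [|g]; last exact: L1_fourier_sq.
rewrite -mulrA mulr_natl -sumr_const; apply: ler_sum => g _.
rewrite plancherel// (le_trans (schwartz_L2_le (sW g)))// -/B ler_wpM2l//.
rewrite lerXn2r ?nnegrE ?schwartz_norm_ge0//.
rewrite (le_trans (schwartz_norm_partials _ _ sp))// schwartz_norm_mono//.
by rewrite size_map size_enum_ord leq_add2r leq_addr.
Qed.

End weighted_fourier.

(** * Hilbert space methods *)

Section riesz_representation.
Context {R : realType} {V : Type}.
(* [lin c u v] stands for [c u + v]. *)
Variables (lin : R -> V -> V -> V) (L : set V) (B : V -> V -> R).
Hypotheses (Llin : forall c u v, L u -> L v -> L (lin c u v))
  (Blin : forall c u v w, L u -> L v -> L w ->
    B (lin c u v) w = c * B u w + B v w)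
  (BC : forall u v, L u -> L v -> B u v = B v u)
  (B0 : forall u, L u -> 0 <= B u u)
  (* Geometrically fast Cauchy sequences suffice, and they spare the extraction of
     subsequences. *)
  (Bcomplete : forall u : nat -> V, (forall n, L (u n)) ->
    (forall n m, (n <= m)%N ->
       B (lin (-1) (u n) (u m)) (lin (-1) (u n) (u m)) <= 8^-1 ^+ n) ->
    exists2 l, L l & forall n,
       B (lin (-1) (u n) l) (lin (-1) (u n) l) <= 8^-1 ^+ n).

Definition form_closure (V0 : set V) : set V :=
  [set w | L w /\ forall e : R, 0 < e -> exists2 v, V0 v &
    B (lin (-1) v w) (lin (-1) v w) < e].

Lemma Blinr c u v w : L u -> L v -> L w -> B w (lin c u v) = c * B w u + B w v.
Proof.
by move=> Lu Lv Lw; rewrite BC//; [rewrite Blin// (BC Lw Lu) (BC Lw Lv)|exact: Llin].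
Qed.

Lemma Blin_sq c u v : L u -> L v ->
  B (lin c u v) (lin c u v) = c ^+ 2 * B u u + 2 * c * B u v + B v v.
Proof.
move=> Lu Lv; have Luv := Llin c Lu Lv.
by rewrite Blin// !Blinr// (BC Lv Lu); ring.
Qed.

Lemma form_le_weighted (s : R) u v : 0 < s -> L u -> L v ->
  2 * `|B u v| <= s * B u u + s^-1 * B v v.
Proof.
move=> s0 Lu Lv.
have h1 := B0 (Llin s Lu Lv); rewrite Blin_sq// in h1.
have h2 := B0 (Llin (- s) Lu Lv); rewrite Blin_sq// in h2.
have E : s * B u u + s^-1 * B v v = s^-1 * (s ^+ 2 * B u u + B v v).
  by rewrite mulrDr mulrA expr2 mulrA mulVf ?mul1r// gt_eqF.
rewrite E ler_pdivlMl// mulrA mulrC.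
by have [b0|b0] := ger0P (B u v); nra.
Qed.

Lemma form_cvg u w v : (forall n, L (u n)) -> L w -> L v ->
  (forall n, B (lin (-1) (u n) w) (lin (-1) (u n) w) <= 8^-1 ^+ n) ->
  (fun n => B (u n) v) @ \oo --> B w v.
Proof.
move=> Lu Lw Lv h; apply/cvgrPdist_le => e e0.
have b0 := B0 Lv.
have /cvgrPdist_le/(_ _ e0) : (fun n => 2^-1 ^+ n * (1 + B v v)) @ \oo --> (0 : R).
  rewrite -(mul0r (1 + B v v)); apply: cvgM; last exact: cvg_cst.
  apply: cvg_expr; rewrite ger0_norm// invf_lt1//; lra.
apply: filterS => n; rewrite sub0r normrN.
rewrite ger0_norm; last by rewrite mulr_ge0 ?exprn_ge0// addr_ge0.
apply: le_trans.
have Ld : L (lin (-1) (u n) w) by exact: Llin.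
have -> : B w v - B (u n) v = B (lin (-1) (u n) w) v by rewrite Blin//; ring.
have s0 : 0 < 2 ^+ n :> R by rewrite exprn_gt0.
have := form_le_weighted s0 Ld Lv; rewrite -exprVn.
have h1 : 2 ^+ n * B (lin (-1) (u n) w) (lin (-1) (u n) w) <= 2^-1 ^+ n.
  rewrite -ler_pdivlMl//; apply: (le_trans (h n)).
  rewrite -exprVn -exprMn lerXn2r ?nnegrE ?mulr_ge0//; lra.
have t0 : 0 <= 2^-1 ^+ n :> R by rewrite exprn_ge0.
by move: (`|_|) (B _ _) h1 b0 t0 => x y; nra.
Qed.

Lemma riesz_representation (V0 : set V) (l : V -> R) (C : R) (v0 : V) :
  V0 v0 -> V0 `<=` L -> (forall c u v, V0 u -> V0 v -> V0 (lin c u v)) ->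
  (forall c u v, V0 u -> V0 v -> l (lin c u v) = c * l u + l v) ->
  0 <= C -> (forall v, V0 v -> l v ^+ 2 <= C * B v v) ->
  exists2 w, form_closure V0 w & forall v, V0 v -> B w v = l v.
Proof.
move=> V0v0 V0L V0lin llin C0 lC.
(* The representative of [l] is the limit of a minimising sequence of [J]. *)
pose J v := B v v - 2 * l v.
have Jlb v : V0 v -> - C <= J v.
  move=> Vv; have h := lC v Vv; have b0 := B0 (V0L v Vv); rewrite /J.
  suff : 2 * l v <= C + B v v by lra.
  rewrite leNgt; apply/negP => lt.
  have : (C + B v v) ^+ 2 < (2 * l v) ^+ 2.
    by rewrite ltrXn2r// ?nnegrE ?(le_trans _ (ltW lt)) ?addr_ge0.
  by have := sqr_ge0 (C - B v v); nra.
have Jlin e u v : V0 u -> V0 v -> J (lin e u v) =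
    J v + 2 * e * (B v u - l u) + e ^+ 2 * B u u.
  move=> Vu Vv; rewrite /J Blin_sq ?llin//; [|exact: V0L|exact: V0L].
  by rewrite (BC (V0L _ Vu) (V0L _ Vv)); ring.
have iS : has_inf (J @` V0).
  by split; [exists (J v0), v0|exists (- C) => _ [v Vv <-]; exact: Jlb].
pose m := inf (J @` V0).
have mJ v : V0 v -> m <= J v by move=> Vv; apply: ge_inf; [case: iS|exists v].
pose eps n : R := 8^-1 ^+ n / 4.
have eps0 n : 0 < eps n by rewrite divr_gt0 ?exprn_gt0.
have /choice[u hu] : forall n, exists v, V0 v /\ J v < m + eps n.
  by move=> n; have [_ [v Vv <-] h] := inf_adherent (eps0 n) iS; exists v.
have Vu n := (hu n).1; have Lu n := V0L _ (Vu n).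
have cauchy n p : (n <= p)%N ->
    B (lin (-1) (u n) (u p)) (lin (-1) (u n) (u p)) <= 8^-1 ^+ n.
  move=> np; have mid := mJ _ (V0lin 2^-1 _ _ (V0lin (-1) _ _ (Vu n) (Vu p)) (Vu n)).
  have VD := V0lin (-1) _ _ (Vu n) (Vu p).
  rewrite Jlin// in mid.
  have Jp : J (u p) = J (u n) + 2 * (B (u n) (lin (-1) (u n) (u p)) -
      l (lin (-1) (u n) (u p))) + B (lin (-1) (u n) (u p)) (lin (-1) (u n) (u p)).
    rewrite Blinr// Blin_sq// llin// /J; ring.
  have hn := (hu n).2; have hp := (hu p).2.
  have ep : eps p <= eps n.
    by rewrite /eps ler_wpM2r// ler_wiXn2l// invf_le1// ler1n.
  have -> : 8^-1 ^+ n = 4 * eps n :> R by rewrite /eps mulrC divfK.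
  move: mid Jp hn hp ep; move: (B _ _) (B _ _) (l _) => b c l'; move=> *; nra.
have [w Lw hw] := Bcomplete Lu cauchy.
have cw v : V0 v -> (fun n => B (u n) v) @ \oo --> B w v.
  by move=> Vv; apply: form_cvg => //; exact: V0L.
have cvg8 : (fun n => 8^-1 ^+ n) @ \oo --> (0 : R).
  apply: cvg_expr; rewrite ger0_norm// invf_lt1//; lra.
exists w.
  split=> // e e0; have /cvgrPdist_lt/(_ _ e0)[N _ hN] := cvg8.
  exists (u N) => //; apply: (le_lt_trans (hw N)).
  have := hN N (leqnn N); rewrite sub0r normrN; apply: le_lt_trans.
  exact: ler_norm.
move=> v Vv.
have key e : 0 <= 2 * e * (B w v - l v) + e ^+ 2 * B v v.
  have : (fun n => eps n + (2 * e * (B (u n) v - l v) + e ^+ 2 * B v v)) @ \oo -->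
      0 + (2 * e * (B w v - l v) + e ^+ 2 * B v v).
    apply: cvgD.
      rewrite -(mul0r (4^-1 : R)); apply: cvgM => //; exact: cvg_cst.
    apply: cvgD; last exact: cvg_cst.
    apply: cvgM; first exact: cvg_cst.
    by apply: cvgB; [exact: cw|exact: cvg_cst].
  rewrite add0r => h; rewrite -(cvg_lim _ h)//; apply: limr_ge.
    by apply/cvg_ex; eexists; exact: h.
  apply: nearW => n; have := mJ _ (V0lin e _ _ Vv (Vu n)); rewrite Jlin//.
  have := (hu n).2; lra.
have b0 := B0 (V0L _ Vv).
apply/eqP; rewrite -subr_eq0; apply/eqP; move: key; move: (B w v - l v) => dl key.
have b1 : 0 < B v v + 1 by lra.
have := key (- dl / (B v v + 1)).
have -> : 2 * (- dl / (B v v + 1)) * dl + (- dl / (B v v + 1)) ^+ 2 * B v v =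
   - (dl ^+ 2) * ((B v v + 2) / (B v v + 1) ^+ 2).
  by field; rewrite gt_eqF.
rewrite mulNr oppr_ge0 => h.
have q0 : 0 < (B v v + 2) / (B v v + 1) ^+ 2 by rewrite divr_gt0 ?exprn_gt0//; lra.
have : dl ^+ 2 <= 0 by rewrite -(pmulr_lle0 _ q0).
by move=> d2; apply/eqP; rewrite -sqrf_eq0 eq_le d2 sqr_ge0.
Qed.

Lemma form_cauchy_schwarz u v : L u -> L v -> B u v ^+ 2 <= B u u * B v v.
Proof.
move=> Lu Lv; have h c : 0 <= c ^+ 2 * B u u + 2 * c * B u v + B v v.
  by rewrite -Blin_sq//; apply: B0; exact: Llin.
have a0 := B0 Lu; move: h a0; move: (B u u) (B u v) (B v v) => a b c h.
rewrite le_eqVlt => /orP[/eqP a0|a0].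
  rewrite -a0 mul0r; have [->|b0] := eqVneq b 0; first by rewrite expr0n.
  have := h (- (c + 1) / (2 * b)); rewrite -a0 mulr0 add0r.
  have -> : 2 * (- (c + 1) / (2 * b)) * b + c = -1 by field.
  by rewrite leNgt ltrN10.
have := h (- b / a); have -> : (- b / a) ^+ 2 * a + 2 * (- b / a) * b + c = (a * c - b ^+ 2) / a.
  by field; rewrite gt_eqF.
by rewrite pmulr_lge0 ?invr_gt0// subr_ge0.
Qed.

Lemma form_closure_lin (V0 : set V) c u v : V0 `<=` L ->
  (forall c u v, V0 u -> V0 v -> V0 (lin c u v)) ->
  form_closure V0 u -> form_closure V0 v -> form_closure V0 (lin c u v).
Proof.
move=> V0L V0lin [Lu hu] [Lv hv]; split=> [|e e0]; first exact: Llin.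
have c0 : 0 < 4 * (c ^+ 2 + 1) by rewrite mulr_gt0// ltr_wpDl// sqr_ge0.
have [u' Vu hu'] := hu (e / (4 * (c ^+ 2 + 1))) (divr_gt0 e0 c0).
have [v' Vv hv'] := hv (e / 4) (divr_gt0 e0 (ltr0n _ 4)).
have Lu' := V0L _ Vu; have Lv' := V0L _ Vv.
have Ld : L (lin (-1) u' u) by exact: Llin.
have Ld' : L (lin (-1) v' v) by exact: Llin.
exists (lin c u' v'); first exact: V0lin.
have E : B (lin (-1) (lin c u' v') (lin c u v)) (lin (-1) (lin c u' v') (lin c u v)) =
    B (lin c (lin (-1) u' u) (lin (-1) v' v)) (lin c (lin (-1) u' u) (lin (-1) v' v)).
  have La : L (lin c u' v') by exact: Llin.
  have Lb : L (lin c u v) by exact: Llin.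
  rewrite !Blin_sq// !Blin// !Blinr// (BC Lu' Lv') (BC Lu Lv) (BC Lu' Lv) (BC Lu Lv') (BC Lu' Lu) (BC Lv' Lv); ring.
rewrite E Blin_sq//; apply: (@le_lt_trans _ _ (2 * (c ^+ 2 * B (lin (-1) u' u) (lin (-1) u' u)
    + B (lin (-1) v' v) (lin (-1) v' v)))).
  have := B0 (Llin (- c) Ld Ld'); rewrite Blin_sq// sqrrN.
  move: (B _ _) (B _ _) (B _ _) => x y z; lra.
have h : c ^+ 2 * B (lin (-1) u' u) (lin (-1) u' u) <= e / 4.
  have := ltW hu'; rewrite ler_pdivlMr// => h; have b0 := B0 Ld.
  by move: h b0; move: (B _ _) => x h b0; have := sqr_ge0 c; nra.
by move: h hv'; move: (B _ _) (B _ _) => x y; lra.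
Qed.

Lemma form_closure_orthogonal (V0 : set V) w k : V0 `<=` L -> L k -> form_closure V0 w ->
  (forall v, V0 v -> B v k = 0) -> B w k = 0.
Proof.
move=> V0L Lk [Lw cw] h; apply/eqP; apply: contraT => b0.
have b2 : 0 < B w k ^+ 2 by rewrite exprn_even_gt0.
have k1 : 0 < B k k + 1 by rewrite ltr_wpDl// B0.
have [v Vv] := cw _ (divr_gt0 b2 k1); have Lv := V0L _ Vv.
have Ld : L (lin (-1) v w) by exact: Llin.
rewrite ltr_pdivlMr// => lt; have := form_cauchy_schwarz Ld Lk.
rewrite Blin// h// mulr0 add0r => le2; rewrite mulrDr mulr1 in lt.
by have := B0 Ld; lra.
Qed.

End riesz_representation.

Section fast_convergence.
Context {disp : measure_display} {T : measurableType disp} {R : realType}.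
Variable m : {measure set T -> \bar R}.

(* Chebyshev and Borel-Cantelli in one step: the series [sum_n 4^n g_n] has a
   finite integral. *)
Lemma ae_fast_bound (g : nat -> T -> R) : (forall n, measurable_fun setT (g n)) ->
  (forall n x, 0 <= g n x) ->
  (forall n, (\int[m]_x (g n x)%:E <= (8^-1 ^+ n)%:E)%E) ->
  exists E : set T, [/\ measurable E, m (~` E) = 0%E &
    forall x, E x -> exists M, forall n, g n x <= M * 4^-1 ^+ n].
Proof.
move=> mg g0 gI.
pose h n x := (4 ^+ n * g n x)%:E.
have h0 n x : (0 <= h n x)%E by rewrite lee_fin mulr_ge0// exprn_ge0.
have mh n : measurable_fun setT (h n).
  by apply/measurable_EFinP; apply: measurable_funM.
pose S x := (\sum_(n <oo) h n x)%E.
have mS : measurable_fun setT S by apply: ge0_emeasurable_sum.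
have Soo : (\int[m]_x S x < +oo)%E.
  rewrite integral_nneseries//.
  apply: (@le_lt_trans _ _ (\sum_(n <oo) (2^-1 ^+ n)%:E)%E).
    apply: lee_nneseries => [n _ _|n _]; first exact: integral_ge0.
    rewrite /h; under eq_integral do rewrite EFinM.
    have gn0 x : setT x -> (0 <= (g n x)%:E)%E by rewrite lee_fin.
    have mgn : measurable_fun setT (EFin \o g n) by exact/measurable_EFinP.
    rewrite (ge0_integralZl_EFin _ measurableT gn0 mgn) ?exprn_ge0//.
    apply: (@le_trans _ _ ((4 ^+ n)%:E * (8^-1 ^+ n)%:E)%E).
      by rewrite lee_pmul2l// lte_fin exprn_gt0.
    rewrite -EFinM -exprMn lee_fin lerXn2r ?nnegrE//; lra.
  rewrite (eq_eseriesr (g := fun n => (2 / (2 ^ (n + 1)%N)%:R)%:E)).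
    have /cvg_lim -> // := @cvg_geometric_eseries_half R 2 0.
    by rewrite ltry.
  move=> n _; congr EFin; rewrite addn1 natrX exprS invfM mulrA divff// mul1r.
  by rewrite exprVn.
have S0 x : (0 <= S x)%E by apply: nneseries_ge0.
have LS : m.-integrable setT S.
  by apply/integrableP; split=> //; under eq_integral do rewrite gee0_abs//.
exists [set x | (S x < +oo)%E].
have mE : measurable [set x | (S x < +oo)%E].
  by rewrite -[X in measurable X]setTI; exact: emeasurable_fun_infty_o.
split=> //.
- apply/negligibleP; first exact: measurableC.
  apply: negligibleS (integrable_ae measurableT LS) => x /= nS fS; apply: nS.
  by rewrite -ge0_fin_numE//; exact: fS.
- move=> x /= Sx; exists (fine (S x)) => n.
  have hS : (h n x <= S x)%E.
    apply: le_trans (nneseries_lim_ge n.+1 _) => //.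
    by rewrite big_nat_recr//= leeDr// sume_ge0.
  have : 4 ^+ n * g n x <= fine (S x).
    by rewrite -lee_fin fineK// ge0_fin_numE.
  by rewrite exprVn ler_pdivlMr ?exprn_gt0// mulrC.
Qed.

End fast_convergence.

Section weighted_L2.
Context {R : realType} {d : nat}.
Hypothesis d0 : (0 < d)%N.
Local Notation mu := (@lebesgue_rV R d).
Implicit Types (F G : 'rV[R]_d -> R[i]) (xi : 'rV[R]_d) (t : R).
Local Notation re F xi := (complex.Re (F xi)).
Local Notation im F xi := (complex.Im (F xi)).

Definition clin (c : R) F G : 'rV[R]_d -> R[i] :=
  fun xi => ((c * re F xi + re G xi) +i* (c * im F xi + im G xi))%C.

Definition cmeas F : Prop :=
  measurable_fun setT (fun xi => re F xi) /\ measurable_fun setT (fun xi => im F xi).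

Definition cdot F G xi : R := re F xi * re G xi + im F xi * im G xi.

Definition wL2 t : set ('rV[R]_d -> R[i]) :=
  [set F | cmeas F /\ L1 mu (fun xi => wt t xi * cdot F F xi)].

Definition wform t F G : R := \int[mu]_xi (wt t xi * cdot F G xi).

Lemma clinK F G : clin 1 F (clin (-1) F G) = G.
Proof.
apply/funext => xi; rewrite /clin /= !mul1r !mulN1r !addrA !subrr !add0r.
by case: (G xi).
Qed.

Lemma cmeas_clin c F G : cmeas F -> cmeas G -> cmeas (clin c F G).
Proof.
by move=> [mF mF'] [mG mG']; split; apply: measurable_funD => //; exact: measurable_funM.
Qed.

Lemma measurable_cdot F G : cmeas F -> cmeas G -> measurable_fun setT (cdot F G).
Proof.
by move=> [mF mF'] [mG mG']; apply: measurable_funD; exact: measurable_funM.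
Qed.

Lemma cdotC F G xi : cdot F G xi = cdot G F xi.
Proof. by rewrite /cdot mulrC [im F xi * _]mulrC. Qed.

Lemma cdot_lin c F G K xi : cdot (clin c F G) K xi = c * cdot F K xi + cdot G K xi.
Proof. by rewrite /cdot /clin/=; ring. Qed.

Lemma cdot_ge0 F xi : 0 <= cdot F F xi.
Proof. by rewrite addr_ge0// -expr2 sqr_ge0. Qed.

Lemma cdot_le F G xi : `|cdot F G xi| <= cdot F F xi + cdot G G xi.
Proof.
have h1 := cdot_ge0 (clin 1 F G) xi; have h2 := cdot_ge0 (clin (-1) F G) xi.
have hF := cdot_ge0 F xi; have hG := cdot_ge0 G xi.
move: h1 h2; rewrite !cdot_lin ![cdot _ (clin _ _ _) _]cdotC !cdot_lin (cdotC G F) => h1 h2.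
by rewrite ler_norml; apply/andP; split; lra.
Qed.

Lemma L1_cdot t F G : wL2 t F -> wL2 t G -> L1 mu (fun xi => wt t xi * cdot F G xi).
Proof.
move=> [mF LF] [mG LG]; apply: L1_le (L1D LF LG) _.
  by apply: measurable_funM; [exact: measurable_wt|exact: measurable_cdot].
move=> xi; rewrite -mulrDr normrM ger0_norm ?wt_ge0// ler_wpM2l ?wt_ge0//.
exact: cdot_le.
Qed.

Lemma wL2_clin t c F G : wL2 t F -> wL2 t G -> wL2 t (clin c F G).
Proof.
move=> hF hG; have [mF LF] := hF; have [mG LG] := hG.
split; first exact: cmeas_clin.
have L := L1D (L1D (L1Z (c ^+ 2) LF) (L1Z (2 * c) (L1_cdot hF hG))) LG.
apply: eq_integrable L => // xi _ /=; congr EFin.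
by rewrite !cdot_lin ![cdot _ (clin _ _ _) _]cdotC !cdot_lin (cdotC G F); ring.
Qed.

Lemma wform_lin t c F G K : wL2 t F -> wL2 t G -> wL2 t K ->
  wform t (clin c F G) K = c * wform t F K + wform t G K.
Proof.
move=> hF hG hK; have L1K := L1_cdot hF hK; have L2K := L1_cdot hG hK.
rewrite /wform -(RintZ c L1K) -(RintD (L1Z c L1K) L2K).
by apply: eq_Rint => xi; rewrite cdot_lin; ring.
Qed.

Lemma wformC t F G : wform t F G = wform t G F.
Proof. by apply: eq_Rint => xi; rewrite cdotC. Qed.

Lemma wform_ge0 t F : 0 <= wform t F F.
Proof. by apply: Rintegral_ge0 => xi _; rewrite mulr_ge0 ?wt_ge0 ?cdot_ge0. Qed.

Lemma ae_enorm_gt0 : {ae mu, forall xi : 'rV[R]_d, 0 < enorm xi}.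
Proof. by apply: filterS (@ae_coor_neq0 R d) => xi; exact: enorm_gt0. Qed.

Lemma wt_gt0 t xi : 0 < enorm xi -> 0 < wt t xi.
Proof. by move=> e0; rewrite powR_gt0. Qed.

Lemma wform_eq0 t F : wL2 t F -> wform t F F = 0 -> {ae mu, forall xi, F xi = 0}.
Proof.
move=> [mF LF] F0.
have : (\int[mu]_xi `|(wt t xi * cdot F F xi)%:E| = 0)%E.
  rewrite -[RHS]/(0%:E) -F0 /wform RintE//; apply: eq_integral => xi _.
  by rewrite gee0_abs// lee_fin mulr_ge0 ?wt_ge0 ?cdot_ge0.
have mE : measurable_fun setT (fun xi => (wt t xi * cdot F F xi)%:E).
  by apply/measurable_EFinP; exact: L1_measurable LF.
move=> /(ae_eq_integral_abs mu measurableT mE).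
move=> h; apply: filterS2 h ae_enorm_gt0 => xi /(_ I) /= [] /eqP.
rewrite mulf_eq0 => + e0; rewrite (gt_eqF (wt_gt0 t e0))/= => /eqP h.
have hr := sqr_ge0 (re F xi); have hi := sqr_ge0 (im F xi).
rewrite /cdot -!expr2 in h.
have r0 : re F xi = 0 by apply/eqP; rewrite -sqrf_eq0 eq_le hr andbT; lra.
have i0 : im F xi = 0 by apply/eqP; rewrite -sqrf_eq0 eq_le hi andbT; lra.
by move: r0 i0; case: (F xi) => a b /= -> ->.
Qed.

Lemma cvg_of_geometric (x : nat -> R) (K : R) :
  (forall n, `|x n.+1 - x n| <= K * 2^-1 ^+ n) -> cvgn x.
Proof.
move=> h.
have K0 : 0 <= K by have := le_trans (normr_ge0 _) (h 0%N); rewrite expr0 mulr1.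
have E : x = (fun n => x 0%N + series (fun k => x k.+1 - x k) n).
  apply/funext => n; rewrite /series/= telescope_sumr//; ring.
rewrite E; apply: is_cvgD; first exact: is_cvg_cst.
apply: normed_cvg; apply: (series_le_cvg _ _ h) => [n|n|] //.
  by rewrite mulr_ge0// exprn_ge0.
have := @is_cvg_geometric_series R K 2^-1; rewrite /geometric/=; apply.
by rewrite ger0_norm// invf_lt1//; lra.
Qed.

Lemma wform_complete t (u : nat -> 'rV[R]_d -> R[i]) : (forall n, wL2 t (u n)) ->
  (forall n m, (n <= m)%N ->
     wform t (clin (-1) (u n) (u m)) (clin (-1) (u n) (u m)) <= 8^-1 ^+ n) ->
  exists2 l, wL2 t l &
    forall n, wform t (clin (-1) (u n) l) (clin (-1) (u n) l) <= 8^-1 ^+ n.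
Proof.
move=> hu cauchy.
pose g n xi := wt t xi * cdot (clin (-1) (u n) (u n.+1)) (clin (-1) (u n) (u n.+1)) xi.
have hg n : wL2 t (clin (-1) (u n) (u n.+1)) by exact: wL2_clin.
have [E0 [mE0 E00 hE0]] : exists E : set 'rV[R]_d, [/\ measurable E, mu (~` E) = 0%E &
    forall x, E x -> exists M, forall n, g n x <= M * 4^-1 ^+ n].
  apply: ae_fast_bound => [n|n x|n].
  - exact: L1_measurable (hg n).2.
  - by rewrite mulr_ge0 ?wt_ge0 ?cdot_ge0.
  - by rewrite -RintE ?lee_fin; [exact: cauchy|exact: (hg n).2].
pose E := E0 `&` [set xi | 0 < enorm xi].
have mE : measurable E.
  apply: measurableI => //.
  rewrite (_ : [set _ | _] = @enorm R d @^-1` `]0, +oo[%classic).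
    by rewrite -[X in measurable X]setTI; exact: measurable_enorm.
  by apply/seteqP; split => xi /=; rewrite in_itv/= andbT.
have aeE : {ae mu, forall xi, E xi}.
  have h0 : {ae mu, forall xi, E0 xi}.
    by exists (~` E0); split=> //; exact: measurableC.
  by apply: filterS2 h0 ae_enorm_gt0.
have mI : measurable_fun setT (\1_E : 'rV[R]_d -> R) by exact: measurable_indic.
pose a n xi := re (u n) xi * \1_E xi.
pose b n xi := im (u n) xi * \1_E xi.
have cab xi : cvgn (fun n => a n xi) /\ cvgn (fun n => b n xi).
  rewrite /a /b indicE; have [Exi|nE] := pselect (E xi); last first.
    by rewrite memNset//; split; under eq_fun do rewrite mulr0; exact: is_cvg_cst.
  rewrite mem_set//; have [h1 h2] := Exi; have [M hM] := hE0 _ h1.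
  have w0 := wt_gt0 t h2.
  have bd n : cdot (clin (-1) (u n) (u n.+1)) (clin (-1) (u n) (u n.+1)) xi <=
      (Num.sqrt (`|M| / wt t xi) * 2^-1 ^+ n) ^+ 2.
    rewrite exprMn sqr_sqrtr ?divr_ge0 ?(ltW w0)// -exprM mulnC exprM expr2.
    have -> : 2^-1 * 2^-1 = 4^-1 :> R by rewrite -invfM -natrM.
    rewrite mulrAC ler_pdivlMr// mulrC (le_trans (hM n))// ler_wpM2r ?exprn_ge0//.
    exact: ler_norm.
  have q0 n : 0 <= Num.sqrt (`|M| / wt t xi) * 2^-1 ^+ n.
    by rewrite mulr_ge0 ?sqrtr_ge0 ?exprn_ge0.
  have sq_le (y q : R) : 0 <= q -> y ^+ 2 <= q ^+ 2 -> `|y| <= q.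
    by move=> q0' yq; rewrite -(@ler_pXn2r _ 2)// ?nnegrE// real_normK ?num_real.
  split; apply: (@cvg_of_geometric _ (Num.sqrt (`|M| / wt t xi))) => n;
    rewrite !mulr1; apply: sq_le => //; apply: le_trans (bd n);
    rewrite /cdot /clin/= -!expr2.
  - by rewrite !mulN1r ![- _ + _]addrC lerDl sqr_ge0.
  - by rewrite !mulN1r ![- _ + _]addrC lerDr sqr_ge0.
pose l xi : R[i] := (limn (fun n => a n xi) +i* limn (fun n => b n xi))%C.
have ml : cmeas l.
  split; apply: measurable_fun_cvg.
  - by move=> n; apply: measurable_funM; [exact: (hu n).1.1|exact: mI].
  - by move=> xi _; exact: (cab xi).1.
  - by move=> n; apply: measurable_funM; [exact: (hu n).1.2|exact: mI].
  - by move=> xi _; exact: (cab xi).2.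
pose u' n xi : R[i] := (a n xi +i* b n xi)%C.
have mu' n : cmeas (u' n).
  split; apply: measurable_funM; [exact: (hu n).1.1|exact: mI|
    exact: (hu n).1.2|exact: mI].
have uu' n : {ae mu, forall xi, u' n xi = u n xi}.
  apply: filterS aeE => xi Exi; rewrite /u' /a /b indicE mem_set// !mulr1.
  by case: (u n xi).
have key n : (\int[mu]_xi (wt t xi * cdot (clin (-1) (u n) l) (clin (-1) (u n) l) xi)%:E
    <= (8^-1 ^+ n)%:E)%E.
  pose f m xi := (wt t xi * cdot (clin (-1) (u n) (u' (m + n)%N))
    (clin (-1) (u n) (u' (m + n)%N)) xi)%:E.
  have mf m : measurable_fun setT (f m).
    apply/measurable_EFinP; apply: measurable_funM; first exact: measurable_wt.
    by apply: measurable_cdot; apply: cmeas_clin; [exact: (hu n).1|exact: mu'|exact: (hu n).1|exact: mu'].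
  have f0 m xi : setT xi -> (0 <= f m xi)%E.
    by move=> _; rewrite lee_fin mulr_ge0 ?wt_ge0 ?cdot_ge0.
  have fI m : (\int[mu]_xi f m xi <= (8^-1 ^+ n)%:E)%E.
    have hL : wL2 t (clin (-1) (u n) (u (m + n)%N)) by exact: wL2_clin.
    rewrite (ae_eq_integral (fun xi => (wt t xi *
      cdot (clin (-1) (u n) (u (m + n)%N)) (clin (-1) (u n) (u (m + n)%N)) xi)%:E))//.
    - by rewrite -RintE ?lee_fin; [exact: cauchy (leq_addl _ _)|exact: hL.2].
    - by apply/measurable_EFinP; exact: L1_measurable hL.2.
    - by apply: filterS (uu' (m + n)%N) => xi h _; rewrite /f /cdot /clin h.
  have lf xi : limn_einf (f^~ xi) =
      (wt t xi * cdot (clin (-1) (u n) l) (clin (-1) (u n) l) xi)%:E.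
    apply: (cvg_limn_einf_sup _).1; apply: cvg_EFin; first exact: nearW.
    apply: cvgM; first exact: cvg_cst.
    have ca : (fun m => a (m + n)%N xi) @ \oo --> limn (fun n => a n xi).
      by rewrite (cvg_shiftn n (fun m => a m xi)); exact: (cab xi).1.
    have cb : (fun m => b (m + n)%N xi) @ \oo --> limn (fun n => b n xi).
      by rewrite (cvg_shiftn n (fun m => b m xi)); exact: (cab xi).2.
    rewrite /cdot /clin /=; apply: cvgD; apply: cvgM; apply: cvgD => //; exact: cvg_cst.
  have := fatou mu measurableT mf f0.
  under eq_integral do rewrite lf.
  move=> /le_trans; apply.
  rewrite limn_einf_lim; apply: lime_le; first exact: is_cvg_einfs.
  apply: nearW => m; apply: le_trans (fI m); apply: ereal_inf_lbound.
  by exists m => /=.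
have hl n : wL2 t (clin (-1) (u n) l).
  split; first by apply: cmeas_clin => //; exact: (hu n).1.
  apply: Rint_ge0E.
  - apply: measurable_funM; first exact: measurable_wt.
    by apply: measurable_cdot; apply: cmeas_clin => //; exact: (hu n).1.
  - by move=> xi; rewrite mulr_ge0 ?wt_ge0 ?cdot_ge0.
  - exact: le_lt_trans (key n) (ltry _).
exists l.
  rewrite -(clinK (u 0%N) l); exact: wL2_clin.
by move=> n; rewrite -lee_fin /wform RintE; [exact: key|exact: (hl n).2].
Qed.

End weighted_L2.

(** * Homogeneous Sobolev spaces on the Fourier side *)

Section fourier_pairing.
Context {R : realType} {d : nat}.
Hypothesis d0 : (0 < d)%N.
Local Notation mu := (@lebesgue_rV R d).
Local Notation e i := (delta_mx ord0 i : 'rV[R]_d).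
Implicit Types (F G : 'rV[R]_d -> R[i]) (phi psi : 'rV[R]_d -> R) (x xi : 'rV[R]_d) (t : R).
Local Notation re F xi := (complex.Re (F xi)).
Local Notation im F xi := (complex.Im (F xi)).

(* Multiplication by the imaginary unit: [cdot F G] and [cdot F (crot G)] are the
   real and the imaginary part of [F * conj G]. *)
Definition crot G : 'rV[R]_d -> R[i] := fun xi => ((- im G xi)%R +i* re G xi)%C.

Definition wscale t G : 'rV[R]_d -> R[i] :=
  fun xi => ((wt t xi * re G xi)%R +i* (wt t xi * im G xi)%R)%C.

Lemma cmeas_crot G : cmeas G -> cmeas (crot G).
Proof. by move=> [mr mi]; split => //; exact: measurable_funN. Qed.

Lemma cmeas_wscale t G : cmeas G -> cmeas (wscale t G).
Proof. by move=> [mr mi]; split; apply: measurable_funM => //; exact: measurable_wt. Qed.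

Lemma cdot_crot2 F G xi : cdot (crot F) (crot G) xi = cdot F G xi.
Proof. by rewrite /cdot /crot/=; ring. Qed.

Lemma wL2_crot t G : wL2 t G -> wL2 t (crot G).
Proof.
move=> [mG LG]; split; first exact: cmeas_crot.
by apply: eq_integrable LG => // xi _ /=; rewrite cdot_crot2.
Qed.

Lemma cdot_scale t F G xi : cdot F (wscale t G) xi = wt t xi * cdot F G xi.
Proof. by rewrite /cdot /wscale/=; ring. Qed.

Lemma wtK t xi : t != 0 -> wt t xi * wt (- t) xi * wt (- t) xi = wt (- t) xi.
Proof.
move=> t0; rewrite /wt mulrN; have [e0|e0] := eqVneq (enorm xi) 0.
  by rewrite e0 !powR0 ?mulr0// ?oppr_eq0 mulf_neq0.
by rewrite !powRN divff ?mul1r// powR_eq0 (negbTE e0).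
Qed.

Lemma wform_scale t F G : t != 0 ->
  wform t (wscale (- t) F) (wscale (- t) G) = wform (- t) F G.
Proof.
move=> t0; apply: eq_Rint => xi; rewrite cdot_scale cdotC cdot_scale !mulrA wtK// cdotC//.
Qed.

Lemma wL2_scale t G : t != 0 -> wL2 (- t) G -> wL2 t (wscale (- t) G).
Proof.
move=> t0 [mG LG]; split; first exact: cmeas_wscale.
apply: eq_integrable LG => // xi _ /=.
by rewrite cdot_scale [cdot (wscale _ _) _ _]cdotC cdot_scale !mulrA wtK.
Qed.

Lemma wt_inv t xi : 0 < enorm xi -> wt t xi * wt (- t) xi = 1.
Proof.
by move=> e0; rewrite /wt mulrN powRN divff// powR_eq0 (gt_eqF e0).
Qed.

Lemma ae_dual t F G : {ae mu, forall xi, wt t xi * cdot F (wscale (- t) G) xi = cdot F G xi}.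
Proof.
apply: filterS (@ae_enorm_gt0 R d d0) => xi e0.
by rewrite cdot_scale mulrA wt_inv// mul1r.
Qed.

Lemma L1_dual t F G : t != 0 -> wL2 t F -> wL2 (- t) G -> L1 mu (cdot F G).
Proof.
move=> t0 hF hG; have hK := wL2_scale t0 hG.
by apply: L1_ae (L1_cdot hF hK) (ae_dual t F G); apply: measurable_cdot; [exact: hF.1|exact: hG.1].
Qed.

Lemma Rint_dual t F G : t != 0 -> wL2 t F -> wL2 (- t) G ->
  \int[mu]_xi cdot F G xi = wform t F (wscale (- t) G).
Proof.
move=> t0 hF hG; have hK := wL2_scale t0 hG; apply/esym/Rint_ae; last exact: ae_dual.
- exact: L1_measurable (L1_cdot hF hK).
- exact: L1_measurable (L1_dual t0 hF hG).
Qed.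

Definition hat phi : 'rV[R]_d -> R[i] := fourier phi.

Lemma hatE phi xi : hat phi xi = (fourier_re phi xi +i* fourier_im phi xi)%C.
Proof. exact: fourierE. Qed.

Arguments hat : simpl never.

Lemma hat_re phi xi : re (hat phi) xi = fourier_re phi xi.
Proof. by rewrite /hat fourierE. Qed.

Lemma hat_im phi xi : im (hat phi) xi = fourier_im phi xi.
Proof. by rewrite /hat fourierE. Qed.

Lemma cdot_hat phi psi xi : cdot (hat phi) (hat psi) xi = fourier_dot phi psi xi.
Proof. by rewrite /cdot !hat_re !hat_im. Qed.

Lemma cmeas_hat phi : L1 mu phi -> cmeas (hat phi).
Proof.
move=> L; split.
  by under eq_fun do rewrite hat_re; exact: measurable_fourier_re.
by under eq_fun do rewrite hat_im; exact: measurable_fourier_im.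
Qed.

Lemma hat_bound t : exists (C : R) (n : nat), 0 <= C /\
  forall phi, schwartz_mom (t - d%:R / 2) phi ->
    wL2 (- t) (hat phi) /\ wform (- t) (hat phi) (hat phi) <= C * schwartz_norm n phi ^+ 2.
Proof.
have [C [n [C0 h]]] := @weighted_fourier_bound R d d0 t.
exists C, n; split=> // phi sp; have [L I] := h phi sp.
have E xi : wt (- t) xi * fourier_sq phi xi = wt (- t) xi * cdot (hat phi) (hat phi) xi.
  by rewrite cdot_hat -fourier_sqE.
split; last by rewrite /wform -(eq_Rint _ E).
split; first exact/cmeas_hat/schwartz_L1/sp.1.
by apply: eq_integrable L => // xi _ /=; rewrite E.
Qed.

Lemma hat_wL2 t phi : schwartz_mom (t - d%:R / 2) phi -> wL2 (- t) (hat phi).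
Proof. by have [C [n [_ h]]] := hat_bound t; move=> /h[]. Qed.

Lemma hat_lin c phi psi : L1 mu phi -> L1 mu psi ->
  hat (fun x => c * phi x + psi x) = clin c (hat phi) (hat psi).
Proof.
move=> L L'; apply/funext => xi; rewrite /clin !hat_re !hat_im /hat fourierE.
by rewrite fourier_re_lin// fourier_im_lin.
Qed.

Lemma gaussp_translate (c x : 'rV[R]_d) : gaussp (fun=> 1) c x = gauss (x - c).
Proof.
rewrite /gauss /gaussp; apply: eq_bigr => i _.
by rewrite /gauss1 !mxE subr0 hornerC hornerC.
Qed.

Lemma tr_sin_gauss xi : tr_sin (@gauss R d) xi = 0.
Proof.
apply: Rint_odd; first exact: L1_sin L1_gauss.
by move=> x; rewrite gaussN dotNl sinN mulrN.
Qed.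

Lemma hat_gauss_translate c xi : hat (gaussp (fun=> 1) c) xi =
  ((gauss xi * cos (dot c xi))%R +i* (- (gauss xi * sin (dot c xi)))%R)%C.
Proof.
have Lg := @L1_gauss R d.
have L := schwartz_L1 (schwartz_gaussp (fun=> 1) c : schwartz (gaussp (fun=> 1) c)).
have Z0 : @gauss_mass R d != 0 by rewrite gt_eqF// gauss_mass_gt0.
have shift (T : R -> R) : measurable_fun setT T -> (forall a, `|T a| <= 1) ->
    \int[mu]_x (gaussp (fun=> 1) c x * T (dot x xi)) =
    \int[mu]_x (gauss x * T (dot c xi + dot x xi)).
  move=> mT T1.
  have LT : L1 mu (fun x => gaussp (fun=> 1) c x * T (dot x xi)).
    by apply: (@L1_Mb _ _ _ _ 1) => //; exact: measurableT_comp mT (measurable_dotl xi).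
  rewrite -(Rint_translate c LT); apply: eq_Rint => x.
  by rewrite gaussp_translate addrC addKr dotDl.
rewrite /hat fourierE fourier_reE fourier_imE//.
rewrite /tr_cos (shift cos measurable_cos cos_norm_le1).
rewrite /tr_sin (shift sin measurable_sin sin_norm_le1).
have Lc := L1_cos xi Lg; have Ls := L1_sin xi Lg.
have -> : \int[mu]_x (gauss x * cos (dot c xi + dot x xi)) =
    cos (dot c xi) * tr_cos (@gauss R d) xi - sin (dot c xi) * tr_sin (@gauss R d) xi.
  rewrite /tr_cos /tr_sin -(RintZ _ Lc) -(RintZ _ Ls) -RintB; [|exact: L1Z|exact: L1Z].
  by apply: eq_Rint => x; rewrite cosD; ring.
have -> : \int[mu]_x (gauss x * sin (dot c xi + dot x xi)) =
    sin (dot c xi) * tr_cos (@gauss R d) xi + cos (dot c xi) * tr_sin (@gauss R d) xi.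
  rewrite /tr_cos /tr_sin -(RintZ _ Lc) -(RintZ _ Ls) -RintD; [|exact: L1Z|exact: L1Z].
  by apply: eq_Rint => x; rewrite sinD; ring.
rewrite tr_sin_gauss tr_cos_gauss !mulr0 subr0 addr0.
by congr (_ +i* _)%C; [|congr (- _)]; field.
Qed.

Lemma hat_partial phi i xi : schwartz phi ->
  hat (partials [:: i] phi) xi =
    ((xi ord0 i * re (crot (hat phi)) xi)%R +i* (xi ord0 i * im (crot (hat phi)) xi)%R)%C.
Proof.
move=> sp; rewrite /crot !hatE /=.
by rewrite fourier_re_partial// fourier_im_partial// mulrN.
Qed.

Lemma hat_partials4 phi i k xi : schwartz phi ->
  hat (partials (nseq (4 * k) i) phi) xi =
    ((xi ord0 i ^+ (4 * k) * re (hat phi) xi)%R +i* (xi ord0 i ^+ (4 * k) * im (hat phi) xi)%R)%C.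
Proof.
move=> sp; elim: k => [|k IH].
  by rewrite muln0 expr0 !mul1r !hatE.
have sk := schwartz_partials (nseq (4 * k) i) sp.
rewrite mulnS -[(4 + 4 * k)%N]/(4 * k).+4.
rewrite (_ : partials (nseq (4 * k).+4 i) phi = partials [:: i] (partials [:: i]
  (partials [:: i] (partials [:: i] (partials (nseq (4 * k) i) phi)))))//.
have s1 := schwartz_partials [:: i] sk.
have s2 := schwartz_partials [:: i] s1.
have s3 := schwartz_partials [:: i] s2.
rewrite hat_partial// /crot hat_partial// /crot hat_partial// /crot hat_partial//.
by rewrite /crot IH /= !exprS; congr (_ +i* _)%C; ring.
Qed.

(* A derivative of high order, divisible by 4, of a translated Gaussian has vanishing
   moments, and pairing [F] with its transform gives the Fourier transform of the
   integrable function [F xi * xi_0 ^ (4 k) * gauss xi] at the translation vector. *)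
Lemma fourier_pairing_inj t F : t != 0 -> wL2 t F ->
  (forall phi, schwartz_mom (t - d%:R / 2) phi ->
     \int[mu]_xi cdot F (hat phi) xi = 0 /\ \int[mu]_xi cdot F (crot (hat phi)) xi = 0) ->
  {ae mu, forall xi, F xi = 0}.
Proof.
move=> t0 hF h0.
have [k [tk _]] := @moment_order R (t - d%:R / 2).
pose i0 := Ordinal d0.
pose g c : 'rV[R]_d -> R := gaussp (fun=> 1) c.
pose phi c := partials (nseq (4 * k) i0) (g c).
have sg c : schwartz (g c) by exact: schwartz_gaussp.
have phiS c : schwartz_mom (t - d%:R / 2) (phi c).
  split=> [|a ar]; first exact/schwartz_partials/sg.
  apply: moment_partials => //.
  have : (mdeg a)%:R < k%:R :> R by exact: le_lt_trans ar tk.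
  rewrite ltr_nat => ak; rewrite (@leq_ltn_trans (mdeg a))//.
    by rewrite /mdeg (bigD1 i0)//= leq_addr.
  by rewrite (leq_trans ak)// leq_pmull.
pose q xi : R := xi ord0 i0 ^+ (4 * k) * gauss xi.
pose u xi := re F xi * q xi; pose v xi := im F xi * q xi.
have E1 c xi : cdot F (hat (phi c)) xi =
    u xi * cos (dot xi c) - v xi * sin (dot xi c).
  by rewrite /cdot /phi hat_partials4// hat_gauss_translate /= dotC /u /v /q; ring.
have E2 c xi : cdot F (crot (hat (phi c))) xi =
    u xi * sin (dot xi c) + v xi * cos (dot xi c).
  by rewrite /cdot /crot /phi hat_partials4// hat_gauss_translate /= dotC /u /v /q; ring.
have Lp c : L1 mu (cdot F (hat (phi c))) by apply: L1_dual hF _ => //; exact: hat_wL2.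
have Lpr c : L1 mu (cdot F (crot (hat (phi c)))).
  by apply: L1_dual hF _ => //; apply: wL2_crot; exact: hat_wL2.
have d00 xi : dot xi 0 = 0 by rewrite dotC -(scale0r 0) dotZl mul0r.
have Lu : L1 mu u.
  by apply: eq_integrable (Lp 0) => // xi _ /=; rewrite E1 d00 cos0 sin0 mulr1 mulr0 subr0.
have Lv : L1 mu v.
  by apply: eq_integrable (Lpr 0) => // xi _ /=; rewrite E2 d00 cos0 sin0 mulr1 mulr0 add0r.
have e1 c : tr_cos u c - tr_sin v c = 0.
  rewrite -(h0 _ (phiS c)).1 (eq_Rint _ (E1 c)) RintB//; [exact: L1_cos|exact: L1_sin].
have e2 c : tr_sin u c + tr_cos v c = 0.
  rewrite -(h0 _ (phiS c)).2 (eq_Rint _ (E2 c)) RintD//; [exact: L1_sin|exact: L1_cos].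
have evenc f c : tr_cos f (- c) = tr_cos f c.
  by apply: eq_Rint => x; rewrite dotC dotNl cosN dotC.
have odds f c : L1 mu f -> tr_sin f (- c) = - tr_sin f c.
  move=> Lf; rewrite /tr_sin -RintN; last exact: L1_sin.
  by apply: eq_Rint => x; rewrite dotC dotNl sinN dotC mulrN.
have cu c : tr_cos u c = 0 by have := e1 c; have := e1 (- c); rewrite evenc odds//; lra.
have sv c : tr_sin v c = 0 by have := e1 c; rewrite cu; lra.
have su c : tr_sin u c = 0 by have := e2 c; have := e2 (- c); rewrite evenc odds//; lra.
have cv c : tr_cos v c = 0 by have := e2 c; rewrite su; lra.
have u0 := fourier_unique Lu cu su; have v0 := fourier_unique Lv cv sv.
apply: filterS3 u0 v0 (@ae_coor_neq0 R d) => xi uz vz cz.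
have q0 : q xi != 0 by rewrite mulf_neq0 ?expf_neq0 ?cz// gt_eqF// gauss_gt0.
move: uz vz; rewrite /u /v => /eqP; rewrite mulf_eq0 (negbTE q0) orbF => /eqP uz.
move=> /eqP; rewrite mulf_eq0 (negbTE q0) orbF => /eqP vz.
by move: uz vz; case: (F xi) => a b /= -> ->.
Qed.

End fourier_pairing.

Section identification.
Context {R : realType} {d : nat}.
Hypothesis d0 : (0 < d)%N.
Local Notation mu := (@lebesgue_rV R d).
Local Notation e i := (delta_mx ord0 i : 'rV[R]_d).
Implicit Types (F G K : 'rV[R]_d -> R[i]) (phi psi g : 'rV[R]_d -> R).
Implicit Types (x xi : 'rV[R]_d) (t r : R) (T U : functional R d) (D : set 'rV[R]_d).
Local Notation re F xi := (complex.Re (F xi)).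
Local Notation im F xi := (complex.Im (F xi)).

Lemma cintegral_conj F G : cintegral (fun xi => F xi * (G xi)^*%C) =
  ((\int[mu]_xi cdot F G xi) +i* (\int[mu]_xi cdot F (crot G) xi))%C.
Proof.
rewrite /cintegral; congr (_ +i* _)%C; apply: eq_Rint => xi;
  rewrite /cdot /crot; case: (F xi) (G xi) => a b [a' b'] /=; ring.
Qed.

Lemma is_fourierP t T F : is_fourier t T F <-> wL2 t F /\
  forall phi, schwartz_mom (t - d%:R / 2) phi ->
    T phi = \int[mu]_xi cdot F (hat phi) xi /\
    \int[mu]_xi cdot F (crot (hat phi)) xi = 0.
Proof.
have E xi : enorm xi `^ (2 * t) * (re F xi ^+ 2 + im F xi ^+ 2) = wt t xi * cdot F F xi.
  by rewrite /cdot !expr2.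
split=> [[mr mi Foo hT]|[[[mr mi] L] hT]].
  split=> [|phi /hT].
    split; first by split.
    apply: Rint_ge0E.
    - by apply: measurable_funM; [exact: measurable_wt|exact: measurable_cdot].
    - by move=> xi; rewrite mulr_ge0 ?wt_ge0 ?cdot_ge0.
    - by under eq_integral do rewrite -E.
  by rewrite cintegral_conj => -[-> <-].
split=> // [|phi sp]; first by under eq_integral do rewrite E; exact: L1_ltoo.
by rewrite cintegral_conj; have [-> ->] := hT _ sp.
Qed.

Lemma wform_ae t F F' G G' : wL2 t F -> wL2 t F' -> wL2 t G -> wL2 t G' ->
  {ae mu, forall xi, F xi = F' xi} -> {ae mu, forall xi, G xi = G' xi} ->
  wform t F G = wform t F' G'.
Proof.
move=> hF hF' hG hG' FF GG; apply: Rint_ae.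
- exact: L1_measurable (L1_cdot hF hG).
- exact: L1_measurable (L1_cdot hF' hG').
- by apply: filterS2 FF GG => xi h h'; rewrite /cdot h h'.
Qed.

Lemma crot_ae F G : {ae mu, forall xi, F xi = G xi} ->
  {ae mu, forall xi, crot F xi = crot G xi}.
Proof. by apply: filterS => xi h; rewrite /crot h. Qed.

Lemma cdot_linr c F G K xi : cdot K (clin c F G) xi = c * cdot K F xi + cdot K G xi.
Proof. by rewrite cdotC cdot_lin ![cdot _ K _]cdotC. Qed.

Lemma Rint_dual_lin t c F G K : t != 0 -> wL2 t F -> wL2 t G -> wL2 (- t) K ->
  \int[mu]_xi cdot (clin c F G) K xi = c * (\int[mu]_xi cdot F K xi) + \int[mu]_xi cdot G K xi.
Proof.
move=> t0 hF hG hK; rewrite -RintZ; last exact: L1_dual hF hK.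
rewrite -RintD; [|exact/L1Z/(L1_dual _ _ hF hK)|exact: L1_dual hG hK].
by apply: eq_Rint => xi; rewrite cdot_lin.
Qed.

Lemma is_fourier_lin t c T U F G : t != 0 -> is_fourier t T F -> is_fourier t U G ->
  is_fourier t (fun phi => c * T phi + U phi) (clin c F G).
Proof.
move=> t0 /is_fourierP[hF TF] /is_fourierP[hG UG]; apply/is_fourierP.
split=> [|phi sp]; first exact: wL2_clin.
have [-> f0] := TF _ sp; have [-> g0] := UG _ sp; have hw := hat_wL2 d0 sp.
rewrite !(Rint_dual_lin _ t0 hF hG)//; last exact: wL2_crot.
by rewrite f0 g0 mulr0 addr0.
Qed.

Lemma functional_subE T U : T \- U = (fun phi => -1 * U phi + T phi).
Proof. by apply/funext => phi /=; rewrite mulN1r addrC. Qed.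

Lemma is_fourier_sub t T U F G : t != 0 -> is_fourier t T F -> is_fourier t U G ->
  is_fourier t (T \- U) (clin (-1) G F).
Proof. by move=> t0 hT hU; rewrite functional_subE; exact: is_fourier_lin. Qed.

Lemma is_fourier_uniq t T F G : t != 0 -> is_fourier t T F -> is_fourier t T G ->
  {ae mu, forall xi, F xi = G xi}.
Proof.
move=> t0 hF hG; have /is_fourierP[hD TD] := is_fourier_sub t0 hG hF.
have h : {ae mu, forall xi, clin (-1) F G xi = 0}.
  apply: fourier_pairing_inj hD _ => // phi sp; have [<- ->] := TD _ sp.
  by rewrite /= subrr.
apply: filterS h => xi; rewrite /clin; case: (F xi) (G xi) => a b [a' b'] /=.
case=> /eqP; rewrite mulN1r addrC subr_eq0 => /eqP -> /eqP.
by rewrite mulN1r addrC subr_eq0 => /eqP ->.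
Qed.

Lemma fourier_hdotP t T F : is_fourier t T F -> is_fourier t T (fourier_hdot t T).
Proof. by move=> h; apply: (@xgetPex _ (fun=> 0) [set F | is_fourier t T F]); exists F. Qed.

Lemma hdot_innerE t T U F G : t != 0 -> is_fourier t T F -> is_fourier t U G ->
  hdot_inner t T U = (wform t F G +i* wform t F (crot G))%C.
Proof.
move=> t0 hT hU; have hT' := fourier_hdotP hT; have hU' := fourier_hdotP hU.
have FF := is_fourier_uniq t0 hT' hT; have GG := is_fourier_uniq t0 hU' hU.
have [hF _] := (is_fourierP t T F).1 hT; have [hG _] := (is_fourierP t U G).1 hU.
have [hF' _] := (is_fourierP t T _).1 hT'; have [hG' _] := (is_fourierP t U _).1 hU'.
rewrite -(wform_ae hF' hF hG' hG FF GG).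
rewrite -(wform_ae hF' hF (wL2_crot hG') (wL2_crot hG) FF (crot_ae GG)).
rewrite /hdot_inner /cintegral /wform; congr (_ +i* _)%C; apply: eq_Rint => xi;
  rewrite /cdot /crot; case: (fourier_hdot t T xi) (fourier_hdot t U xi) => a b [a' b'] /=.
all: rewrite /wt; ring.
Qed.

Lemma hdot_normE t T F : t != 0 -> is_fourier t T F ->
  hdot_norm t T = Num.sqrt (wform t F F).
Proof. by move=> t0 h; rewrite /hdot_norm (hdot_innerE t0 h h). Qed.

Lemma hdot_norm_sq t T F : t != 0 -> is_fourier t T F ->
  hdot_norm t T ^+ 2 = wform t F F.
Proof. by move=> t0 h; rewrite (hdot_normE t0 h) sqr_sqrtr// wform_ge0. Qed.

Lemma schwartz_mom_lin r c phi psi : schwartz_mom r phi -> schwartz_mom r psi ->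
  schwartz_mom r (fun x => c * phi x + psi x).
Proof.
move=> [sp mp] [sq mq]; split; first exact: schwartz_lin.
move=> a ar; rewrite (_ : (fun _ => _) =
    (fun x => c * (monom a x * phi x) + monom a x * psi x)); last first.
  by apply/funext => x; ring.
rewrite RintD; [|exact/L1Z/L1_monom|exact: L1_monom].
by rewrite RintZ ?mp ?mq ?mulr0 ?addr0//; exact: L1_monom.
Qed.

Lemma schwartz_mom_neg r : r < 0 -> @schwartz_mom R d r = schwartz.
Proof.
move=> r0; apply/seteqP; split=> [phi []//|phi sp]; split=> // a ar.
by have := le_lt_trans ar r0; rewrite ltrn0.
Qed.

Lemma dual_lin r c T U : dual r T -> dual r U ->
  dual r (fun phi => c * T phi + U phi).
Proof.
move=> [lT [C [n bT]]] [lU [C' [n' bU]]]; split.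
  by move=> b phi psi sp sq; rewrite lT// lU//; ring.
exists (`|c| * `|C| + `|C'|), (maxn n n') => phi sp.
have h m B : (m <= maxn n n')%N -> B * schwartz_norm m phi <= `|B| * schwartz_norm (maxn n n') phi.
  move=> mn; apply: le_trans (ler_wpM2r _ (ler_norm _)) _; first exact: schwartz_norm_ge0 sp.1.
  by rewrite ler_wpM2l//; exact: schwartz_norm_mono sp.1 mn.
apply: le_trans (ler_normD _ _) _; rewrite mulrDl lerD//.
  rewrite normrM -mulrA ler_wpM2l//; apply: le_trans (bT _ sp) _.
  exact/h/leq_maxl.
by apply: le_trans (bU _ sp) _; exact/h/leq_maxr.
Qed.

Definition cherm F : Prop := forall xi, re F (- xi) = re F xi /\ im F (- xi) = - im F xi.

Lemma cherm_hat phi : L1 mu phi -> cherm (hat phi).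
Proof. by move=> L xi; rewrite !hatE /= fourier_reN fourier_imN. Qed.

Lemma enormN xi : enorm (- xi) = enorm xi.
Proof. by rewrite /enorm dotNl dotC dotNl opprK. Qed.

Lemma cherm_scale t F : cherm F -> cherm (wscale t F).
Proof.
by move=> hF xi; rewrite /wscale /= /wt enormN; have [-> ->] := hF xi; rewrite mulrN.
Qed.

Lemma Rint_cherm F G : L1 mu (cdot F (crot G)) -> cherm F -> cherm G ->
  \int[mu]_xi cdot F (crot G) xi = 0.
Proof.
move=> L hF hG; apply: Rint_odd => // xi; rewrite /cdot /crot /=.
by have [-> ->] := hF xi; have [-> ->] := hG xi; ring.
Qed.

Lemma wform_cherm t F G : wL2 t F -> wL2 t G -> cherm F -> cherm G ->
  wform t F (crot G) = 0.
Proof.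
move=> hF hG cF cG; apply: Rint_odd; first exact: L1_cdot hF (wL2_crot hG).
move=> xi; rewrite /cdot /crot /= /wt enormN.
by have [-> ->] := cF xi; have [-> ->] := cG xi; ring.
Qed.

Lemma Rint_hat_crot phi psi : schwartz phi -> schwartz psi ->
  \int[mu]_xi cdot (hat phi) (crot (hat psi)) xi = 0.
Proof.
move=> sp sq; have Lp := schwartz_L1 sp; have Lq := schwartz_L1 sq.
apply: Rint_cherm; try exact: cherm_hat.
apply: L1_le (L1D (L1_fourier_sq sp) (L1_fourier_sq sq)) _.
  by apply: measurable_cdot; [exact: cmeas_hat|apply: cmeas_crot; exact: cmeas_hat].
move=> xi; apply: le_trans (cdot_le _ _ _) _.
by rewrite cdot_crot2 !cdot_hat -!fourier_sqE.
Qed.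

Lemma dual_dist_of r g : schwartz g -> dual r (dist_of g).
Proof.
move=> sg; have Lg := schwartz_L1 sg.
have L phi : schwartz phi -> L1 mu (fun x => g x * phi x).
  move=> sp; apply: (@L1_Mb _ _ _ _ (schwartz_norm 0 phi)) => //.
    exact: schwartz_measurable.
  by move=> x; exact: schwartz_bounded.
split=> [c phi psi [sp _] [sq _]|].
  rewrite /dist_of /l2pair -(RintZ c (L _ sp)) -(RintD (L1Z c (L _ sp)) (L _ sq)).
  by apply: eq_Rint => x; ring.
exists (\int[mu]_x `|g x|), 0%N => phi [sp _]; rewrite /dist_of /l2pair.
apply: le_trans (Rint_norm (L _ sp)) _.
rewrite mulrC -RintZ; last exact: L1_norm.
apply: Rint_le; [exact/L1_norm/L|exact/L1Z/L1_norm|] => x.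
by rewrite normrM mulrC ler_wpM2r//; exact: schwartz_bounded.
Qed.

Lemma is_fourier_dist_of t g : schwartz g -> wL2 t (hat g) ->
  is_fourier t (dist_of g) (hat g).
Proof.
move=> sg hg; apply/is_fourierP; split=> // phi [sp _].
split; last exact: Rint_hat_crot.
rewrite /dist_of -(parseval sg sp).2; apply: eq_Rint => xi.
by rewrite cdot_hat.
Qed.

Lemma test_schwartz D g : test_fun D g -> schwartz g.
Proof.
move=> [sm cK _]; set K := closure _ in cK.
have out w x : ~ K x -> partials w g x = 0.
  elim: w x => [|i w IH] x nK /=.
    by apply: contrapT => /eqP gx; apply: nK; exact: (@subset_closure _ [set x | g x != 0]).
  rewrite (@near_eq_derive _ _ _ _ (cst 0)) ?derive_cst//.
  have oK : open (~` K) by apply: closed_openC; exact: closed_closure.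
  by apply: filterS (open_nbhs_nbhs (conj oK nK)) => y; exact: IH.
split=> // a w.
pose f x := `|monom a x * partials w g x|.
have cf : continuous f.
  move=> x; apply: (@cvg_norm _ _ _ (nbhs x) _ (fun y => monom a y * partials w g y)).
  apply: (@cvgM _ _ (nbhs x) _ (fun y => monom a y)); last exact/differentiable_continuous/sm.
  apply: (@cvg_bigprod _ _ (nbhs x)) => i.
  apply: (@continuous_comp _ _ _ (fun y : 'rV[R]_d => y ord0 i) (fun z : R => z ^+ a i)).
    exact: coord_continuous.
  exact: exprn_continuous.
have [[y Ky]|nK] := pselect (K !=set0).
  have [c _ hc] := compact_EVT_max (ex_intro _ y Ky) cK (continuous_subspaceT cf).
  exists (f c) => x; have [Kx|nKx] := pselect (K x); first by apply: hc; rewrite inE.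
  by rewrite out// mulr0 normr0 normr_ge0.
exists 0 => x; rewrite out ?mulr0 ?normr0// => Kx; apply: nK; by exists x.
Qed.

End identification.

Section density.
Context {R : realType} {d : nat}.
Hypothesis d0 : (0 < d)%N.
Local Notation mu := (@lebesgue_rV R d).
Implicit Types (F G K : 'rV[R]_d -> R[i]) (phi psi g : 'rV[R]_d -> R).
Implicit Types (x xi : 'rV[R]_d) (t r s : R) (T U : functional R d) (D : set 'rV[R]_d).
Local Notation re F xi := (complex.Re (F xi)).
Local Notation im F xi := (complex.Im (F xi)).

Definition wclosure t (V0 : set ('rV[R]_d -> R[i])) : set ('rV[R]_d -> R[i]) :=
  form_closure clin (wL2 t) (wform t) V0.

Lemma wform_cauchy_schwarz t F G : wL2 t F -> wL2 t G ->
  wform t F G ^+ 2 <= wform t F F * wform t G G.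
Proof.
exact: (form_cauchy_schwarz (@wL2_clin R d t) (@wform_lin R d t)
  (fun u v _ _ => wformC t u v) (fun u _ => wform_ge0 t u)).
Qed.

Lemma wform_linr t c F G K : wL2 t F -> wL2 t G -> wL2 t K ->
  wform t K (clin c F G) = c * wform t K F + wform t K G.
Proof. by move=> hF hG hK; rewrite wformC wform_lin// ![wform t _ K]wformC. Qed.

Lemma wclosure_orthogonal t V0 w K : V0 `<=` wL2 t -> wL2 t K -> wclosure t V0 w ->
  (forall v, V0 v -> wform t v K = 0) -> wform t w K = 0.
Proof.
exact: (form_closure_orthogonal (@wL2_clin R d t) (@wform_lin R d t)
  (fun u v _ _ => wformC t u v) (fun u _ => wform_ge0 t u)).
Qed.

Lemma wclosure_lin t V0 c u v : V0 `<=` wL2 t ->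
  (forall c u v, V0 u -> V0 v -> V0 (clin c u v)) ->
  wclosure t V0 u -> wclosure t V0 v -> wclosure t V0 (clin c u v).
Proof.
exact: (form_closure_lin (@wL2_clin R d t) (@wform_lin R d t)
  (fun u v _ _ => wformC t u v) (fun u _ => wform_ge0 t u)).
Qed.

Lemma wform_riesz t (V0 : set ('rV[R]_d -> R[i])) (l : ('rV[R]_d -> R[i]) -> R)
    (C : R) (v0 : 'rV[R]_d -> R[i]) :
  V0 v0 -> V0 `<=` wL2 t -> (forall c u v, V0 u -> V0 v -> V0 (clin c u v)) ->
  (forall c u v, V0 u -> V0 v -> l (clin c u v) = c * l u + l v) ->
  0 <= C -> (forall v, V0 v -> l v ^+ 2 <= C * wform t v v) ->
  exists2 w, wclosure t V0 w & forall v, V0 v -> wform t w v = l v.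
Proof.
exact: (riesz_representation (@wL2_clin R d t) (@wform_lin R d t)
  (fun u v _ _ => wformC t u v) (fun u _ => wform_ge0 t u) (@wform_complete R d d0 t)).
Qed.

Definition functional_of F : functional R d := fun psi => \int[mu]_xi cdot F (hat psi) xi.

Definition real_pairing t F : Prop := forall phi, schwartz_mom (t - d%:R / 2) phi ->
  \int[mu]_xi cdot F (crot (hat phi)) xi = 0.

Lemma is_fourier_functional_of t F : wL2 t F -> real_pairing t F ->
  is_fourier t (functional_of F) F.
Proof. by move=> hF rF; apply/is_fourierP; split=> // phi sp; split=> //; exact: rF. Qed.

Lemma hdot_functional_of t F : t != 0 -> wL2 t F -> real_pairing t F ->
  hdot t (functional_of F).
Proof.
move=> t0 hF rF; split; last by exists F; exact: is_fourier_functional_of.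
split=> [c phi psi sp sq|].
  rewrite /functional_of hat_lin; [|exact: schwartz_L1 sp.1|exact: schwartz_L1 sq.1].
  have hp := L1_dual d0 t0 hF (hat_wL2 d0 sp); have hq := L1_dual d0 t0 hF (hat_wL2 d0 sq).
  rewrite -(RintZ c hp) -(RintD (L1Z c hp) hq).
  by apply: eq_Rint => xi; rewrite cdot_linr.
have [C [n [C0 h]]] := @hat_bound R d d0 t.
exists (Num.sqrt (wform t F F * C)), n => phi sp; have [hp bp] := h _ sp.
rewrite /functional_of (Rint_dual d0 t0 hF hp).
have hs := wL2_scale t0 hp.
rewrite -(@ler_pXn2r _ 2)// ?nnegrE//; last by rewrite mulr_ge0 ?sqrtr_ge0// (schwartz_norm_ge0 _ sp.1).
rewrite real_normK ?num_real// exprMn sqr_sqrtr ?mulr_ge0 ?wform_ge0//.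
apply: le_trans (wform_cauchy_schwarz hF hs) _.
by rewrite wform_scale// -mulrA ler_wpM2l// wform_ge0.
Qed.

Definition hats r : set ('rV[R]_d -> R[i]) := hat @` schwartz_mom r.

Lemma hats_wL2 t : hats (t - d%:R / 2) `<=` wL2 (- t).
Proof. by move=> _ [phi sp <-]; exact: hat_wL2. Qed.

Lemma hats_lin r c F G : hats r F -> hats r G -> hats r (clin c F G).
Proof.
move=> [phi sp <-] [psi sq <-]; exists (fun x => c * phi x + psi x).
  exact: schwartz_mom_lin.
by rewrite hat_lin//; [exact: schwartz_L1 sp.1|exact: schwartz_L1 sq.1].
Qed.

Lemma schwartz_mom0 r : schwartz_mom r (fun _ : 'rV[R]_d => 0).
Proof.
split=> [|a _]; first exact: schwartz0.
by under eq_Rint do rewrite mulr0; exact: Rintegral0.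
Qed.

Lemma Rint_scale_hat t F K : t != 0 -> cmeas F -> cmeas K ->
  wform (- t) (wscale t F) K = \int[mu]_xi cdot F K xi.
Proof.
move=> t0 mF mK; apply: Rint_ae.
- apply: measurable_funM; first exact: measurable_wt.
  by apply: measurable_cdot => //; exact: cmeas_wscale.
- exact: measurable_cdot.
- apply: filterS (@ae_enorm_gt0 R d d0) => xi e0.
  by rewrite cdotC cdot_scale cdotC mulrA mulrC -{2}(opprK t) wt_inv// mulr1.
Qed.

Lemma wform_crotN t F G : wL2 t F -> wL2 t G -> wform t F (crot G) = - wform t G (crot F).
Proof.
move=> hF hG; rewrite /wform -RintN; last exact/L1_cdot/wL2_crot.
by apply: eq_Rint => xi; rewrite /cdot /crot /=; ring.
Qed.

Lemma wform_scaleN t F G : t != 0 -> wform (- t) (wscale t F) (wscale t G) = wform t F G.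
Proof. by move=> t0; have := @wform_scale R d (- t) F G; rewrite opprK oppr_eq0; apply. Qed.

Lemma wL2_scaleN t F : t != 0 -> wL2 t F -> wL2 (- t) (wscale t F).
Proof. by move=> t0; have := @wL2_scale R d (- t) F; rewrite opprK oppr_eq0; apply. Qed.

(* The residual of the orthogonal projection onto the closure of [hats] is orthogonal
   to [hats] in the real and in the imaginary sense, so [fourier_pairing_inj] kills
   it. *)
Lemma hats_dense t F (e : R) : t != 0 -> wL2 t F -> real_pairing t F -> 0 < e ->
  exists2 phi, schwartz_mom (t - d%:R / 2) phi &
    wform (- t) (clin (-1) (hat phi) (wscale t F)) (clin (-1) (hat phi) (wscale t F)) < e.
Proof.
move=> t0 hF rF; move: e.
have nt0 : - t != 0 by rewrite oppr_eq0.
set G := wscale t F.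
have hG : wL2 (- t) G by exact: wL2_scaleN.
have hsub := @hats_wL2 t.
have [w cw hw] : exists2 w, wclosure (- t) (hats (t - d%:R / 2)) w &
    forall v, hats (t - d%:R / 2) v -> wform (- t) w v = wform (- t) G v.
  apply: (@wform_riesz (- t) _ (wform (- t) G) (wform (- t) G G) (hat (fun=> 0))) => //.
  - by exists (fun=> 0) => //; exact: schwartz_mom0.
  - exact: hats_lin.
  - by move=> c u v hu hv; rewrite wform_linr//; exact: hsub.
  - exact: wform_ge0.
  - by move=> v hv; apply: wform_cauchy_schwarz => //; exact: hsub.
have hww : wL2 (- t) w := cw.1.
have hE : wL2 (- t) (clin (-1) w G) by exact: wL2_clin.
have E0 : {ae mu, forall xi, wscale (- t) (clin (-1) w G) xi = 0}.
  apply: (fourier_pairing_inj d0 t0); first exact: wL2_scale.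
  move=> phi sp; have hp := hat_wL2 d0 sp.
  have V0 : hats (t - d%:R / 2) (hat phi) by exists phi.
  have S K : wL2 (- t) K -> \int[mu]_xi cdot (wscale (- t) (clin (-1) w G)) K xi =
      wform (- t) (clin (-1) w G) K.
    by move=> _; apply: eq_Rint => xi; rewrite cdotC cdot_scale cdotC.
  rewrite !S//; last exact: wL2_crot.
  have hc := wL2_crot hp.
  rewrite !wform_lin// hw// mulN1r addNr; split=> //.
  rewrite (wclosure_orthogonal hsub hc cw) ?mulr0 ?add0r.
    rewrite /G Rint_scale_hat//; [exact: rF|exact: hF.1|exact: hc.1].
  move=> _ [psi sq <-]; apply: wform_cherm => //; first exact: hat_wL2.
    exact/cherm_hat/schwartz_L1/sq.1.
  exact/cherm_hat/schwartz_L1/sp.1.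
have wG : {ae mu, forall xi, w xi = G xi}.
  apply: filterS2 E0 (@ae_enorm_gt0 R d d0) => xi + e0.
  rewrite /wscale /clin; case: (w xi) (G xi) => a b [a' b'] /= [] /eqP.
  rewrite mulf_eq0 (gt_eqF (wt_gt0 _ e0))/= mulN1r addrC subr_eq0 => /eqP -> /eqP.
  by rewrite mulf_eq0 (gt_eqF (wt_gt0 _ e0))/= mulN1r addrC subr_eq0 => /eqP ->.
move=> e e0; have [_ [phi sp <-] lt] := cw.2 _ e0; exists phi => //.
have hp := hat_wL2 d0 sp.
have h1 : wL2 (- t) (clin (-1) (hat phi) w) by exact: wL2_clin.
have h2 : wL2 (- t) (clin (-1) (hat phi) G) by exact: wL2_clin.
have ae1 : {ae mu, forall xi, clin (-1) (hat phi) w xi = clin (-1) (hat phi) G xi}.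
  by apply: filterS wG => xi h; rewrite /clin h.
by rewrite -(wform_ae h1 h2 h1 h2 ae1 ae1).
Qed.

Lemma wform_real t F G : t != 0 -> wL2 t F -> wL2 t G -> real_pairing t F ->
  real_pairing t G -> wform t F (crot G) = 0.
Proof.
move=> t0 hF hG rF rG.
have cl K : wL2 t K -> real_pairing t K ->
    wclosure (- t) (hats (t - d%:R / 2)) (wscale t K).
  move=> hK rK; split=> [|e e0]; first exact: wL2_scaleN.
  by have [phi sp h] := hats_dense t0 hK rK e0; exists (hat phi) => //; exists phi.
have hF' := wL2_scaleN t0 hF; have hG' := wL2_scaleN t0 hG.
have hsub := @hats_wL2 t.
rewrite -(wform_scaleN _ _ t0).
rewrite (_ : wscale t (crot G) = crot (wscale t G)); last first.
  by apply/funext => xi; rewrite /wscale /crot /= mulrN.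
apply: (wclosure_orthogonal hsub (wL2_crot hG') (cl _ hF rF)) => _ [phi sp <-].
have hp := hat_wL2 d0 sp.
rewrite wform_crotN// (wclosure_orthogonal hsub (wL2_crot hp) (cl _ hG rG)) ?oppr0//.
move=> _ [psi sq <-]; apply: wform_cherm => //; first exact: hat_wL2.
  exact/cherm_hat/schwartz_L1/sq.1.
exact/cherm_hat/schwartz_L1/sp.1.
Qed.

End density.

(** * Projections onto the zero-boundary space *)

Section projection.
Context {R : realType} {d : nat}.
Hypothesis d0 : (0 < d)%N.
Local Notation mu := (@lebesgue_rV R d).
Implicit Types (F G K p q f : 'rV[R]_d -> R[i]) (phi psi g : 'rV[R]_d -> R).
Implicit Types (x xi : 'rV[R]_d) (t r : R) (T U V : functional R d).
Variables (s : R) (D : set 'rV[R]_d).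
Hypotheses (s0 : 0 < s) (hD : allowable s D).
Local Notation S_H := (@schwartz_mom R d (s - d%:R / 2)).

Let sn0 : s != 0. Proof. by rewrite gt_eqF. Qed.
Let nsn0 : - s != 0. Proof. by rewrite oppr_eq0. Qed.

Lemma test_fun_lin c g g' : test_fun D g -> test_fun D g' ->
  test_fun D (fun x => c * g x + g' x).
Proof.
move=> tg tg'; have [_ cg gD] := tg; have [_ cg' gD'] := tg'.
have sub : closure [set x | c * g x + g' x != 0] `<=`
    closure [set x | g x != 0] `|` closure [set x | g' x != 0].
  rewrite -closureU; apply: closure_subset => x /= h.
  have [g0|] := eqVneq (g x) 0; last by left.
  by right; move: h; rewrite g0 mulr0 add0r.
split; first exact: (schwartz_lin c (test_schwartz tg) (test_schwartz tg')).1.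
  by apply: subclosed_compact sub; [exact: closed_closure|exact: compactU].
by move=> x /sub[/gD|/gD'].
Qed.

Lemma test_fun0 : test_fun D (fun=> 0).
Proof.
have E : [set x : 'rV[R]_d | (0 : R) != 0] = set0.
  by apply/seteqP; split=> x //=; rewrite eqxx.
have [sm _] := @schwartz0 R d.
by split; rewrite ?E ?closure0//; exact: compact0.
Qed.

Definition tests : set ('rV[R]_d -> R[i]) := hat @` test_fun D.

Lemma test_hat_wL2 phi : schwartz phi -> wL2 s (hat phi).
Proof.
move=> sp; rewrite -(opprK s); apply: hat_wL2 => //.
rewrite schwartz_mom_neg// ltr_wnDr ?oppr_lt0// oppr_le0 divr_ge0//.
Qed.

Lemma tests_wL2 : tests `<=` wL2 s.
Proof. by move=> _ [g /test_schwartz sg <-]; exact: test_hat_wL2. Qed.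

Lemma tests_lin c F G : tests F -> tests G -> tests (clin c F G).
Proof.
move=> [g tg <-] [g' tg' <-]; exists (fun x => c * g x + g' x).
  exact: test_fun_lin.
by rewrite hat_lin//; apply: schwartz_L1; [exact: test_schwartz tg|exact: test_schwartz tg'].
Qed.

Lemma real_pairing_hat phi t : schwartz phi -> real_pairing t (hat phi).
Proof. by move=> sp psi [sq _]; exact: Rint_hat_crot. Qed.

Lemma closure_real_pairing F : wclosure s tests F -> real_pairing s F.
Proof.
move=> cF phi sp; have hp := hat_wL2 d0 sp.
rewrite (Rint_dual d0 sn0 cF.1 (wL2_crot hp)).
apply: wclosure_orthogonal cF _ => //; first exact: tests_wL2.
  by apply: wL2_scale => //; exact: wL2_crot.
move=> _ [g /test_schwartz sg <-].
rewrite -(Rint_dual d0 sn0 (test_hat_wL2 sg) (wL2_crot hp)).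
exact: Rint_hat_crot sp.1.
Qed.

Lemma hdot_real T F : is_fourier s T F -> real_pairing s F.
Proof. by move=> /is_fourierP[_ h] phi /h[]. Qed.

Lemma hdot_inner_real T U F G : is_fourier s T F -> is_fourier s U G ->
  hdot_inner s T U = (wform s F G)%:C%C.
Proof.
move=> hT hU; rewrite (hdot_innerE d0 sn0 hT hU) (wform_real d0 sn0)//.
- by case: ((is_fourierP _ _ _).1 hT).
- by case: ((is_fourierP _ _ _).1 hU).
- exact: hdot_real hT.
- exact: hdot_real hU.
Qed.

Lemma test_is_fourier g : test_fun D g -> is_fourier s (dist_of g) (hat g).
Proof.
move=> /test_schwartz sg; apply: is_fourier_dist_of => //; exact: test_hat_wL2.
Qed.

Lemma sqrt_lt (a e : R) : 0 < e -> a < e ^+ 2 -> Num.sqrt a < e.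
Proof.
by move=> e0 h; rewrite -[ltRHS]ger0_norm ?(ltW e0)// -sqrtr_sqr ltr_sqrt// exprn_gt0.
Qed.

Lemma hdot0P U F : is_fourier s U F -> dual (s - d%:R / 2) U ->
  hdot0 s D U <-> wclosure s tests F.
Proof.
move=> hU dU; have [hF _] := (is_fourierP _ _ _).1 hU.
have N g : test_fun D g -> hdot_norm s (U \- dist_of g) =
    Num.sqrt (wform s (clin (-1) (hat g) F) (clin (-1) (hat g) F)).
  move=> tg; apply: hdot_normE => //.
  by apply: is_fourier_sub => //; exact: test_is_fourier.
split=> [[_ h]|[_ h]].
  split=> // e e0; have [g tg] := h (Num.sqrt e) (etrans (sqrtr_gt0 e) e0).
  by rewrite N// ltr_sqrt// => lt; exists (hat g) => //; exists g.
split=> [|e e0]; first by split=> //; exists F.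
have e2 : 0 < e ^+ 2 by rewrite exprn_gt0.
by have [_ [g tg <-] lt] := h _ e2; exists g => //; rewrite N// sqrt_lt.
Qed.

Lemma hdot0_closure U : hdot0 s D U ->
  exists2 F, is_fourier s U F & wclosure s tests F.
Proof.
by move=> hU; have [[dU [F hF]] _] := hU; exists F => //; exact/(hdot0P hF dU).
Qed.

Lemma closure_hdot0 F : wclosure s tests F ->
  hdot0 s D (functional_of F) /\ is_fourier s (functional_of F) F.
Proof.
move=> cF; have rF := closure_real_pairing cF.
have hF := is_fourier_functional_of cF.1 rF; split=> //.
by apply/(hdot0P hF) => //; exact: (hdot_functional_of d0 sn0 cF.1 rF).1.
Qed.

Lemma tests_closure F : tests F -> wclosure s tests F.
Proof.
move=> tF; split=> [|e e0]; first exact: tests_wL2.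
exists F => //; rewrite (_ : clin _ _ _ = fun=> 0).
  by rewrite /wform /cdot; under eq_Rint do rewrite /= mul0r addr0 mulr0; rewrite Rintegral0.
by apply/funext => xi; rewrite /clin !mulN1r !addNr.
Qed.

Definition riesz_rep phi f : Prop := wclosure s tests f /\
  forall g, test_fun D g -> wform s f (hat g) = l2pair phi g.

Lemma riesz_rep_exists phi : schwartz phi -> exists f, riesz_rep phi f.
Proof.
move=> sp; have [C hC] := hD.2 _ sp.
pose l v := \int[mu]_xi cdot (hat phi) v xi.
have lg g : test_fun D g -> l (hat g) = l2pair phi g.
  move=> /test_schwartz sg; rewrite -(parseval sp sg).2.
  by apply: eq_Rint => xi; rewrite cdot_hat.
have L1g g : test_fun D g -> L1 mu (cdot (hat phi) (hat g)).
  move=> /test_schwartz sg.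
  by apply: eq_integrable (parseval sp sg).1 => // xi _ /=; rewrite cdot_hat.
have [f cf hf] : exists2 f, wclosure s tests f & forall v, tests v -> wform s f v = l v.
  apply: (@wform_riesz _ _ d0 s tests l (C ^+ 2) (hat (fun=> 0))).
  - by exists (fun=> 0) => //; exact: test_fun0.
  - exact: tests_wL2.
  - exact: tests_lin.
  - move=> c _ _ [g tg <-] [g' tg' <-]; rewrite /l.
    rewrite -(RintZ c (L1g _ tg)) -(RintD (L1Z c (L1g _ tg)) (L1g _ tg')).
    by apply: eq_Rint => xi; rewrite cdot_linr.
  - exact: sqr_ge0.
  - move=> _ [g tg <-]; rewrite lg//.
    rewrite -(hdot_norm_sq d0 sn0 (test_is_fourier tg)) -exprMn.
    have h := hC _ tg; rewrite -[X in X <= _]real_normK ?num_real//.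
    by rewrite lerXn2r ?nnegrE// (le_trans _ h).
by exists f; split=> // g tg; rewrite hf ?lg//; exists g.
Qed.

Lemma closure_eq f f' : wclosure s tests f -> wclosure s tests f' ->
  (forall g, test_fun D g -> wform s f (hat g) = wform s f' (hat g)) ->
  {ae mu, forall xi, f xi = f' xi}.
Proof.
move=> cf cf' h; have hf := cf.1; have hf' := cf'.1.
have hd : wL2 s (clin (-1) f f') by exact: wL2_clin.
have z k : wclosure s tests k -> wform s k (clin (-1) f f') = 0.
  move=> ck; apply: wclosure_orthogonal ck _ => //; first exact: tests_wL2.
  move=> _ [g tg <-]; have hg := test_hat_wL2 (test_schwartz tg).
  by rewrite wform_linr// !(wformC s (hat g)) h// mulN1r addNr.
have : wform s (clin (-1) f f') (clin (-1) f f') = 0.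
  by rewrite wform_lin// !z// mulr0 addr0.
move=> /(wform_eq0 d0 hd); apply: filterS => xi.
rewrite /clin; case: (f xi) (f' xi) => a b [a' b'] /= [] /eqP.
by rewrite mulN1r addrC subr_eq0 => /eqP -> /eqP; rewrite mulN1r addrC subr_eq0 => /eqP ->.
Qed.

Lemma riesz_rep_lin c phi psi f f' : schwartz phi -> schwartz psi ->
  riesz_rep phi f -> riesz_rep psi f' ->
  riesz_rep (fun x => c * phi x + psi x) (clin c f f').
Proof.
move=> sp sq [cf hf] [cf' hf']; split.
  by apply: wclosure_lin => //; [exact: tests_wL2|exact: tests_lin].
move=> g tg; have hg := test_hat_wL2 (test_schwartz tg).
rewrite wform_lin//; [|exact: cf.1|exact: cf'.1]; rewrite hf// hf'//.
have L h : schwartz h -> L1 mu (fun x => h x * g x).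
  move=> sh; apply: (@L1_Mb _ _ _ _ (schwartz_norm 0 g)).
  - exact: schwartz_L1.
  - exact: schwartz_measurable (test_schwartz tg).
  - by move=> x; apply: schwartz_bounded; exact: test_schwartz tg.
rewrite /l2pair -(RintZ c (L _ sp)) -(RintD (L1Z c (L _ sp)) (L _ sq)).
by apply: eq_Rint => x; ring.
Qed.

Lemma hdot_dom_norm_rep phi f : riesz_rep phi f -> hdot_dom_norm s D phi ^+ 2 = wform s f f.
Proof.
move=> [cf hf].
have ex : exists U, [set f | hdot0 s D f /\ forall g, test_fun D g ->
    hdot_inner s f (dist_of g) = (l2pair phi g)%:C%C] U.
  have [h0 hF] := closure_hdot0 cf; exists (functional_of f); split=> // g tg.
  by rewrite (hdot_inner_real hF (test_is_fourier tg)) hf.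
have [h0 hp] := getPex ex; have [F hF cF] := hdot0_closure h0.
rewrite /hdot_dom_norm (hdot_norm_sq d0 sn0 hF).
have ae : {ae mu, forall xi, F xi = f xi}.
  apply: closure_eq => // g tg; rewrite hf//.
  have := hp _ tg; rewrite -/(riesz s D phi) (hdot_inner_real hF (test_is_fourier tg)).
  by case.
exact: (wform_ae cF.1 cf.1 cF.1 cf.1 ae ae).
Qed.

(* The Fourier transform of [inv_laplacian s phi] *)
Definition invlap_hat phi := wscale (- s) (hat phi).

Lemma inv_laplacianE phi : inv_laplacian s phi = functional_of (invlap_hat phi).
Proof.
have h (c : R) (z z' : R[i]) : complex.Re ((c%:C%C * z) * z'^*%C) =
    c * (complex.Re z * complex.Re z' + complex.Im z * complex.Im z').
  by case: z z' => a b [a' b'] /=; ring.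
apply/funext => psi; apply: eq_Rint => xi.
by rewrite h cdotC cdot_scale cdotC /wt mulrN.
Qed.

Lemma invlap_hat_wL2 phi : S_H phi -> wL2 s (invlap_hat phi).
Proof. by move=> sp; apply: wL2_scale => //; exact: hat_wL2. Qed.

Lemma invlap_hat_real phi : S_H phi -> real_pairing s (invlap_hat phi).
Proof.
move=> sp psi sq; apply: Rint_cherm.
- apply: L1_dual (invlap_hat_wL2 sp) _ => //; apply: wL2_crot; exact: hat_wL2.
- exact/cherm_scale/cherm_hat/schwartz_L1/sp.1.
- exact/cherm_hat/schwartz_L1/sq.1.
Qed.

Lemma invlap_hat_is_fourier phi : S_H phi -> is_fourier s (inv_laplacian s phi) (invlap_hat phi).
Proof.
move=> sp; rewrite inv_laplacianE; apply: is_fourier_functional_of.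
  exact: invlap_hat_wL2.
exact: invlap_hat_real.
Qed.

Lemma invlap_hat_test phi g : S_H phi -> test_fun D g ->
  wform s (invlap_hat phi) (hat g) = l2pair phi g.
Proof.
move=> sp tg; have sg := test_schwartz tg; rewrite -(parseval sp.1 sg).2.
have L := L1_dual d0 sn0 (test_hat_wL2 sg) (hat_wL2 d0 sp).
rewrite wformC -(Rint_dual d0 sn0 (test_hat_wL2 sg) (hat_wL2 d0 sp)).
by apply: eq_Rint => xi; rewrite cdotC cdot_hat.
Qed.

Lemma hdot_norm_invlap_hat phi : S_H phi ->
  hdot_norm (- s) (dist_of phi) ^+ 2 = wform s (invlap_hat phi) (invlap_hat phi).
Proof.
move=> sp; have hp := hat_wL2 d0 sp.
rewrite (hdot_norm_sq d0 nsn0 (is_fourier_dist_of sp.1 hp)).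
by rewrite /invlap_hat wform_scale.
Qed.

Lemma projHar_norm phi p : S_H phi -> riesz_rep phi p ->
  hdot_norm s (projHar s D (inv_laplacian s phi)) ^+ 2 =
  wform s (clin (-1) p (invlap_hat phi)) (clin (-1) p (invlap_hat phi)).
Proof.
move=> sp [cp hp]; set T := inv_laplacian s phi.
have hT := invlap_hat_is_fourier sp; have hF := invlap_hat_wL2 sp.
have [p0 hpF] := closure_hdot0 cp.
have ex : exists U, [set U | hdot0 s D U /\
    forall V, hdot0 s D V -> hdot_inner s (T \- U) V = 0] U.
  exists (functional_of p); split=> // V /hdot0_closure[G hG cG].
  have hTU := is_fourier_sub d0 sn0 hT hpF.
  rewrite (hdot_inner_real hTU hG) wformC (wclosure_orthogonal tests_wL2 _ cG)//.
    by apply: wL2_clin => //; exact: cp.1.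
  move=> _ [g tg <-]; have hg := test_hat_wL2 (test_schwartz tg).
  rewrite wformC wform_lin//; last exact: cp.1.
  by rewrite hp// invlap_hat_test// mulN1r addNr.
have [h0 hU] := getPex ex; rewrite -/(projD s D T) in h0 hU.
have [q hq cq] := hdot0_closure h0.
have hTU := is_fourier_sub d0 sn0 hT hq.
rewrite /projHar (hdot_norm_sq d0 sn0 hTU).
have ae : {ae mu, forall xi, q xi = p xi}.
  apply: closure_eq => // g tg; have hg := test_hat_wL2 (test_schwartz tg).
  have g0 : hdot0 s D (dist_of g).
    apply/(hdot0P (test_is_fourier tg)); last by apply: tests_closure; exists g.
    exact/dual_dist_of/(test_schwartz tg).
  have := hU _ g0; rewrite (hdot_inner_real hTU (test_is_fourier tg)) => -[].
  rewrite wform_lin//; last exact: cq.1.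
  by rewrite invlap_hat_test// hp// => /eqP; rewrite mulN1r addrC subr_eq0 => /eqP ->.
have h1 : wL2 s (clin (-1) q (invlap_hat phi)) by apply: wL2_clin => //; exact: cq.1.
have h2 : wL2 s (clin (-1) p (invlap_hat phi)) by apply: wL2_clin => //; exact: cp.1.
have ae2 : {ae mu, forall xi, clin (-1) q (invlap_hat phi) xi = clin (-1) p (invlap_hat phi) xi}.
  by apply: filterS ae => xi h; rewrite /clin h.
exact: (wform_ae h1 h2 h1 h2 ae2 ae2).
Qed.

End projection.

Section approximation.
Context {R : realType} {d : nat}.
Hypothesis d0 : (0 < d)%N.
Local Notation mu := (@lebesgue_rV R d).
Implicit Types (F G K p q f : 'rV[R]_d -> R[i]) (phi psi g : 'rV[R]_d -> R).
Implicit Types (x xi : 'rV[R]_d) (t r : R) (T U V : functional R d).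
Variables (s : R) (D : set 'rV[R]_d).
Hypotheses (s0 : 0 < s) (hD : allowable s D).
Local Notation S_H := (@schwartz_mom R d (s - d%:R / 2)).
Local Notation invlap_hat := (invlap_hat s).

Let sn0 : s != 0. Proof. by rewrite gt_eqF. Qed.
Let nsn0 : - s != 0. Proof. by rewrite oppr_eq0. Qed.

Definition schwartz_sub psi phi : 'rV[R]_d -> R := fun x => -1 * phi x + psi x.

Lemma wform_sub_sq t F G : wL2 t F -> wL2 t G ->
  wform t (clin (-1) F G) (clin (-1) F G) = wform t F F - 2 * wform t F G + wform t G G.
Proof.
move=> hF hG; have hd : wL2 t (clin (-1) F G) by exact: wL2_clin.
by rewrite wform_lin// !wform_linr// (wformC t G F); ring.
Qed.

Lemma riesz_rep_invlap_hat phi p k : S_H phi -> riesz_rep s D phi p ->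
  wclosure s (tests D) k -> wform s k p = wform s k (invlap_hat phi).
Proof.
move=> sp [cp hp] ck; have hF := invlap_hat_wL2 d0 s0 sp; have hp2 := cp.1; have hk := ck.1.
have hsub := @tests_wL2 R d d0 s D s0.
have hd : wL2 s (clin (-1) p (invlap_hat phi)) by exact: wL2_clin.
have := wclosure_orthogonal hsub hd ck; rewrite wform_linr// mulN1r addrC.
move=> h; apply/esym/eqP; rewrite -subr_eq0; apply/eqP/h => _ [g tg <-].
have hg := test_hat_wL2 d0 s0 (test_schwartz tg).
by rewrite wformC wform_lin// hp// (invlap_hat_test d0 s0 sp tg) mulN1r addNr.
Qed.

Lemma norm_pythagoras phi : S_H phi ->
  hdot_norm (- s) (dist_of phi) ^+ 2 =
  hdot_norm s (projHar s D (inv_laplacian s phi)) ^+ 2 + hdot_dom_norm s D phi ^+ 2.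
Proof.
move=> sp; have [p rp] := riesz_rep_exists d0 s0 hD sp.1.
have hF := invlap_hat_wL2 d0 s0 sp; have hp := rp.1.1.
apply: (etrans (hdot_norm_invlap_hat d0 s0 sp)); apply/esym.
apply: (etrans (congr2 +%R (projHar_norm d0 s0 sp rp) (hdot_dom_norm_rep d0 s0 rp))).
by rewrite wform_sub_sq// -(riesz_rep_invlap_hat sp rp rp.1); ring.
Qed.

Lemma wform_invlap_hat_dist psi F : S_H psi -> wL2 s F ->
  wform (- s) (clin (-1) (hat psi) (wscale s F)) (clin (-1) (hat psi) (wscale s F)) =
  wform s (clin (-1) (invlap_hat psi) F) (clin (-1) (invlap_hat psi) F).
Proof.
move=> sp hF; have hp := hat_wL2 d0 sp; have hl := invlap_hat_wL2 d0 s0 sp.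
have hs := wL2_scaleN sn0 hF.
have hd : wL2 (- s) (clin (-1) (hat psi) (wscale s F)) by exact: wL2_clin.
rewrite -(wform_scale _ _ sn0).
have h1 := wL2_scale sn0 hd.
have h2 : wL2 s (clin (-1) (invlap_hat psi) F) by exact: wL2_clin.
have ae1 : {ae mu, forall xi, wscale (- s) (clin (-1) (hat psi) (wscale s F)) xi =
    clin (-1) (invlap_hat psi) F xi}.
  apply: filterS (@ae_enorm_gt0 R d d0) => xi e0.
  have w1 := wt_inv s e0.
  have E (y z : R) : wt (- s) xi * (-1 * y + wt s xi * z) = -1 * (wt (- s) xi * y) + z.
    by rewrite -[in RHS](mul1r z) -w1; ring.
  by rewrite /invlap_hat /wscale /clin; cbn [complex.Re complex.Im]; rewrite !E.
exact: (wform_ae h1 h2 h1 h2 ae1 ae1).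
Qed.

Lemma invlap_hat_lin c phi psi : S_H phi -> S_H psi ->
  invlap_hat (fun x => c * phi x + psi x) = clin c (invlap_hat phi) (invlap_hat psi).
Proof.
move=> sp sq; rewrite /invlap_hat hat_lin; [|exact: schwartz_L1 sp.1|exact: schwartz_L1 sq.1].
by apply/funext => xi; rewrite /wscale /clin /=; congr (_ +i* _)%C; ring.
Qed.

(* The left-hand side of the bound is the variance of
   (h, psi) - (h_D, phi) = (h^Har, psi) + (h_D, psi - phi). *)
Lemma dom_norm_approx phi (e : R) : schwartz phi -> 0 < e ->
  exists2 psi, S_H psi &
    hdot_norm s (projHar s D (inv_laplacian s psi)) ^+ 2 +
    hdot_dom_norm s D (schwartz_sub psi phi) ^+ 2 < e.
Proof.
move=> sp e0; have [f rf] := riesz_rep_exists d0 s0 hD sp.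
have hf := rf.1.1; have rpf := closure_real_pairing d0 s0 rf.1.
have [psi sq lt] := hats_dense d0 sn0 hf rpf e0; exists psi => //.
rewrite wform_invlap_hat_dist// in lt.
have [p rp] := riesz_rep_exists d0 s0 hD sq.1; have hp := rp.1.1.
have hF := invlap_hat_wL2 d0 s0 sq.
have rd := riesz_rep_lin d0 s0 (-1) sp sq.1 rf rp.
rewrite (projHar_norm d0 s0 sq rp) (hdot_dom_norm_rep d0 s0 rd).
move: lt; rewrite !wform_sub_sq//.
rewrite (wformC s p (invlap_hat psi)) (riesz_rep_invlap_hat sq rp rf.1).
rewrite (riesz_rep_invlap_hat sq rp rp.1) (wformC s p (invlap_hat psi)) (wformC s f (invlap_hat psi)).
by lra.
Qed.

(* [psi] is (-Delta)^s P^Har (-Delta)^{-s} [phi], which vanishes on [D]; the last bound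
   is on the variance of (h, phi') - (h^Har, phi). *)
Lemma projHar_approx phi : S_H phi -> exists psi : functional R d,
  [/\ Tspace s psi, dist_supp psi `<=` ~` D
    & forall e : R, 0 < e -> exists phi', [/\ S_H phi',
        hdot_norm (- s) (psi \- dist_of phi') < e &
        hdot_norm s (projHar s D (inv_laplacian s (schwartz_sub phi' phi))) ^+ 2 +
        hdot_dom_norm s D phi' ^+ 2 < e]].
Proof.
move=> sp; have [p rp] := riesz_rep_exists d0 s0 hD sp.1.
have hF := invlap_hat_wL2 d0 s0 sp; have hp := rp.1.1.
pose u := clin (-1) p (invlap_hat phi); pose K := wscale s u.
have hu : wL2 s u by exact: wL2_clin.
have hK : wL2 (- s) K by exact: wL2_scaleN.
have ru : real_pairing s u.
  move=> chi sc; rewrite (Rint_dual_lin d0 (-1) sn0 hp hF); last exact/wL2_crot/hat_wL2.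
  by rewrite (closure_real_pairing d0 s0 rp.1)// (invlap_hat_real d0 s0 sp)// mulr0 addr0.
have rK : real_pairing (- s) K.
  move=> chi [sc _]; have hc := test_hat_wL2 d0 s0 sc.
  rewrite -(wform_real d0 sn0 hu hc ru (real_pairing_hat sc)).
  by apply: eq_Rint => xi; rewrite cdotC cdot_scale cdotC.
have fK := is_fourier_functional_of hK rK.
have dK := hdot_functional_of d0 nsn0 hK rK.
exists (functional_of K).
have approx e : 0 < e -> exists phi', [/\ S_H phi',
    hdot_norm (- s) (functional_of K \- dist_of phi') ^+ 2 < e &
    hdot_norm s (projHar s D (inv_laplacian s (schwartz_sub phi' phi))) ^+ 2 +
    hdot_dom_norm s D phi' ^+ 2 < e].
  move=> e0; have [phi' sp' lt] := hats_dense d0 sn0 hu ru e0; exists phi'; split=> //.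
    have fp' := is_fourier_dist_of sp'.1 (hat_wL2 d0 sp').
    by rewrite (hdot_norm_sq d0 nsn0 (is_fourier_sub d0 nsn0 fK fp')).
  rewrite wform_invlap_hat_dist// in lt.
  have [p' rp'] := riesz_rep_exists d0 s0 hD sp'.1; have hp' := rp'.1.1.
  have hF' := invlap_hat_wL2 d0 s0 sp'.
  have rd := riesz_rep_lin d0 s0 (-1) sp.1 sp'.1 rp rp'.
  have sd := schwartz_mom_lin (-1) sp sp'.
  rewrite (projHar_norm d0 s0 sd rd) (hdot_dom_norm_rep d0 s0 rp') invlap_hat_lin//.
  have hdF : wL2 s (clin (-1) (invlap_hat phi) (invlap_hat phi')) by exact: wL2_clin.
  have hdp : wL2 s (clin (-1) p p') by exact: wL2_clin.
  move: lt; rewrite /u !wform_sub_sq//.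
  rewrite !wform_linr// !wform_lin//.
  have := riesz_rep_invlap_hat sp rp rp.1; have := riesz_rep_invlap_hat sp rp rp'.1.
  have := riesz_rep_invlap_hat sp' rp' rp.1; have := riesz_rep_invlap_hat sp' rp' rp'.1.
  set F := invlap_hat phi; set F' := invlap_hat phi'.
  have := wformC s p' p; have := wformC s F p; have := wformC s F p'.
  have := wformC s F' p; have := wformC s F' p'; have := wformC s F' F.
  move: (wform s p p) (wform s p p') (wform s p' p) (wform s p' p') (wform s p F)
    (wform s p F') (wform s p' F) (wform s p' F') (wform s F p) (wform s F' p)
    (wform s F p') (wform s F' p') (wform s F F) (wform s F F') (wform s F' F) (wform s F' F').
  clear; move=> *; lra.
split.
- split=> // e e0; have e2 : 0 < e ^+ 2 by rewrite exprn_gt0.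
  have [phi' [sp' lt _]] := approx _ e2; exists phi' => //.
  by rewrite -(@ltr_pXn2r _ 2)// ?nnegrE ?sqrtr_ge0// ltW.
- move=> x supp Dx; apply: supp; exists D => //; split; first by case: hD.1.
  move=> g tg; have hg := test_hat_wL2 d0 s0 (test_schwartz tg).
  transitivity (wform s u (hat g)).
    by apply: eq_Rint => xi; rewrite cdotC cdot_scale cdotC.
  by rewrite wform_lin// rp.2// (invlap_hat_test d0 s0 sp tg) mulN1r addNr.
- move=> e e0; have e2 : 0 < e ^+ 2 by rewrite exprn_gt0.
  have m0 : 0 < Num.min e (e ^+ 2) by rewrite lt_min e0.
  have [phi' [sp' + lt]] := approx _ m0; exists phi'; split=> //.
    by rewrite -(@ltr_pXn2r _ 2)// ?nnegrE ?sqrtr_ge0 ?(ltW e0)// (lt_le_trans p0)// ge_min lexx orbT.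
  by rewrite (lt_le_trans lt)// ge_min lexx.
Qed.

End approximation.

(** * Gaussian variables *)

Section gaussian.
Context {R : realType}.
Local Notation leb := (@lebesgue_measure R).
Implicit Types (a b v m x z : R) (A : set R).

Lemma integral_mkindic A (f : R -> R) :
  (\int[leb]_(x in A) (f x)%:E = \int[leb]_x (f x * \1_A x)%:E)%E.
Proof.
rewrite integral_mkcond; apply: eq_integral => x _.
by rewrite patchE indicE; case: ifP => _; rewrite ?mulr1 ?mulr0.
Qed.

Lemma ge0_integral_normal_prob m v (f : R -> \bar R) :
  measurable_fun setT f -> (forall x, 0 <= f x)%E ->
  (\int[normal_prob m v]_x f x = \int[leb]_x (f x * (normal_pdf m v x)%:E))%E.
Proof.
move=> mf f0.
have dom : normal_prob m v `<< leb := @normal_prob_dominates R m v.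
have mpdf : measurable_fun setT (fun x => (normal_pdf m v x)%:E).
  by apply/measurable_EFinP; exact: measurable_normal_pdf.
rewrite -(Radon_Nikodym_SigmaFinite.change_of_variables dom)//.
apply: ae_eq_integral => //.
- apply: emeasurable_funM => //.
  exact: measurable_int (Radon_Nikodym_SigmaFinite.f_integrable dom).
- exact: emeasurable_funM.
- apply: ae_eqe_mul2l; apply: integral_ae_eq => //.
    exact: Radon_Nikodym_SigmaFinite.f_integrable.
  by move=> E _ mE; rewrite -Radon_Nikodym_SigmaFinite.f_integral.
Qed.

Lemma normal_pdf_varE m v x : 0 < v -> normal_pdf m (Num.sqrt v) x =
  (Num.sqrt (2 * pi * v))^-1 * expR (- (x - m) ^+ 2 / (2 * v)).
Proof.
move=> v0; rewrite normal_pdfE ?sqrtr_eq0 -?ltNge// /normal_peak /normal_fun.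
rewrite sqr_sqrtr ?ltW//; congr ((Num.sqrt _)^-1 * expR (_ / _)).
  by rewrite -mulr_natl; ring.
by rewrite -mulr_natl.
Qed.

Lemma normal_pdf_conv a b x z : 0 < a -> 0 < b ->
  normal_pdf 0 (Num.sqrt a) x * normal_pdf 0 (Num.sqrt b) (z - x) =
  normal_pdf 0 (Num.sqrt (a + b)) z *
  normal_pdf (a * z / (a + b)) (Num.sqrt (a * b / (a + b))) x.
Proof.
move=> a0 b0; have ab0 : 0 < a + b by exact: addr_gt0.
have c0 : 0 < a * b / (a + b) by rewrite divr_gt0// mulr_gt0.
have p0 : 0 < pi :> R by exact: pi_gt0.
rewrite !normal_pdf_varE// mulrACA [RHS]mulrACA -!expRD -!invfM -!sqrtrM; last 2 first.
  by rewrite !mulr_ge0// ltW.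
  by rewrite !mulr_ge0// ltW.
congr ((Num.sqrt _)^-1 * expR _).
  by field; rewrite gt_eqF.
by field; rewrite !gt_eqF.
Qed.

Lemma int_normal_pdf_conv a b z : 0 < a -> 0 < b ->
  (\int[leb]_x (normal_pdf 0 (Num.sqrt a) x * normal_pdf 0 (Num.sqrt b) (z - x))%:E =
   (normal_pdf 0 (Num.sqrt (a + b)) z)%:E)%E.
Proof.
move=> a0 b0; under eq_integral do rewrite normal_pdf_conv// EFinM.
rewrite ge0_integralZl//=.
- by rewrite integral_normal_pdf mule1.
- by apply/measurable_EFinP; exact: measurable_normal_pdf.
- by move=> x _; rewrite lee_fin normal_pdf_ge0.
- by rewrite lee_fin normal_pdf_ge0.
Qed.

Lemma normal_prob_conv a b A : 0 < a -> 0 < b -> measurable A ->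
  ((normal_prob 0 (Num.sqrt a) \x normal_prob 0 (Num.sqrt b)) [set z : R * R | A (z.1 + z.2)%R] =
   normal_prob 0 (Num.sqrt (a + b)) A)%E.
Proof.
move=> a0 b0 mA; set f := normal_pdf 0 (Num.sqrt a); set g := normal_pdf 0 (Num.sqrt b).
have mf : measurable_fun setT f by exact: measurable_normal_pdf.
have mg : measurable_fun setT g by exact: measurable_normal_pdf.
have f0 x : 0 <= f x by exact: normal_pdf_ge0.
have g0 x : 0 <= g x by exact: normal_pdf_ge0.
have mI : measurable_fun setT (\1_A : R -> R) by exact: measurable_indic.
have mgT (x : R) : measurable_fun setT (fun y => g y * \1_A (x + y)).
  apply: measurable_funM => //; apply: (measurableT_comp mI).
  exact: measurable_funD.
have sec x : normal_prob 0 (Num.sqrt b) (xsection [set z : R * R | A (z.1 + z.2)] x) =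
    (\int[leb]_z (g (z - x) * \1_A z)%:E)%E.
  rewrite /normal_prob integral_mkindic -/g.
  transitivity (\int[leb]_y (g y * \1_A (x + y))%:E)%E.
    by apply: eq_integral => y _; rewrite !indicE; congr (_ * (nat_of_bool _)%:R)%:E; rewrite mem_xsection; apply/idP/idP; rewrite !inE.
  rewrite (@ge0_integral_affine1 R (- x) 1)//.
  - rewrite normr1 mul1e; apply: eq_integral => z _.
    by rewrite mul1r addrA subrr add0r addrC.
  - by apply/measurable_EFinP.
  - by move=> y; rewrite lee_fin mulr_ge0// indicE.
have mh : measurable_fun setT (fun p : R * R => (f p.1 * (g (p.2 - p.1) * \1_A p.2))%:E).
  apply/measurable_EFinP; apply: measurable_funM.
    exact: (measurableT_comp mf measurable_fst).
  apply: measurable_funM; last exact: (measurableT_comp mI measurable_snd).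
  apply: (measurableT_comp mg); exact: measurable_funB.
have h0 (p : R * R) : (0 <= (f p.1 * (g (p.2 - p.1) * \1_A p.2))%:E)%E.
  by rewrite lee_fin !mulr_ge0// indicE.
have mgz x : measurable_fun setT (fun z => (g (z - x) * \1_A z)%:E).
  apply/measurable_EFinP; apply: measurable_funM => //.
  by apply: (measurableT_comp mg); exact: measurable_funB.
transitivity (\int[normal_prob 0 (Num.sqrt a)]_x (\int[leb]_z (g (z - x) * \1_A z)%:E))%E.
  by apply: eq_integral => x _; rewrite /= sec.
have mgI : measurable_fun setT (fun p : R * R => (g (p.2 - p.1) * \1_A p.2)%:E).
  apply/measurable_EFinP; apply: measurable_funM; last exact: (measurableT_comp mI measurable_snd).
  by apply: (measurableT_comp mg); exact: measurable_funB.
have gI0 (p : R * R) : (0 <= (g (p.2 - p.1) * \1_A p.2)%:E)%E.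
  by rewrite lee_fin mulr_ge0// indicE.
rewrite ge0_integral_normal_prob; last 2 first.
- have h := @measurable_fun_fubini_tonelli_F _ _ _ _ R leb _ mgI gI0; exact: h.
- by move=> x; apply: integral_ge0 => z _; rewrite lee_fin mulr_ge0// indicE.
transitivity (\int[leb]_x \int[leb]_z (f x * (g (z - x) * \1_A z))%:E)%E.
  apply: eq_integral => x _; rewrite muleC -ge0_integralZl//.
  - exact: mgz.
  - by move=> z _; rewrite lee_fin mulr_ge0// indicE.
  - by rewrite lee_fin.
have hF := @fubini_tonelli _ _ _ _ R leb leb _ mh h0.
apply: (etrans hF) => {hF}.
rewrite /normal_prob integral_mkindic; apply: eq_integral => z _.
rewrite EFinM -(int_normal_pdf_conv _ a0 b0) muleC -ge0_integralZl//.
- by apply: eq_integral => x _; rewrite -EFinM; congr EFin; rewrite /f /g; ring.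
- apply/measurable_EFinP; apply: measurable_funM => //.
  by apply: (measurableT_comp mg); exact: measurable_funB.
- by move=> x _; rewrite lee_fin mulr_ge0.
Qed.

Lemma normal_second_moment v : 0 < v ->
  (\int[normal_prob 0 (Num.sqrt v)]_x (x ^+ 2)%:E <= (8 * v)%:E)%E.
Proof.
move=> v0; have v20 : 0 < 2 * v by rewrite mulr_gt0.
have p0 : 0 < pi :> R by exact: pi_gt0.
have mx2 : measurable_fun setT (fun x : R => (x ^+ 2)%:E : \bar R).
  by apply/measurable_EFinP; exact: measurable_funX.
rewrite ge0_integral_normal_prob; last 2 first.
- exact: mx2.
- by move=> x; rewrite lee_fin sqr_ge0.
have -> : ((8 * v)%:E = \int[leb]_x ((8 * v)%:E * (normal_pdf 0 (Num.sqrt (2 * v)) x)%:E))%E.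
  rewrite ge0_integralZl//= ?integral_normal_pdf ?mule1//.
  - by apply/measurable_EFinP; exact: measurable_normal_pdf.
  - by move=> x _; rewrite lee_fin normal_pdf_ge0.
  - by rewrite lee_fin mulr_ge0// ltW.
have mp w : measurable_fun setT (fun x => (normal_pdf 0 w x)%:E : \bar R).
  by apply/measurable_EFinP; exact: measurable_normal_pdf.
apply: ge0_le_integral => //.
- by move=> x _; rewrite -EFinM lee_fin mulr_ge0 ?sqr_ge0 ?normal_pdf_ge0.
- exact: emeasurable_funM mx2 (mp _).
- exact: emeasurable_funM (measurable_cst _) (mp _).
move=> x _; rewrite -!EFinM lee_fin !normal_pdf_varE// subr0.
have sE : Num.sqrt (2 * pi * (2 * v)) <= 2 * Num.sqrt (2 * pi * v).
  have -> : (2 : R) = Num.sqrt (2 ^+ 2) by rewrite sqrtr_sqr ger0_norm.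
  rewrite -sqrtrM ?sqr_ge0// ler_sqrt; last first.
    by rewrite !mulr_ge0 ?sqrtr_ge0// ltW.
  rewrite !sqrtr_sqr !ger0_norm//; have := mulr_gt0 p0 v0; nra.
have q1 : 0 < Num.sqrt (2 * pi * v) by rewrite sqrtr_gt0 !mulr_gt0.
have q2 : 0 < Num.sqrt (2 * pi * (2 * v)) by rewrite sqrtr_gt0 !mulr_gt0.
have iE : (Num.sqrt (2 * pi * v))^-1 <= 2 * (Num.sqrt (2 * pi * (2 * v)))^-1.
  by rewrite ler_pdivlMr// mulrC ler_pdivrMr.
(* [u <= expR u] trades the factor [x ^+ 2] for a Gaussian of twice the variance. *)
pose u := x ^+ 2 / (4 * v).
have u0 : 0 <= u by rewrite divr_ge0 ?sqr_ge0// mulr_ge0// ltW.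
have xE : x ^+ 2 = 4 * v * u by rewrite /u; field; rewrite gt_eqF.
have -> : - x ^+ 2 / (2 * v) = - (u + u) by rewrite /u; field; rewrite gt_eqF.
have -> : - x ^+ 2 / (2 * (2 * v)) = - u by rewrite /u; field; rewrite gt_eqF.
rewrite xE opprD expRD.
have eu := expR_gt0 (- u).
have ue : u * expR (- u) <= 1.
  rewrite expRN ler_pdivrMr ?expR_gt0// mul1r.
  by apply: le_trans (expR_ge1Dx u); rewrite lerDr.
have -> : 4 * v * u * ((Num.sqrt (2 * pi * v))^-1 * (expR (- u) * expR (- u))) =
  4 * v * ((Num.sqrt (2 * pi * v))^-1 * ((u * expR (- u)) * expR (- u))) by ring.
have -> : 8 * v * ((Num.sqrt (2 * pi * (2 * v)))^-1 * expR (- u)) =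
  4 * v * (2 * (Num.sqrt (2 * pi * (2 * v)))^-1 * (1 * expR (- u))) by ring.
apply: ler_wpM2l; first by rewrite mulr_ge0// ltW.
apply: ler_pM => //.
- by do 2 (apply: mulr_ge0; last exact: ltW).
- by apply: ler_wpM2r => //; exact: ltW.
Qed.

End gaussian.

Section random_variables.
Context {disp : measure_display} {Omega : measurableType disp} {R : realType}.
Variable P : probability Omega R.
Implicit Types (X Y Z : Omega -> R) (a b v : R).

Lemma centered_gaussian_second_moment v X : 0 <= v -> centered_gaussian P v X ->
  (\int[P]_w ((X w) ^+ 2)%:E <= (8 * v)%:E)%E.
Proof.
move=> v0 [mX law].
pose mX' : measurable_fun setT (X : Omega -> measurableTypeR R) := mX.
have mx2 : measurable_fun setT (fun x : measurableTypeR R => ((x : R) ^+ 2)%:E : \bar R).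
  by apply/measurable_EFinP; exact: measurable_funX.
have := @ge0_integral_pushforward _ _ _ (measurableTypeR R) R X mX' P setT
  (fun x => ((x : R) ^+ 2)%:E) measurableT mx2.
rewrite preimage_setT => <-; last by move=> x _; rewrite lee_fin sqr_ge0.
pose m := measure_function_pushforward__canonical__measure_function_Measure P mX'.
have [v00|v1] := eqVneq v 0.
  rewrite (@eq_measure_integral _ _ R setT (\d_(0 : measurableTypeR R)) m); last first.
    by move=> A mA _; rewrite /m /= /pushforward law// v00 eqxx.
  by rewrite integral_dirac//= diracT mul1e v00 mulr0 expr0n.
have vp : 0 < v by rewrite lt_neqAle eq_sym v1.
rewrite (@eq_measure_integral _ _ R setT (normal_prob 0 (Num.sqrt v)) m).
  exact: normal_second_moment.
by move=> A mA _; rewrite /m /= /pushforward law// (negbTE v1).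
Qed.

Lemma prob_setI_ae (E S : set Omega) : measurable E -> measurable S -> P (~` E) = 0%E ->
  P S = P (S `&` E).
Proof.
move=> mE mS E0; apply/eqP; rewrite eq_le; apply/andP; split; last first.
  by apply: le_measure; rewrite ?inE//; exact: measurableI.
have mSE : measurable (S `&` E) by exact: measurableI.
have mcE : measurable (~` E) by exact: measurableC.
apply: (@le_trans _ _ (P ((S `&` E) `|` ~` E))).
  apply: le_measure; rewrite ?inE//; first exact: measurableU.
  by move=> w Sw; have [Ew|nE] := pselect (E w); [left|right].
apply: le_trans (measureU2 _ mSE mcE) _; rewrite -[leRHS]adde0 leeD//.
by rewrite le_eqVlt; apply/orP; left; apply/eqP; exact: E0.
Qed.

Lemma centered_gaussian_add0 b X Y : centered_gaussian P 0 X -> centered_gaussian P b Y ->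
  centered_gaussian P b (fun w => X w + Y w).
Proof.
move=> [mX lX] [mY lY]; split; first exact: measurable_funD.
move=> A mA; rewrite -lY//.
pose E := X @^-1` [set 0].
have pre Z B : measurable_fun setT Z -> measurable B -> measurable (Z @^-1` B).
  by move=> mZ mB; rewrite -[X in measurable X]setTI; exact: mZ.
have mE : measurable E by exact: pre.
have E0 : P (~` E) = 0%E.
  rewrite /E preimage_setC lX ?eqxx; last exact: measurableC.
  by rewrite diracE memNset//; apply.
rewrite (prob_setI_ae mE _ E0); last by apply: pre => //; exact: measurable_funD.
rewrite [RHS](prob_setI_ae mE _ E0); last exact: pre.
by congr (P _); apply/seteqP; split=> w [] /= + Ew; rewrite Ew add0r.
Qed.

Lemma centered_gaussian_add a b X Y : 0 <= a -> 0 <= b ->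
  centered_gaussian P a X -> centered_gaussian P b Y ->
  (forall A B : set R, measurable A -> measurable B ->
    P (X @^-1` A `&` Y @^-1` B) = (P (X @^-1` A) * P (Y @^-1` B))%E) ->
  centered_gaussian P (a + b) (fun w => X w + Y w).
Proof.
move=> a0 b0 hX hY indep.
have [a00|a1] := eqVneq a 0.
  by rewrite a00 add0r; rewrite a00 in hX; exact: centered_gaussian_add0.
have [b00|b1] := eqVneq b 0.
  rewrite b00 addr0; rewrite b00 in hY.
  by under eq_fun do rewrite addrC; exact: centered_gaussian_add0.
have ap : 0 < a by rewrite lt_neqAle eq_sym a1.
have bp : 0 < b by rewrite lt_neqAle eq_sym b1.
have [mX lX] := hX; have [mY lY] := hY.
split; first exact: measurable_funD.
move=> A mA; rewrite gt_eqF ?addr_gt0// -(normal_prob_conv ap bp mA).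
have mXY : measurable_fun setT
    ((fun w => (X w, Y w)) : Omega -> measurableTypeR R * measurableTypeR R).
  exact: measurable_fun_pair.
rewrite (@product_measure_unique _ _ _ _ R (normal_prob 0 (Num.sqrt a))
  (normal_prob 0 (Num.sqrt b))
  (measure_function_pushforward__canonical__measure_function_Measure P mXY))//=.
- move=> B C mB mC; rewrite /pushforward.
  have -> : (fun w => (X w, Y w)) @^-1` (B `*` C) = X @^-1` B `&` Y @^-1` C by [].
  by rewrite indep// lX// lY// (negbTE a1) (negbTE b1).
- have mD : measurable_fun setT (fun z : measurableTypeR R * measurableTypeR R => (z.1 : R) + z.2).
    exact: measurable_funD.
  by have := mD measurableT A mA; rewrite setTI.
Qed.

Lemma second_moment_add (c c' : R) X Y : measurable_fun setT X -> measurable_fun setT Y ->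
  (\int[P]_w ((X w) ^+ 2)%:E <= c%:E)%E -> (\int[P]_w ((Y w) ^+ 2)%:E <= c'%:E)%E ->
  (\int[P]_w ((X w + Y w) ^+ 2)%:E <= (2 * (c + c'))%:E)%E.
Proof.
move=> mX mY hX hY.
have mX2 : measurable_fun setT (fun w => ((X w) ^+ 2)%:E).
  by apply/measurable_EFinP; exact: measurable_funX.
have mY2 : measurable_fun setT (fun w => ((Y w) ^+ 2)%:E).
  by apply/measurable_EFinP; exact: measurable_funX.
apply: (@le_trans _ _ (\int[P]_w (2%:E * (((X w) ^+ 2)%:E + ((Y w) ^+ 2)%:E)))%E).
  apply: ge0_le_integral => //.
  - by move=> w _; rewrite lee_fin sqr_ge0.
  - by apply/measurable_EFinP; apply: measurable_funX; exact: measurable_funD.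
  - by apply: emeasurable_funM => //; exact: emeasurable_funD.
  - move=> w _; rewrite -EFinD -EFinM lee_fin; have := sqr_ge0 (X w - Y w); nra.
rewrite ge0_integralZl//; last 2 first.
- exact: emeasurable_funD.
- by move=> w _; rewrite -EFinD lee_fin addr_ge0 ?sqr_ge0.
rewrite ge0_integralD//; last 2 first.
- by move=> w _; rewrite lee_fin sqr_ge0.
- by move=> w _; rewrite lee_fin sqr_ge0.
by rewrite EFinM lee_pmul2l// EFinD leeD.
Qed.

Definition determined_events (G : set (set Omega)) : set (set Omega) :=
  [set A | exists2 B, <<s G >> B & P.-negligible ((A `\` B) `|` (B `\` A))].

Lemma determined_events_sigma G : sigma_algebra setT (determined_events G).
Proof.
have sG : sigma_algebra setT <<s G >> by exact: smallest_sigma_algebra.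
have [s0 sC sU] := sG; split.
- exists set0 => //; rewrite !setD0 setU0; exact: negligible_set0.
- move=> A [B GB nB]; exists (setT `\` B); first exact: sC.
  apply: negligibleS nB => w; rewrite !setTD /setD /setU /= => -[[nA nnB]|[nB nnA]].
    by right; split=> //; exact: contrapT.
  by left; split=> //; exact: contrapT.
- move=> A hA; have /choice[B hB] : forall n, exists B, <<s G >> B /\
      P.-negligible ((A n `\` B) `|` (B `\` A n)).
    by move=> n; have [B GB nB] := hA n; exists B.
  exists (\bigcup_n B n); first by apply: sU => n; exact: (hB n).1.
  apply: negligibleS (negligible_bigcup (fun n => (hB n).2)) => w.
  case=> [[[n _ An] nB]|[[n _ Bn] nA]]; exists n => //.
    by left; split=> // Bn; apply: nB; exists n.
  by right; split=> // An; apply: nA; exists n.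
Qed.

Lemma as_determined_gen (G0 G : set (set Omega)) :
  (forall A, G0 A -> determined_events G A) -> as_determined P <<s G0 >> <<s G >>.
Proof.
move=> h A GA; apply: (smallest_sub (determined_events_sigma G) _ GA); exact: h.
Qed.

Lemma L2_limit_determined (G : set (set Omega)) X (Z : nat -> Omega -> R) :
  measurable_fun setT X -> (forall n, measurable_fun setT (Z n)) ->
  (forall n (B : set R), measurable B -> <<s G >> (Z n @^-1` B)) ->
  (forall n, (\int[P]_w ((Z n w - X w) ^+ 2)%:E <= (8^-1 ^+ n)%:E)%E) ->
  forall B : set R, measurable B -> determined_events G (X @^-1` B).
Proof.
move=> mX mZ GZ hZ B mB.
have [E [mE E0 hE]] : exists E : set Omega, [/\ measurable E, P (~` E) = 0%E &
    forall w, E w -> exists M, forall n, (Z n w - X w) ^+ 2 <= M * 4^-1 ^+ n].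
  apply: (ae_fast_bound (g := fun n w => (Z n w - X w) ^+ 2)) => //.
  - by move=> n; apply: measurable_funX; exact: measurable_funB.
  - by move=> n w; exact: sqr_ge0.
have cv w : E w -> (fun n => Z n w) @ \oo --> X w.
  move=> /hE[M hM].
  have c4 : (fun n => M * 4^-1 ^+ n) @ \oo --> (0 : R).
    rewrite -(mulr0 M); apply: cvgM; first exact: cvg_cst.
    by apply: cvg_expr; rewrite ger0_norm// invf_lt1// ltr1n.
  apply/cvgrPdist_lt => e e0.
  have e2 : 0 < e ^+ 2 by rewrite exprn_gt0.
  have /cvgrPdist_lt/(_ _ e2) := c4; apply: filterS => n.
  rewrite sub0r normrN distrC => lt.
  rewrite -(@ltr_pXn2r _ 2)// ?nnegrE ?(ltW e0)// real_normK ?num_real//.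
  by apply: le_lt_trans (hM n) _; apply: le_lt_trans lt; exact: ler_norm.
pose f n : g_sigma_algebraType G -> \bar R := fun w => (Z n w)%:E.
have mf n : measurable_fun setT (f n).
  by apply/measurable_EFinP => _ A mA; rewrite setTI; exact: GZ.
have mL := measurable_fun_limn_esup mf.
pose L w := limn_esup (f^~ w).
exists (L @^-1` (EFin @` B)).
  by have := mL measurableT _ (measurable_image_EFin mB); rewrite setTI.
have LE w : E w -> L w = (X w)%:E.
  move=> Ew; apply: (cvg_limn_einf_sup _).2; apply: cvg_EFin; first exact: nearW.
  exact: cv.
exists (~` E); split; [exact: measurableC|exact: E0|].
move=> w [[Bw nL]|[Lw nB]] Ew.
  by apply: nL; rewrite /preimage /= LE//; exists (X w).
move: Lw; rewrite /preimage /= LE// => -[x Bx [xX]]; apply: nB.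
by rewrite /preimage /= -xX.
Qed.

End random_variables.

Section gaussian_free_field.
Context {R : realType} {d : nat}.
Hypothesis d0 : (0 < d)%N.
Variables (s : R) (D : set 'rV[R]_d).
Hypotheses (s0 : 0 < s) (hD_allow : allowable s D).
Context {disp : measure_display} {Omega : measurableType disp} (P : probability Omega R).
Variables hD hHar : Omega -> functional R d.
Hypotheses (hD_law : FGF_dom P s D hD) (hHar_law : harmonic_extension_field P s D hHar).
Implicit Types (phi psi : 'rV[R]_d -> R).
Local Notation S_H := (@schwartz_mom R d (hurst (d := d) s)).
Local Notation varHar phi := (hdot_norm s (projHar s D (inv_laplacian s phi)) ^+ 2).
Local Notation varD phi := (hdot_dom_norm s D phi ^+ 2).

Lemma dual_schwartz r (T : functional R d) : dual (-1) T -> dual r T.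
Proof.
move=> [lT [C [n bT]]]; have E : @schwartz_mom R d (-1) = schwartz.
  by apply: schwartz_mom_neg; rewrite ltrN10.
rewrite E in lT bT; split=> [c phi psi [sp _] [sq _]|]; first exact: lT.
by exists C, n => phi [sp _]; exact: bT.
Qed.

Let measurable_hD phi : schwartz phi -> measurable_fun setT (fun w => hD w phi).
Proof. by move=> sp; case: (hD_law.2 _ sp). Qed.

Let measurable_hHar phi : S_H phi -> measurable_fun setT (fun w => hHar w phi).
Proof. by move=> sp; case: (hHar_law.2 _ sp). Qed.

Let hD_sub w phi psi : schwartz phi -> schwartz psi ->
  hD w (schwartz_sub psi phi) = hD w psi - hD w phi.
Proof.
move=> sp sq; have [lD _] := dual_schwartz (-1) (hD_law.1.1 w).
by rewrite /schwartz_sub lD ?schwartz_mom_neg ?ltrN10// mulN1r addrC.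
Qed.

Let hHar_sub w phi psi : S_H phi -> S_H psi ->
  hHar w (schwartz_sub psi phi) = hHar w psi - hHar w phi.
Proof.
by move=> sp sq; have [lH _] := hHar_law.1.1 w; rewrite /schwartz_sub lH// mulN1r addrC.
Qed.

Let eps_gt0 n : 0 < 8^-1 ^+ n / 16 :> R.
Proof. by rewrite divr_gt0// exprn_gt0. Qed.

Lemma field_second_moment phi psi n : S_H phi -> schwartz psi ->
  varHar phi + varD psi < 8^-1 ^+ n / 16 ->
  (\int[P]_w ((hHar w phi + hD w psi) ^+ 2)%:E <= (8^-1 ^+ n)%:E)%E.
Proof.
move=> sp sq lt.
have := second_moment_add (measurable_hHar sp) (measurable_hD sq)
  (centered_gaussian_second_moment (sqr_ge0 _) (hHar_law.2 _ sp))
  (centered_gaussian_second_moment (sqr_ge0 _) (hD_law.2 _ sq)).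
move=> /le_trans; apply; rewrite lee_fin.
by move: lt; rewrite ltr_pdivlMr//; move: (varHar _) (varD _) => x y; lra.
Qed.

Lemma zero_boundary_approx phi n : schwartz phi -> exists2 psi, S_H psi &
  (\int[P]_w ((hHar w psi + hD w psi - hD w phi) ^+ 2)%:E <= (8^-1 ^+ n)%:E)%E.
Proof.
move=> sp; have [psi sq lt] := dom_norm_approx d0 s0 hD_allow sp (eps_gt0 n).
exists psi => //.
have sd : schwartz (schwartz_sub psi phi) by exact: schwartz_lin sp sq.1.
apply: le_trans (field_second_moment sq sd lt); rewrite le_eqVlt; apply/orP; left.
by apply/eqP; apply: eq_integral => w _; rewrite hD_sub ?addrA//; exact: sq.1.
Qed.

Lemma harmonic_ext_pairing phi : S_H phi -> exists psi : functional R d,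
  [/\ Tspace s psi, dist_supp psi `<=` ~` D
    & ext_pairing P s (fun w => hHar w \+ hD w) psi (fun w => hHar w phi)].
Proof.
move=> sp; have [psi [Tpsi supp approx]] := projHar_approx d0 s0 hD_allow sp.
exists psi; split=> //; split; first exact: measurable_hHar.
have /choice[phi_ hphi] := fun n => approx _ (eps_gt0 n).
have cvg8 : (fun n => 8^-1 ^+ n) @ \oo --> (0 : R).
  by apply: cvg_expr; rewrite ger0_norm// invf_lt1// ltr1n.
exists phi_; split.
- by move=> n; case: (hphi n).
- apply: (squeeze_cvgr _ (cvg_cst 0) cvg8); apply: nearW => n.
  have [_ lt _] := hphi n; rewrite sqrtr_ge0/= (le_trans (ltW lt))//.
  by rewrite ler_pdivrMr// ler_peMr ?exprn_ge0// ler1n.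
- apply: (@squeeze_cvge _ _ _ _ (fun=> 0%E) _ (fun n => (8^-1 ^+ n)%:E)).
  + apply: nearW => n; rewrite integral_ge0/=; last first.
      by move=> w _; rewrite lee_fin sqr_ge0.
    have [sn _ lt] := hphi n.
    have sd : S_H (schwartz_sub (phi_ n) phi) by exact: schwartz_mom_lin.
    apply: le_trans (field_second_moment sd sn.1 lt); rewrite le_eqVlt; apply/orP; left.
    apply/eqP; apply: eq_integral => w _; rewrite hHar_sub//=.
    by congr (_ ^+ 2)%:E; ring.
  + exact: cvg_cst.
  + by apply: cvg_EFin; [exact: nearW|exact: cvg8].
Qed.

Lemma sum_FGF : independent_sigma P (sigma_field schwartz hD) (sigma_field S_H hHar) ->
  FGF P s (fun w => hHar w \+ hD w).
Proof.
move=> indep; split; first split=> [w|phi sp].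
- have E : hHar w \+ hD w = (fun phi => 1 * hHar w phi + hD w phi).
    by apply/funext => phi; rewrite mul1r.
  by rewrite E; apply: dual_lin; [exact: hHar_law.1.1|exact/dual_schwartz/hD_law.1.1].
- by apply: measurable_funD; [exact: measurable_hHar|exact/measurable_hD/sp.1].
move=> phi sp; rewrite (norm_pythagoras d0 s0 hD_allow sp).
apply: centered_gaussian_add; [exact: sqr_ge0|exact: sqr_ge0|exact: hHar_law.2|
  exact: hD_law.2 sp.1|].
move=> A B mA mB; rewrite setIC muleC; apply: indep; apply: sub_sigma_algebra.
  by exists phi, B; split=> //; exact: sp.1.
by exists phi, A.
Qed.

End gaussian_free_field.

Theorem mainTheorem5 (R : realType) (d : nat) (hd : (0 < d)%N)
  (s : R) (hs : 0 < s)
  (D : set 'rV[R]_d) (hD_allow : allowable s D) (hD_proper : D `<` setT)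
  (disp : measure_display) (Omega : measurableType disp)
  (P : probability Omega R)
  (hD hHar : Omega -> functional R d)
  (hD_law : FGF_dom P s D hD)
  (hHar_law : harmonic_extension_field P s D hHar)
  (h_indep : independent_sigma P
     (sigma_field schwartz hD)
     (sigma_field (schwartz_mom (hurst (d := d) s)) hHar)) :
  let H : R := hurst (d := d) s in
  let h : Omega -> functional R d := fun w => hHar w \+ hD w in
  [/\ FGF P s h,
      as_determined P (sigma_field schwartz hD)
        (sigma_field (schwartz_mom H) h),
      as_determined P (sigma_field (schwartz_mom H) hHar)
        (sigma_field (schwartz_mom H) h)
    & as_determined P (sigma_field (test_fun D `&` schwartz_mom H) hHar)
        (sigma_outside P s D h)].
Proof.
move=> H h.
have hFGF : FGF P s h by exact: (sum_FGF hd hs hD_allow hD_law hHar_law h_indep).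
have mh phi : schwartz_mom H phi -> measurable_fun setT (fun w => h w phi).
  by move=> sp; case: (hFGF.2 _ sp).
have mD phi : schwartz phi -> measurable_fun setT (fun w => hD w phi).
  by move=> sp; case: (hD_law.2 _ sp).
have mHar phi : schwartz_mom H phi -> measurable_fun setT (fun w => hHar w phi).
  by move=> sp; case: (hHar_law.2 _ sp).
split=> //.
- apply: as_determined_gen => _ [phi [B [sp mB ->]]].
  have /choice[psi hpsi] : forall n, exists psi, schwartz_mom H psi /\
      (\int[P]_w ((hHar w psi + hD w psi - hD w phi) ^+ 2)%:E <= (8^-1 ^+ n)%:E)%E.
    by move=> n; have [psi] := zero_boundary_approx hd hs hD_allow hD_law hHar_law n sp; exists psi.
  apply: (L2_limit_determined (mD _ sp) (Z := fun n w => h w (psi n))) => //.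
  + by move=> n; apply: mh; case: (hpsi n).
  + move=> n A mA; apply: sub_sigma_algebra; exists (psi n), A; split=> //.
    by case: (hpsi n).
  + by move=> n; case: (hpsi n).
- apply: as_determined_gen => _ [phi [B [sp mB ->]]].
  have /choice[psi hpsi] : forall n, exists psi, schwartz_mom H psi /\
      (\int[P]_w ((hHar w psi + hD w psi - hD w phi) ^+ 2)%:E <= (8^-1 ^+ n)%:E)%E.
    by move=> n; have [psi] := zero_boundary_approx hd hs hD_allow hD_law hHar_law n sp.1; exists psi.
  have spsi n : schwartz_mom H (psi n) by case: (hpsi n).
  apply: (L2_limit_determined (mHar _ sp) (Z := fun n w => h w phi - h w (psi n))) => //.
  + by move=> n; apply: measurable_funB; exact: mh.
  + set G := [set A | _] => n A mA.
    have mG chi : schwartz_mom H chi ->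
        measurable_fun setT ((fun w => h w chi) : g_sigma_algebraType G -> R).
      move=> sc _ C mC; rewrite setTI; apply: sub_sigma_algebra.
      by exists chi, C.
    have hm : measurable_fun setT
        ((fun w => h w phi - h w (psi n)) : g_sigma_algebraType G -> R).
      by apply: measurable_funB; exact: mG.
    by have := hm measurableT A mA; rewrite setTI.
  + move=> n; have [_] := hpsi n; apply: le_trans; rewrite le_eqVlt; apply/orP; left.
    apply/eqP; apply: eq_integral => w _; rewrite /h /=.
    by congr EFin; ring.
- apply: as_determined_gen => _ [phi [B [[_ sp] mB ->]]].
  exists ((fun w => hHar w phi) @^-1` B); last by rewrite setDv setU0; exact: negligible_set0.
  apply: sub_sigma_algebra; exists (fun w => hHar w phi), B; split=> //.
  exact: (harmonic_ext_pairing hd hs hD_allow hD_law hHar_law sp).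
Qed.
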